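(* Let $\rho_u>0$ and let $\{X_K\}_{K\ge1}$ be a sequence of finite-dimensional subspaces of $H^1_0(\Omega)$ such that for every $\psi\in H^1_0(\Omega)$ there are $\psi_K\in X_K$ with $\|\psi-\psi_K\|_{H^1_0(\Omega)}\to0$ as $K\to\infty$. With $\mathcal{T}_\theta$, $\mathcal{T}_\theta^K$ and $\theta_{ro}$ as in the context, let $u_o$ be the unique minimizer over $u\in L_2(0,t_F)^m$ of $$\mathcal{J}(u)=\|\mathcal{T}_\theta[u]-\theta_{ro}\|^2_{L_2(\Omega)}+\rho_u\|u\|^2_{L_2(0,t_F)^m},$$ and, for each $K$, let $u_K$ be the unique minimizer over $u\in L_2(0,t_F)^m$ of $$\mathcal{J}_K(u)=\|\mathcal{T}_\theta^K[u]-\theta_{ro}\|^2_{L_2(\Omega)}+\rho_u\|u\|^2_{L_2(0,t_F)^m}.$$ Then $u_K\to u_o$ in the norm of $L_2(0,t_F)^m$ as $K\to\infty$.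
   Context: $\Omega\subset\mathbb{R}^d$ is a bounded, open, connected set, $t_F>0$, $m$ is a positive integer, $\langle\cdot,\cdot\rangle$ is the inner product of $L_2(\Omega)$. Coefficients $a^{ij}=a^{ji},b^i,c\in L_\infty(\Omega)$ are given and $$\mathbf{B}[u,v]=\int_\Omega\Big\{\sum_{i,j=1}^d a^{ij}u_{x_i}v_{x_j}+\sum_{i=1}^d b^iu_{x_i}v+cuv\Big\}dx,\qquad u,v\in H^1_0(\Omega).$$ $\mathbf{B}$ satisfies Gårding's inequality: there are $\kappa\ge0$, $\kappa_0>0$ with $\mathbf{B}[\phi,\phi]+\kappa\|\phi\|^2_{L_2(\Omega)}\ge\kappa_0\|\phi\|^2_{H^1_0(\Omega)}$ for all $\phi\in H^1_0(\Omega)$. The operator $A$ on $L_2(\Omega)$ is defined by $\langle -A[\phi],\psi\rangle=\mathbf{B}[\phi,\psi]$ for all $\psi\in H^1_0(\Omega)$, with $\operatorname{dom}(A)$ the set of $\phi\in H^1_0(\Omega)$ for which $\mathbf{B}[\phi,\cdot]$ is represented by an element of $L_2(\Omega)$; $A$ generates a $C_0$-semigroup $S_A(t)$ on $L_2(\Omega)$. For $f\in L_2(\Omega\times(0,t_F))$ and $g\in L_2(\Omega)$, $\underline\theta(t;f,g)=S_A(t)[g]+\int_0^tS_A(t-\tau)[f(\cdot,\tau)]d\tau$. Data: $\beta_{S1},\dots,\beta_{Sm}\in L_2(\Omega)$, $f_S\in L_2(\Omega\times(0,t_F))$, $g,\theta_r\in L_2(\Omega)$; $\theta_{ro}=\theta_r-\underline\theta(t_F;f_S,g)\in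 L_2(\Omega)$. The control-to-final-state operator $\mathcal{T}_\theta:L_2(0,t_F)^m\to L_2(\Omega)$ is $$\mathcal{T}_\theta[u]=\int_0^{t_F}S_A(t_F-\tau)\Big[\sum_{i=1}^m\beta_{Si}u_i(\tau)\Big]d\tau .$$ Finite-dimensional objects: $\mathcal{A}_K:X_K\to X_K$ is the linear operator with $\langle\mathcal{A}_K[\phi],\psi\rangle=-\mathbf{B}[\phi,\psi]$ for all $\phi,\psi\in X_K$; $S_K(t)=\sum_{\ell\ge0}\mathcal{A}_K^\ell t^\ell/\ell!$; $P_K$ is the orthogonal projection of $L_2(\Omega)$ onto $X_K$; and $$\mathcal{T}_\theta^K[u]=\int_0^{t_F}S_K(t_F-\tau)\Big[P_K\Big[\sum_{i=1}^m\beta_{Si}u_i(\tau)\Big]\Big]d\tau .$$ *)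

(* Defs.v *)
From HB Require Import structures.
From mathcomp Require Import all_boot all_order all_algebra.
From mathcomp Require Import all_classical all_reals all_analysis.
From mathcomp Require Import measurable_realfun.

Set Implicit Arguments.
Unset Strict Implicit.
Unset Printing Implicit Defensive.

Import Order.TTheory GRing.Theory Num.Theory.
Import numFieldNormedType.Exports.

Local Open Scope classical_set_scope.
Local Open Scope ring_scope.

(* The sigma-algebra of R^n is generated by the coordinate functions; it is the
   Borel one (see [open_measurable_rV] for the nontrivial inclusion).          *)
Section measurable_matrix.
Context {R : realType} (m n : nat).

Definition mx_cylinders : set (set 'M[R]_(m, n)) :=
  [set A | exists i j, exists2 B : set R,
     measurable B & A = [set x : 'M[R]_(m, n) | B (x i j)]].

Let mx0 : <<s mx_cylinders >> set0.
Proof. exact: sigma_algebra0. Qed.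

Let mxC A : <<s mx_cylinders >> A -> <<s mx_cylinders >> (~` A).
Proof. exact: sigma_algebraC. Qed.

Let mx_bigcup (F : (set 'M[R]_(m, n))^nat) :
  (forall i, <<s mx_cylinders >> (F i)) -> <<s mx_cylinders >> (\bigcup_i F i).
Proof. exact: sigma_algebra_bigcup. Qed.

HB.instance Definition _ := @isMeasurable.Build default_measure_display
  'M[R]_(m, n) <<s mx_cylinders >> mx0 mxC mx_bigcup.

End measurable_matrix.

Section measurable_matrix_lemmas.
Context {R : realType}.

Lemma measurable_mx_coord (m n : nat) i j :
  measurable_fun setT (fun x : 'M[R]_(m, n) => x i j).
Proof.
move=> _ B mB; rewrite setTI; apply: sub_sigma_algebra.
by exists i, j; exists B.
Qed.

Lemma measurable_mx_fun d (T : measurableType d) (m n : nat)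
    (f : T -> 'M[R]_(m, n)) :
  (forall i j, measurable_fun setT (fun t => f t i j)) -> measurable_fun setT f.
Proof.
move=> mf; apply: (@measurability _ _ _ _ _ _ (@mx_cylinders R m n)) => //.
move=> _ [_ [i [j [B mB ->]]] <-]; exact: mf.
Qed.

Lemma measurable_bigcapI (T : finType) d (X : measurableType d)
    (F : T -> set X) :
  (forall i, measurable (F i)) -> measurable [set x | forall i, F i x].
Proof.
move=> mF; have -> : [set x | forall i, F i x] = ~` (\bigcup_i ~` F i).
  by rewrite setC_bigcup; apply/seteqP; split => [x h i _|x h i];
    [rewrite setCK|rewrite -[F i]setCK; exact: h].
apply: measurableC; apply: countable_bigcupT_measurable => [|i].
  exact/countableP.
exact: measurableC.
Qed.

Lemma open_measurable_rV (n : nat) (A : set 'rV[R]_n) : open A -> measurable A.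
Proof.
move=> oA.
pose D (q : 'rV[rat]_n * rat) : set 'rV[R]_n :=
  [set x | forall j : 'I_n, `|ratr (q.1 ord0 j) - x ord0 j| < ratr q.2].
pose F q := if `[< D q `<=` A >] then D q else set0.
have -> : A = \bigcup_q F q.
  apply/seteqP; split => [x Ax|x [q _]]; last first.
    by rewrite /F; case: asboolP => // DA /DA.
  have /nbhs_ballP[e /= e0 eA] : nbhs x A by exact: open_nbhs_nbhs.
  have /rat_in_itvoo[r] : 0 < e / 2 by rewrite divr_gt0.
  rewrite in_itv/= => /andP[r0 re].
  have qP j : exists q : rat, `|ratr q - x ord0 j| < ratr r.
    have /rat_in_itvoo[q] : x ord0 j - ratr r < x ord0 j + ratr r.
      by rewrite ltrD2l gtrN.
    rewrite in_itv/= => /andP[q1 q2]; exists q.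
    by rewrite ltr_norml ltrBlDl ltrBrDl q2 q1.
  pose q := \row_j sval (cid (qP j)).
  exists (q, r) => //; rewrite /F; case: asboolP => [_ j|].
    by rewrite /= mxE; exact: (svalP (cid (qP j))).
  case=> y Dy; apply: eA; split => // i j; rewrite !ord1 /ball/=.
  rewrite -(subrKA (ratr (q ord0 j))) (splitr e) (le_lt_trans (ler_normD _ _))//.
  rewrite ltrD//.
    rewrite distrC (lt_trans _ re)// mxE; exact: (svalP (cid (qP j))).
  by rewrite (lt_trans _ re)//; exact: Dy.
apply: countable_bigcupT_measurable => [|q]; first exact/countableP.
rewrite /F; case: asboolP => // _.
apply: (@measurable_bigcapI 'I_n _ _
  (fun j => [set x : 'rV[R]_n | `|ratr (q.1 ord0 j) - x ord0 j| < ratr q.2])).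
move=> j.
have mf : measurable_fun setT
    (fun x : 'rV[R]_n => `|ratr (q.1 ord0 j) - x ord0 j|).
  apply: measurableT_comp => //; apply: measurable_funB => //.
  exact: measurable_mx_coord.
have mg : measurable_fun [set: 'rV[R]_n] (cst (ratr q.2 : R)).
  exact: measurable_cst.
have /(_ measurableT [set true]) := measurable_fun_ltr mf mg.
by rewrite setTI; exact.
Qed.

End measurable_matrix_lemmas.

(* Prepending a coordinate: R * R^n -> R^(n+1). *)
Definition cons_rV (R : realType) (n : nat) (p : R * 'rV[R]_n) : 'rV[R]_n.+1 :=
  \row_j if unlift ord0 j is Some k then p.2 ord0 k else p.1.

Lemma measurable_cons_rV (R : realType) (n : nat) :
  measurable_fun setT (@cons_rV R n).
Proof.
apply: measurable_mx_fun => i j; case: (unliftP ord0 j) => [k|] jE.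
  apply: (eq_measurable_fun ((fun x : 'rV[R]_n => x ord0 k) \o snd)) => [p _|].
    by rewrite /= mxE jE liftK.
  by apply: measurableT_comp; [exact: measurable_mx_coord|exact: measurable_snd].
apply: (eq_measurable_fun fst) => [p _|]; last exact: measurable_fst.
by rewrite mxE jE unlift_none.
Qed.

Section lebesgue_step.
Context {R : realType} (n : nat).
Variable mu : {sigma_finite_measure set 'rV[R]_n -> \bar R}.
Local Open Scope ereal_scope.

Definition lebesgue_cons : set 'rV[R]_n.+1 -> \bar R :=
  pushforward ((@lebesgue_measure R) \x mu) (@cons_rV R n).

Let lebesgue_cons0 : lebesgue_cons set0 = 0.
Proof. by rewrite /lebesgue_cons /pushforward preimage_set0 measure0. Qed.

Let lebesgue_cons_ge0 A : 0 <= lebesgue_cons A.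
Proof. by rewrite /lebesgue_cons /pushforward measure_ge0. Qed.

Let lebesgue_cons_sigma_additive : semi_sigma_additive lebesgue_cons.
Proof.
move=> F mF tF mUF; rewrite /lebesgue_cons /pushforward preimage_bigcup.
apply: measure_semi_sigma_additive.
- by move=> k; rewrite -[X in measurable X]setTI; exact: measurable_cons_rV.
- apply/trivIsetP => /= i j _ _ ij; rewrite -preimage_setI.
  by move/trivIsetP : tF => /(_ _ _ _ _ ij) ->//; rewrite preimage_set0.
- rewrite -preimage_bigcup -[X in measurable X]setTI.
  exact: measurable_cons_rV.
Qed.

HB.instance Definition _ := isMeasure.Build _ _ _ lebesgue_cons
  lebesgue_cons0 lebesgue_cons_ge0 lebesgue_cons_sigma_additive.

Let lebesgue_cons_sigma_finite : sigma_finite setT lebesgue_cons.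
Proof.
pose uncons (x : 'rV[R]_n.+1) : R * 'rV[R]_n :=
  (x ord0 ord0, \row_j x ord0 (lift ord0 j)).
have consK : cancel (@cons_rV R n) uncons.
  move=> [a v]; rewrite /uncons /cons_rV mxE unlift_none; congr pair.
  by apply/rowP => j; rewrite !mxE liftK.
have muncons : measurable_fun setT uncons.
  apply: measurable_fun_pair; first exact: measurable_mx_coord.
  apply: measurable_mx_fun => i j.
  apply: (eq_measurable_fun (fun x : 'rV[R]_n.+1 => x ord0 (lift ord0 j))).
    by move=> x _; rewrite mxE.
  exact: measurable_mx_coord.
have /sigma_finiteP[F [TF ndF Foo]] := sigma_finiteT (@lebesgue_measure R).
have /sigma_finiteP[G [TG ndG Goo]] := sigma_finiteT mu.
exists (fun k => uncons @^-1` (F k `*` G k)).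
  rewrite -preimage_bigcup; apply/seteqP; split => // x _.
  have [i _ Fi] : (\bigcup_i F i) (uncons x).1 by rewrite -TF.
  have [j _ Gj] : (\bigcup_i G i) (uncons x).2 by rewrite -TG.
  exists (maxn i j) => //; split.
    by apply: (subsetPset _ _ (ndF _ _ (leq_maxl i j))).
  by apply: (subsetPset _ _ (ndG _ _ (leq_maxr i j))).
move=> k; have [mFk Fk] := Foo k; have [mGk Gk] := Goo k.
have mFG : measurable (F k `*` G k) by exact: measurableX.
split; first by rewrite -[X in measurable X]setTI; exact: muncons.
rewrite /lebesgue_cons /pushforward -comp_preimage (_ : uncons \o _ = id).
  by rewrite preimage_id product_measure1E// lte_mul_pinfty// ge0_fin_numE.
exact/funext.
Qed.

HB.instance Definition _ := @Measure_isSigmaFinite.Build _ _ _ lebesgue_cons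
  lebesgue_cons_sigma_finite.

End lebesgue_step.

Fixpoint lebesgue_rV (R : realType) (n : nat) :
    {sigma_finite_measure set 'rV[R]_n -> \bar R} :=
  if n is k.+1 then lebesgue_cons (lebesgue_rV R k) else dirac (0 : 'rV[R]_0).

Lemma lebesgue_rV_box (R : realType) (n : nat) (a b : 'rV[R]_n) :
  (forall i, a ord0 i <= b ord0 i) ->
  lebesgue_rV R n [set x | forall i, x ord0 i \in `[a ord0 i, b ord0 i]] =
    (\prod_(i < n) (b ord0 i - a ord0 i))%:E.
Proof.
elim: n a b => [|n IH] a b ab.
  by rewrite /= diracE mem_set// ?big_ord0//; case.
pose tl (v : 'rV[R]_n.+1) : 'rV[R]_n := \row_j v ord0 (lift ord0 j).
pose Q := [set x : 'rV[R]_n |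
  forall i, x ord0 i \in `[tl a ord0 i, tl b ord0 i]].
have mQ : measurable Q.
  apply: (@measurable_bigcapI 'I_n _ _ (fun i =>
    [set x : 'rV[R]_n | x ord0 i \in `[tl a ord0 i, tl b ord0 i]])) => i.
  rewrite -[X in measurable X]setTI.
  have := @measurable_mx_coord R 1 n ord0 i measurableT _
    (measurable_itv `[tl a ord0 i, tl b ord0 i]).
  by apply.
rewrite /= /lebesgue_cons /pushforward.
rewrite (_ : _ @^-1` _ = `[a ord0 ord0, b ord0 ord0]%classic `*` Q); last first.
  apply/seteqP; split => [[t v] /= h|[t v] [/= ht hv] i].
    split => [|i]; first by have := h ord0; rewrite mxE unlift_none.
    by have := h (lift ord0 i); rewrite mxE liftK /tl !mxE.
  rewrite mxE; case: unliftP => [j|] -> //.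
  by have := hv j; rewrite !mxE.
have lI : (@lebesgue_measure R) `[a ord0 ord0, b ord0 ord0]%classic =
    (b ord0 ord0 - a ord0 ord0)%:E.
  rewrite lebesgue_measure_itv/= lte_fin.
  have := ab ord0; rewrite le_eqVlt => /predU1P[->|->//].
  by rewrite ltxx subrr.
rewrite product_measure1E// [X in (X * _)%E]lI [X in (_ * X)%E]IH => [|i].
  by rewrite big_ord_recl EFinM; under eq_bigr do rewrite !mxE.
by rewrite !mxE.
Qed.

(* Elements of L_2 and L_oo are represented by functions, without passing to
   the quotient: identities between elements are identities almost everywhere,
   and limits are limits for the L_2 seminorm. An object that is unique only up
   to a null set (limit, projection, weak derivative, Bochner integral) is
   picked by [xget] among its representatives.                                *)
Notation L2 mu := (LfunType mu (lee1n 2)).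
Notation Loo mu := (LfunType mu (leey 1)).

Section L2_space.
Context {d} {T : measurableType d} {R : realType}.
Context {mu : {measure set T -> \bar R}}.
Implicit Types (f g w : L2 mu) (X : set (L2 mu)).

Definition l2norm f : R := fine ('N[mu]_2%:E[EFin \o f])%E.

Definition l2dot f g : R := \int[mu]_x (f x * g x).

Definition fin_dim_subspace X := exists n (e : 'I_n -> L2 mu),
  X = [set f | exists c : 'I_n -> R, f = \sum_i c i *: e i %[ae mu]].

Definition orth_proj X f : L2 mu :=
  xget 0 [set p | X p /\ forall g, X g -> l2dot (f - p) g = 0].

Definition exp_op (L : L2 mu -> L2 mu) (t : R) f : L2 mu :=
  xget 0 [set w | l2norm (\sum_(l < n) (t ^+ l / l`!%:R) *: iter l L f - w)
                    @[n --> \oo] --> 0].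

Definition C0_semigroup (S : R -> L2 mu -> L2 mu) :=
  [/\ forall t (k : R) f g, 0 <= t ->
        S t (k *: f + g) = k *: S t f + S t g %[ae mu],
      forall t, 0 <= t -> exists C, forall f, l2norm (S t f) <= C * l2norm f,
      forall f, S 0 f = f %[ae mu],
      forall s t f, 0 <= s -> 0 <= t -> S (s + t) f = S s (S t f) %[ae mu] &
      forall f, l2norm (S t f - f) @[t --> 0^'+] --> 0].

(* The graph of the infinitesimal generator of S. *)
Definition generator (S : R -> L2 mu -> L2 mu) f g :=
  l2norm (h^-1 *: (S h f - f) - g) @[h --> 0^'+] --> 0.

(* Bochner integral over D of F : I -> L2 mu: the simple functions
   t |-> \sum_(k < N n) \1_(E n k t) * x n k approximate F in L_1(D; L2 mu),
   and their integrals converge to w.                                         *)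
Definition is_bochner d' (I : measurableType d')
    (nu : {measure set I -> \bar R}) (D : set I) (F : I -> L2 mu) w :=
  exists (N : nat -> nat) (E : nat -> nat -> set I) (x : nat -> nat -> L2 mu),
    let s n t := \sum_(k < N n) (\1_(E n k) t : R) *: x n k in
    [/\ forall n k, [/\ measurable (E n k), E n k `<=` D & (nu (E n k) < +oo)%E],
        forall n, measurable_fun D (fun t => l2norm (F t - s n t)),
        (\int[nu]_(t in D) (l2norm (F t - s n t))%:E)%E @[n --> \oo] --> 0%E &
        l2norm (\sum_(k < N n) fine (nu (E n k)) *: x n k - w)
          @[n --> \oo] --> 0].

Definition bochner d' (I : measurableType d')
    (nu : {measure set I -> \bar R}) (D : set I) (F : I -> L2 mu) : L2 mu :=
  xget 0 [set w | is_bochner nu D F w].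

End L2_space.

Section sobolev.
Context {R : realType} {d : nat} {O : set 'rV[R]_d} (oO : open O).

(* Lebesgue measure restricted to O: an element of [L2 dom_measure] is a
   function on R^d whose values outside O are irrelevant.                     *)
Definition dom_measure : {measure set 'rV[R]_d -> \bar R} :=
  mrestr (lebesgue_rV R d) (open_measurable_rV oO).

Local Notation L2O := (L2 dom_measure).

Definition partial (i : 'I_d) (f : 'rV[R]_d -> R) : 'rV[R]_d -> R :=
  fun x => 'D_(delta_mx ord0 i) f x.

(* C_c^oo(O): all iterated partial derivatives of f are differentiable. *)
Definition test_function (f : 'rV[R]_d -> R) :=
  (forall (s : seq 'I_d) x, differentiable (foldr partial f s) x) /\
  exists K, [/\ compact K, K `<=` O & forall x, ~ K x -> f x = 0].

Definition is_weak_partial (i : 'I_d) (u g : L2O) :=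
  forall f, test_function f ->
    \int[dom_measure]_x (u x * partial i f x) = - \int[dom_measure]_x (g x * f x).

Definition weak_partial (i : 'I_d) (u : L2O) : L2O :=
  xget 0 [set g | is_weak_partial i u g].

Definition H1 : set L2O := [set u | forall i, exists g, is_weak_partial i u g].

Definition h1norm (u : L2O) : R :=
  Num.sqrt (l2norm u ^+ 2 + \sum_(i < d) l2norm (weak_partial i u) ^+ 2).

Definition H10 : set L2O := [set u | H1 u /\
  exists f : nat -> L2O, (forall n, test_function (f n)) /\
    h1norm (u - f n) @[n --> \oo] --> 0].

Definition bform (a : 'I_d -> 'I_d -> Loo dom_measure)
    (b : 'I_d -> Loo dom_measure) (c : Loo dom_measure) (u v : L2O) : R :=
  \int[dom_measure]_x
    (\sum_(i < d) \sum_(j < d) a i j x * weak_partial i u x * weak_partial j v x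
     + \sum_(i < d) b i x * weak_partial i u x * v x + c x * u x * v x).

(* The graph of A. *)
Definition form_operator (B : L2O -> L2O -> R) (u w : L2O) :=
  H10 u /\ forall v, H10 v -> l2dot (- w) v = B u v.

Definition galerkin_op (B : L2O -> L2O -> R) (X : set L2O) (u : L2O) : L2O :=
  xget 0 [set w | X w /\ forall v, X v -> l2dot w v = - B u v].

End sobolev.

Section control.
Context {R : realType}.

Definition time_measure (tF : R) : {measure set (measurableTypeR R) -> \bar R} :=
  mrestr (@lebesgue_measure R) (measurable_itv `]0, tF[).

Definition cyl_measure (d : nat) (O : set 'rV[R]_d) (oO : open O) (tF : R) :
    {measure set ('rV[R]_d * measurableTypeR R)%type -> \bar R} :=
  mrestr (lebesgue_rV R d \x @lebesgue_measure R)%E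
    (measurableX (open_measurable_rV oO) (measurable_itv `]0, tF[)).

Definition ctrl (m : nat) (tF : R) : Type := 'I_m -> L2 (time_measure tF).

Definition ctrl_norm (m : nat) (tF : R) (u : ctrl m tF) : R :=
  Num.sqrt (\sum_(i < m) l2norm (u i) ^+ 2).

Section states.
Context {d : nat} {O : set 'rV[R]_d} (oO : open O) (tF : R).
Local Notation L2O := (L2 (dom_measure oO)).

(* f(., tau), which lies in L_2 for almost every tau; 0 for the other tau. *)
Definition time_slice (f : L2 (cyl_measure oO tF)) (tau : R) : L2O :=
  insubd (0 : L2O) (fun x => f (x, tau)).

Definition free_state (S : R -> L2O -> L2O) (t : R)
    (f : L2 (cyl_measure oO tF)) (g : L2O) : L2O :=
  S t g + bochner (@lebesgue_measure R) `]0, t[%classic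
            (fun tau => S (t - tau) (time_slice f tau)).

Definition ctrl_to_state (m : nat) (S : R -> L2O -> L2O) (beta : 'I_m -> L2O)
    (u : ctrl m tF) : L2O :=
  bochner (@lebesgue_measure R) `]0, tF[%classic
    (fun tau => S (tF - tau) (\sum_(i < m) u i tau *: beta i)).

Definition cost (m : nat) (Theta : ctrl m tF -> L2O) (theta_ro : L2O) (rho : R)
    (u : ctrl m tF) : R :=
  l2norm (Theta u - theta_ro) ^+ 2 + rho * ctrl_norm u ^+ 2.

End states.

End control.

Definition is_minimizer (U : Type) (R : realType) (J : U -> R) (u : U) :=
  forall v, J u <= J v.

(* Main.v *)
Require Import Defs.
From mathcomp Require Import all_boot all_order all_algebra.
From mathcomp Require Import all_classical all_reals all_analysis.
From mathcomp Require Import measurable_realfun ess_sup_inf ring lra.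

(* The Galerkin semigroups converge to S_A strongly, uniformly on [0, t_F]. For f
   in dom A the points phi_j = S_A(t_j) f of a fine time grid lie in dom A, hence
   in H^1_0, and for K large they have approximations psi_j in X_K. Garding's
   inequality and Gronwall's lemma bound the distance in L_2 from S_K(t) P_K f to
   the piecewise affine path through the psi_j. Since the semigroups are bounded
   uniformly in K on [0, t_F], convergence for f in dom A gives it for all f.

   The form B is bilinear on H^1 only if weak derivatives are unique, and this
   needs the test functions to be dense in L_2. They are, because dom A, which is
   contained in H^1_0, is dense as the domain of the generator of a C_0-semigroup.

   Hence T^K u -> T u in L_2, uniformly for u in bounded sets. The minimizers u_K
   are bounded, so J(u_K) -> min J, and the strong convexity of J gives the
   convergence of u_K to u_o. *)

Set Implicit Arguments.
Unset Strict Implicit.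
Unset Printing Implicit Defensive.

Import Order.TTheory GRing.Theory Num.Theory.
Import numFieldNormedType.Exports.

Local Open Scope classical_set_scope.
Local Open Scope ring_scope.

(** * The space L2 *)

Section L2_theory.
Context {d} {T : measurableType d} {R : realType}.
Context {mu : {measure set T -> \bar R}}.
Implicit Types (f g h : L2 mu) (k : R).

(** Weak derivatives, projections, exponentials and Bochner integrals are chosen by [xget], so
    identities hold only up to null sets. They are therefore tested: [l2eq] is equality of all inner
    products, vector identities become identities of reals, and Bochner integrals, derivatives of
    $S_K$ and the control-to-state maps are handled through their pairings.

    The obstacle in the semigroup estimate is that the density of the $X_K$ approximates each single
    element of $H^1_0$, with neither a rate nor any regularity in time. A finite time grid cures
    both: finitely many points share one index $K_0$, and the interpolant is differentiable on each
    cell. Its slope is a difference quotient, so the approximation error must be small compared with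
    the step. Hence the step is fixed first, from the strong continuity of $S_A$ at $f$ and $Af$,
    and only then the tolerance in $H^1_0$. At a grid point $B(\phi_j,\cdot)$ is the $L_2$ pairing
    with $-A\phi_j$, so the error equation contains $B$ only at $\phi_j-\psi_j$ and at the error
    itself, where Garding's inequality applies. *)

Lemma l2dot_integrable f g :
  mu.-integrable setT (EFin \o (fun x => f x * g x)).
Proof.
by have /Lfun1_integrable := Lfun2_mul_Lfun1 (LfunP f) (LfunP g).
Qed.

Lemma l2dotC f g : l2dot f g = l2dot g f.
Proof. by apply: eq_Rintegral => x _; rewrite mulrC. Qed.

Lemma l2dotDl f g h : l2dot (f + g) h = l2dot f h + l2dot g h.
Proof.
rewrite /l2dot -RintegralD//; [|exact: l2dot_integrable..].
by apply: eq_Rintegral => x _; rewrite mulrDl.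
Qed.

Lemma l2dotZl k f g : l2dot (k *: f) g = k * l2dot f g.
Proof.
rewrite /l2dot -RintegralZl//; last exact: l2dot_integrable.
by apply: eq_Rintegral => x _; rewrite mulrA.
Qed.

Lemma l2dotDr f g h : l2dot f (g + h) = l2dot f g + l2dot f h.
Proof. by rewrite l2dotC l2dotDl ![l2dot _ f]l2dotC. Qed.

Lemma l2dotZr k f g : l2dot f (k *: g) = k * l2dot f g.
Proof. by rewrite l2dotC l2dotZl l2dotC. Qed.

Lemma l2dotNl f g : l2dot (- f) g = - l2dot f g.
Proof. by rewrite -scaleN1r l2dotZl mulN1r. Qed.

Lemma l2dotNr f g : l2dot f (- g) = - l2dot f g.
Proof. by rewrite l2dotC l2dotNl l2dotC. Qed.

Lemma l2dotBl f g h : l2dot (f - g) h = l2dot f h - l2dot g h.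
Proof. by rewrite l2dotDl l2dotNl. Qed.

Lemma l2dotBr f g h : l2dot f (g - h) = l2dot f g - l2dot f h.
Proof. by rewrite l2dotDr l2dotNr. Qed.

Lemma l2dot0l f : l2dot 0 f = 0.
Proof. by rewrite -(scale0r f) l2dotZl mul0r. Qed.

Lemma l2dot_suml (I : Type) (r : seq I) (P : pred I) (F : I -> L2 mu) g :
  l2dot (\sum_(i <- r | P i) F i) g = \sum_(i <- r | P i) l2dot (F i) g.
Proof.
by apply: (big_morph (l2dot^~ g)) => [f h|]; rewrite (l2dotDl, l2dot0l).
Qed.

Lemma l2dot_sumr (I : Type) (r : seq I) (P : pred I) (F : I -> L2 mu) g :
  l2dot g (\sum_(i <- r | P i) F i) = \sum_(i <- r | P i) l2dot g (F i).
Proof. by rewrite l2dotC l2dot_suml; apply: eq_bigr => i _; rewrite l2dotC. Qed.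

Lemma l2norm_ge0 f : 0 <= l2norm f.
Proof. by rewrite /l2norm fine_ge0// Lnorm_ge0. Qed.

Lemma l2dotff f : l2dot f f = l2norm f ^+ 2.
Proof.
have n2 := @powR_Lnorm _ _ _ mu (EFin \o f) 2 (lt0r_neq0 (ltr0Sn R 1)).
apply/EFin_inj; rewrite -powR_mulrn ?l2norm_ge0// -poweR_EFin.
rewrite finite_norm_fine n2 /l2dot /Rintegral fineK; last first.
  exact/integrable_fin_num/l2dot_integrable.
apply: eq_integral => x _ /=.
by rewrite powR_mulrn// real_normK ?num_real// expr2.
Qed.

Lemma l2dot_ge0 f : 0 <= l2dot f f.
Proof. by rewrite l2dotff sqr_ge0. Qed.

Lemma l2normE f : l2norm f = Num.sqrt (l2dot f f).
Proof. by rewrite l2dotff sqrtr_sqr ger0_norm// l2norm_ge0. Qed.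

Lemma l2norm_cauchy f g : `|l2dot f g| <= l2norm f * l2norm g.
Proof.
(* The discriminant argument, with [t] chosen by hand: the vertex [- a / b] gives [c <= a * b] when
   both are nonzero. When one of them vanishes, another [t] makes the quadratic negative unless
   [c <= 0]. *)
have H (a b c : R) : 0 <= a -> 0 <= b ->
    (forall t, 0 <= a ^+ 2 + t * c *+ 2 + t ^+ 2 * b ^+ 2) -> c <= a * b.
  move=> a0 b0 h; have [b00|bn0] := eqVneq b 0.
    rewrite b00 mulr0 leNgt; apply/negP => c0.
    have := h (- (a ^+ 2 + 1) / (c *+ 2)); rewrite b00 expr0n mulr0 addr0.
    have -> : a ^+ 2 + - (a ^+ 2 + 1) / (c *+ 2) * c *+ 2 = - 1.
      by field; lra.
    by lra.
  have bp : 0 < b by rewrite lt_neqAle eq_sym bn0.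
  have := h (- a / b).
  have -> : a ^+ 2 + - a / b * c *+ 2 + (- a / b) ^+ 2 * b ^+ 2 =
     (a / b) *+ 2 * (a * b - c) by field; lra.
  have [a00|an0] := eqVneq a 0.
    move=> _; have := h (- c / b ^+ 2).
    have -> : a ^+ 2 + - c / b ^+ 2 * c *+ 2 + (- c / b ^+ 2) ^+ 2 * b ^+ 2 =
      - (c / b) ^+ 2 by rewrite a00; field; lra.
    rewrite a00 oppr_ge0 mul0r => cb.
    have /eqP : (c / b) ^+ 2 = 0 by apply/le_anti; rewrite cb sqr_ge0.
    by rewrite sqrf_eq0 mulf_eq0 invr_eq0 (negbTE bn0) orbF => /eqP ->.
  rewrite pmulr_rge0 ?subr_ge0// pmulrn_rgt0// divr_gt0//.
  by rewrite lt_neqAle eq_sym an0.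
have {}H f' g' : l2dot f' g' <= l2norm f' * l2norm g'.
  apply: H; rewrite ?l2norm_ge0// => t; rewrite -!l2dotff.
  have := l2dot_ge0 (f' + t *: g').
  rewrite l2dotDl !l2dotDr !l2dotZl !l2dotZr (l2dotC g' f').
  by congr (0 <= _); ring.
rewrite ler_norml H andbT lerNl -l2dotNl; apply: le_trans (H _ _) _.
by rewrite (l2normE (- f)) l2dotNl l2dotNr opprK -l2normE.
Qed.

Lemma l2dot_le f g : l2dot f g <= l2norm f * l2norm g.
Proof. exact: le_trans (ler_norm _) (l2norm_cauchy f g). Qed.

Lemma l2normZ k f : l2norm (k *: f) = `|k| * l2norm f.
Proof.
rewrite !l2normE l2dotZl l2dotZr mulrA -expr2 sqrtrM ?sqr_ge0//.
by rewrite sqrtr_sqr.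
Qed.

Lemma l2normN f : l2norm (- f) = l2norm f.
Proof. by rewrite -scaleN1r l2normZ normrN1 mul1r. Qed.

Lemma l2norm0 : l2norm (0 : L2 mu) = 0.
Proof. by rewrite l2normE l2dot0l sqrtr0. Qed.

Lemma l2normD f g : l2norm (f + g) <= l2norm f + l2norm g.
Proof. exact: ler_LnormD. Qed.

Lemma l2normB f g : l2norm (f - g) <= l2norm f + l2norm g.
Proof. by rewrite (le_trans (l2normD _ _))// l2normN. Qed.

Lemma l2distC f g : l2norm (f - g) = l2norm (g - f).
Proof. by rewrite -l2normN opprB. Qed.

Lemma l2dist_triangle f g h :
  l2norm (f - h) <= l2norm (f - g) + l2norm (g - h).
Proof. by rewrite -(subrKA g) l2normD. Qed.

Lemma l2norm_sum (I : Type) (r : seq I) (P : pred I) (F : I -> L2 mu) :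
  l2norm (\sum_(i <- r | P i) F i) <= \sum_(i <- r | P i) l2norm (F i).
Proof.
apply: (big_ind2 (fun f k => l2norm f <= k)) => [|f a g b fa gb|//].
  by rewrite l2norm0.
by rewrite (le_trans (l2normD _ _))// lerD.
Qed.

(** Test with [g = f]. Through this lemma norms of Bochner integrals are bounded although only their
    pairings are computed. *)
Lemma l2norm_dual f k : 0 <= k ->
  (forall g, l2dot f g <= k * l2norm g) -> l2norm f <= k.
Proof.
move=> k0 /(_ f); rewrite l2dotff expr2.
have [->//|n0] := eqVneq (l2norm f) 0.
by rewrite ler_pM2r// lt_neqAle eq_sym n0 l2norm_ge0.
Qed.

(** Almost everywhere equality in weak form, see [ae_l2eq]. In this form it can be rewritten with
    under [l2dot], and linear identities are closed by [ring]. *)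
Definition l2eq f g := forall h, l2dot f h = l2dot g h.

Lemma l2eq_refl f : l2eq f f. Proof. by []. Qed.

Lemma l2eq_sym f g : l2eq f g -> l2eq g f.
Proof. by move=> fg h; rewrite fg. Qed.

Lemma l2eq_trans g f h : l2eq f g -> l2eq g h -> l2eq f h.
Proof. by move=> fg gh w; rewrite fg gh. Qed.

Lemma l2eqP f g : l2eq f g <-> l2norm (f - g) = 0.
Proof.
split=> [fg|fg h]; first by rewrite l2normE l2dotBl fg subrr sqrtr0.
apply/eqP; rewrite -subr_eq0 -l2dotBl -normr_le0.
by rewrite (le_trans (l2norm_cauchy _ _))// fg mul0r.
Qed.

Lemma l2eq_norm f g : l2eq f g -> l2norm f = l2norm g.
Proof. by move=> fg; rewrite !l2normE fg l2dotC fg. Qed.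

Lemma l2eqD f f' g g' : l2eq f f' -> l2eq g g' -> l2eq (f + g) (f' + g').
Proof. by move=> ff gg h; rewrite !l2dotDl ff gg. Qed.

Lemma l2eqN f f' : l2eq f f' -> l2eq (- f) (- f').
Proof. by move=> ff h; rewrite !l2dotNl ff. Qed.

Lemma l2eqB f f' g g' : l2eq f f' -> l2eq g g' -> l2eq (f - g) (f' - g').
Proof. by move=> ff gg; apply: l2eqD => //; exact: l2eqN. Qed.

Lemma l2eq_sum (I : Type) (r : seq I) (P : pred I) (F G : I -> L2 mu) :
  (forall i, P i -> l2eq (F i) (G i)) ->
  l2eq (\sum_(i <- r | P i) F i) (\sum_(i <- r | P i) G i).
Proof. by move=> FG h; rewrite !l2dot_suml; apply: eq_bigr => i /FG. Qed.

Lemma ae_l2eq f g : f = g %[ae mu] <-> l2eq f g.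
Proof.
split=> [fg h|/l2eqP/fine_Lnormr_eq0].
  congr fine; apply: ae_eq_integral => //.
  - by apply/measurable_EFinP; exact: measurable_funM.
  - by apply/measurable_EFinP; exact: measurable_funM.
  - by apply: filterS fg => x /[apply] ->.
apply: filterS => x /[apply] /= fg.
by apply/eqP; rewrite -subr_eq0; apply/eqP; exact: fg.
Qed.

End L2_theory.

Lemma lee_limn_einf (R : realType) (u v : nat -> \bar R) :
  (forall n, (u n <= v n)%E) -> (limn_einf u <= limn_einf v)%E.
Proof.
move=> uv; rewrite !limn_einf_lim; apply: lee_lim; [exact: is_cvg_einfs..|].
apply: nearW => n; apply: le_ereal_inf_tmp => _ [m /= nm <-].
by apply: le_trans (uv m); apply: ereal_inf_lbound; exists m.
Qed.

(** * Completeness of L2 (Riesz-Fischer) *)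

Section L2_complete.
Context {d} {T : measurableType d} {R : realType}.
Context {mu : {measure set T -> \bar R}}.
Implicit Types (f g h : L2 mu).

Lemma sqr_int_Lfun (f : T -> R) : measurable_fun setT f ->
  (\int[mu]_x (f x ^+ 2)%:E < +oo)%E -> f \in Lfun mu 2%:E.
Proof.
move=> mf ioo; rewrite inE; apply/andP; split; rewrite inE//=.
rewrite /finite_norm unlock /Lnorm; apply: poweR_lty.
under eq_integral => x _ do rewrite poweR_EFin powR_mulrn// real_normK ?num_real//.
exact: ioo.
Qed.

Lemma l2norm_sqr_int f : ((l2norm f ^+ 2)%:E = \int[mu]_x (f x ^+ 2)%:E)%E.
Proof.
rewrite -l2dotff /l2dot /Rintegral fineK; last first.
  exact/integrable_fin_num/l2dot_integrable.
by apply: eq_integral.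
Qed.

(** The weighted sum of [4 ^+ n * (v n.+1 - v n) ^+ 2] has a finite integral, since its terms
    integrate to at most [4^-1 ^+ n]. Hence it is finite almost everywhere, and there the increments
    are bounded by a multiple of [2^-1 ^+ n]. *)
Lemma l2_ae_cvg_subseq (v : nat -> L2 mu) :
  (forall n, l2norm (v n.+1 - v n) <= 4^-1 ^+ n) ->
  {ae mu, forall x, cvgn (fun n => v n x)}.
Proof.
move=> v4.
pose t n x := ((4 ^+ n)%:E * (((v n.+1 - v n) x) ^+ 2)%:E)%E.
have t0 n x : (0 <= t n x)%E by rewrite mule_ge0// lee_fin ?sqr_ge0// exprn_ge0.
have mt n : measurable_fun setT (t n).
  apply/measurable_EFinP/measurable_funM => //.
  by apply: measurable_funX.
have it : (\int[mu]_x (\sum_(0 <= n <oo) t n x) < +oo)%E.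
  rewrite integral_nneseries//.
  apply: (@le_lt_trans _ _ (\sum_(0 <= n <oo) (4^-1 ^+ n : R)%:E)%E).
    apply: lee_nneseries => [n _ _|n _]; first exact: integral_ge0.
    have -> : (\int[mu]_x t n x = (4 ^+ n * l2norm (v n.+1 - v n) ^+ 2)%:E)%E.
      rewrite EFinM l2norm_sqr_int; apply: ge0_integralZl_EFin => //.
      - by move=> x _; rewrite lee_fin sqr_ge0.
      - by apply/measurable_EFinP; exact: measurable_funX.
    rewrite lee_fin.
    have -> : 4^-1 ^+ n = 4 ^+ n * (4^-1 ^+ n) ^+ 2 :> R.
      by rewrite expr2 mulrA -exprMn divff// expr1n mul1r.
    by rewrite ler_wpM2l ?exprn_ge0// lerXn2r ?nnegrE ?exprn_ge0 ?l2norm_ge0.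
  have := @cvg_geometric_series R 1 4^-1.
  rewrite ger0_norm// invf_lt1// (_ : 1 < 4 = true); last by apply/idP; lra.
  move=> /(_ isT) h.
  have -> : (\sum_(0 <= n <oo) (4^-1 ^+ n : R)%:E)%E = (1 / (1 - 4^-1) : R)%:E.
    apply: cvg_lim => //.
    have -> : (fun n => \sum_(0 <= i < n) (4^-1 ^+ i : R)%:E)%E =
        EFin \o series (geometric 1 4^-1).
      apply/funext => n /=; rewrite sumEFin /series/=; congr EFin.
      by apply: eq_bigr => i _; rewrite mul1r.
    by apply: cvg_EFin => //; exact: nearW.
  by rewrite ltry.
have : mu.-integrable setT (fun x => \sum_(0 <= n <oo) t n x)%E.
  apply/integrableP; split.
    exact: ge0_emeasurable_sum.
  under eq_integral => x _ do rewrite gee0_abs ?nneseries_ge0//.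
  exact: it.
move=> /(integrable_ae measurableT); apply: filterS => x /(_ I) fx.
set C := fine (\sum_(0 <= n <oo) t n x)%E.
have tC n : 4 ^+ n * ((v n.+1 - v n) x) ^+ 2 <= C.
  rewrite -lee_fin /C fineK//.
  apply: le_trans (nneseries_lim_ge n.+1 _) => //.
  by rewrite big_nat_recr//= leeDr// sume_ge0.
have C0 : 0 <= C by apply: le_trans (tC 0); rewrite mulr_ge0// sqr_ge0.
have dC n : `|v n.+1 x - v n x| <= Num.sqrt C * 2^-1 ^+ n.
  have -> : 2^-1 ^+ n = Num.sqrt (4^-1 ^+ n) :> R.
    rewrite (_ : 4^-1 ^+ n = (2^-1 ^+ n) ^+ 2).
      by rewrite sqrtr_sqr ger0_norm// exprn_ge0.
    by rewrite exprAC; congr (_ ^+ _); field.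
  rewrite -sqrtrM// -sqrtr_sqr ler_sqrt; last first.
    by rewrite mulr_ge0// exprn_ge0.
  by rewrite exprVn ler_pdivlMr ?exprn_gt0// mulrC tC.
have : cvgn [normed series (telescope (fun n => v n x))].
  have h2 : `|2^-1 : R| < 1 by rewrite ger0_norm// invf_lt1//; lra.
  have /= hg := @is_cvg_geometric_series R (Num.sqrt C) _ h2.
  apply: (@series_le_cvg R _ (geometric (Num.sqrt C) 2^-1)) => // n.
    exact: normr_ge0.
  by rewrite /= mulr_ge0// exprn_ge0.
move=> /normed_cvg.
rewrite telescopeK => cv.
rewrite (_ : (fun n => v n x) = (fun n => v n x - v 0 x) \+ cst (v 0 x)).
  by apply: is_cvgD => //; exact: is_cvg_cst.
by apply/funext => n /=; rewrite subrK.
Qed.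

(** Fatou's lemma for the squares of [v n - v (j + n)] as [j] grows. *)
Lemma l2_ae_cvg_l2 (v : nat -> L2 mu) (w : T -> R) : measurable_fun setT w ->
  {ae mu, forall x, (fun n => v n x) @ \oo --> w x} ->
  forall n (e : R), (forall j, (n <= j)%N -> l2norm (v n - v j) <= e) ->
  (\int[mu]_x ((v n x - w x) ^+ 2)%:E <= (e ^+ 2)%:E)%E.
Proof.
move=> mw vw n e vne.
have e0 : 0 <= e by apply: le_trans (vne n _); rewrite ?l2norm_ge0.
pose F j x := ((v n x - v (j + n)%N x) ^+ 2)%:E.
have mF j : measurable_fun setT (F j).
  by apply/measurable_EFinP/measurable_funX; exact: measurable_funB.
have F0 j x : setT x -> (0 <= F j x)%E by rewrite lee_fin sqr_ge0.
apply: (@le_trans _ _ (\int[mu]_x limn_einf (F^~ x))%E).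
  apply: ae_ge0_le_integral => //.
  - by move=> x _; rewrite lee_fin sqr_ge0.
  - by apply/measurable_EFinP/measurable_funX; exact: measurable_funB.
  - move=> x _.
    have -> : 0%E = limn_einf (cst 0 : nat -> \bar R).
      by have /cvg_limn_einf_sup[->] : cst (0 : \bar R) @ \oo --> (0 : \bar R)
        by exact: cvg_cst.
    by apply: lee_limn_einf => m; exact: F0.
  - rewrite /limn_einf; apply: measurableT_comp => //.
    by apply: measurable_fun_limn_esup => j; exact: measurableT_comp.
  apply: filterS vw => x vx _.
  have : F^~ x @ \oo --> ((v n x - w x) ^+ 2)%:E.
    apply: cvg_EFin; first exact: nearW.
    rewrite /comp/= /F/=; under eq_fun do rewrite expr2.
    rewrite expr2; apply: cvgM; apply: cvgB; (try exact: cvg_cst);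
      by rewrite (cvg_shiftn n (fun j => v j x)).
  by move=> /cvg_limn_einf_sup[->].
apply: le_trans (fatou _ _ mF F0) _ => //.
have -> : (e ^+ 2)%:E = limn_einf (cst (e ^+ 2)%:E).
  by have /cvg_limn_einf_sup[->] : cst ((e ^+ 2)%:E : \bar R) @ \oo --> (e ^+ 2)%:E
    by exact: cvg_cst.
apply: lee_limn_einf => j /=.
have -> : (\int[mu]_x F j x = (l2norm (v n - v (j + n)%N) ^+ 2)%:E)%E.
  by rewrite l2norm_sqr_int.
by rewrite lee_fin lerXn2r ?nnegrE ?l2norm_ge0// vne// leq_addl.
Qed.

Lemma l2_complete (u : nat -> L2 mu) :
  (forall e, 0 < e -> exists N, forall m n, (N <= m)%N -> (N <= n)%N ->
     l2norm (u m - u n) <= e) ->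
  exists w, l2norm (u n - w) @[n --> \oo] --> 0.
Proof.
move=> uc.
have /choice[N NP] (k : nat) : exists N, forall m n, (N <= m)%N -> (N <= n)%N ->
    l2norm (u m - u n) <= 4^-1 ^+ k.
  by apply: uc; rewrite exprn_gt0.
(* The running maximum makes the chosen indices nondecreasing. *)
pose M k := (\max_(i < k.+1) N i)%N.
have NM k : (N k <= M k)%N by rewrite /M (leq_bigmax ord_max).
have MM i j : (i <= j)%N -> (M i <= M j)%N.
  move=> ij; apply/bigmax_leqP => l _.
  by rewrite (leq_bigmax (widen_ord (ij : (i < j.+1)%N) l)).
pose v k := u (M k).
have vu k j : (k <= j)%N -> l2norm (v k - v j) <= 4^-1 ^+ k.
  by move=> kj; apply: NP => //; rewrite (leq_trans (NM k))// MM.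
have vc : {ae mu, forall x, cvgn (fun n => v n x)}.
  by apply: l2_ae_cvg_subseq => n; rewrite l2distC vu.
(* The upper limit is defined and measurable everywhere and agrees with the limit where that
   exists. *)
pose w x := fine (limn_esup (fun n => (v n x)%:E)).
have mw : measurable_fun setT w.
  apply: measurableT_comp => //.
  by apply: measurable_fun_limn_esup => n; apply/measurable_EFinP.
have vw : {ae mu, forall x, (fun n => v n x) @ \oo --> w x}.
  apply: filterS vc => x vx.
  have /cvg_limn_einf_sup[_] : (fun n => (v n x)%:E) @ \oo -->
      (limn (fun n => v n x))%:E.
    by apply: cvg_EFin => //; exact: nearW.
  by rewrite /w => ->.
have wb k := l2_ae_cvg_l2 mw vw (vu k).
have v0w : (fun x => v 0 x - w x) \in Lfun mu 2%:E.
  apply: sqr_int_Lfun; first exact: measurable_funB.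
  exact: le_lt_trans (wb 0) (ltry _).
(* Fatou's bound gives square integrability of [v 0 - w], not directly of [w], so the limit is
   recovered as a difference. *)
pose W : L2 mu := v 0 - Lfun_Sub (lee1n 2) v0w.
have WE x : W x = w x by rewrite /= opprB addrC subrK.
exists W.
have vW k : l2norm (v k - W) <= 4^-1 ^+ k.
  rewrite -(ler_pXn2r (n := 2)) ?nnegrE ?l2norm_ge0 ?exprn_ge0//.
  rewrite -lee_fin l2norm_sqr_int; apply: le_trans (wb k).
  by under eq_integral => x _ do rewrite -[(v k - W) x]/(v k x - W x) WE.
apply/cvgrPdist_le => e e0.
have : (fun k => 4^-1 ^+ k : R) @ \oo --> 0.
  by apply: cvg_expr; rewrite ger0_norm// invf_lt1//; lra.
have e20 : 0 < e / 2 by rewrite divr_gt0.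
move=> /cvgrPdist_le/(_ _ e20)[K _ /(_ K (leqnn K))].
rewrite sub0r normrN ger0_norm ?exprn_ge0// => Ke.
exists (M K) => // n /= Kn.
rewrite sub0r normrN ger0_norm ?l2norm_ge0//.
apply: le_trans (l2dist_triangle _ (v K) _) _.
rewrite [leRHS]splitr lerD//; last exact: le_trans (vW K) _.
by apply: le_trans Ke; apply: NP => //; rewrite (leq_trans (NM K)).
Qed.

End L2_complete.

Lemma cvg0_rightP (R : realType) (phi : R -> R) :
  phi h @[h --> 0^'+] --> 0 <->
  (forall e, 0 < e ->
     exists2 a, 0 < a & forall h, 0 < h -> h < a -> `|phi h| <= e).
Proof.
split=> [/cvgrPdist_le H e /H|H].
  rewrite near_withinE => -[a /= a0 ah]; exists a => // h h0 ha.
  have := ah h; rewrite sub0r normrN; apply => //=.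
  by rewrite sub0r normrN gtr0_norm.
apply/cvgrPdist_le => e /H[a a0 ah]; rewrite near_withinE.
exists a => //= h /=; rewrite sub0r normrN => ha h0.
by rewrite sub0r normrN ah// -(gtr0_norm h0).
Qed.

Lemma cvg0_seqP (R : realType) (u : nat -> R) : (forall n, 0 <= u n) ->
  u n @[n --> \oo] --> 0 <->
  (forall e, 0 < e -> exists N, forall n, (N <= n)%N -> u n <= e).
Proof.
move=> u0; split=> [/cvgrPdist_le H e /H[N _ Nh]|H].
  by exists N => n /Nh; rewrite sub0r normrN ger0_norm.
apply/cvgrPdist_le => e /H[N Nh]; exists N => //= n /Nh.
by rewrite sub0r normrN ger0_norm.
Qed.

(** * Bounded operators and the uniform boundedness principle *)

Section L2_linear.
Context {d} {T : measurableType d} {R : realType}.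
Context {mu : {measure set T -> \bar R}}.
Implicit Types (f g h : L2 mu) (L : L2 mu -> L2 mu).

Definition l2linear L := forall (k : R) f g,
  l2eq (L (k *: f + g)) (k *: L f + L g).

Definition l2bound L (C : R) := forall f, l2norm (L f) <= C * l2norm f.

Lemma l2bound_ext L C f g : l2linear L -> l2bound L C ->
  l2eq f g -> l2eq (L f) (L g).
Proof.
move=> lL bL fg; have := lL 1 (f - g) g; rewrite !scale1r subrK => H.
apply/l2eqP; rewrite (l2eq_norm (l2eqB H (l2eq_refl _))) addrK.
apply/eqP; rewrite eq_le l2norm_ge0 andbT (le_trans (bL _))//.
by rewrite (l2eqP _ _).1// mulr0.
Qed.

Lemma l2linear0 L : l2linear L -> l2eq (L 0) 0.
Proof.
move=> lL h; have := lL 1 0 0 h.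
rewrite !scale1r addr0 l2dotDl l2dot0l => /eqP.
by rewrite -subr_eq0 opprD addrA subrr sub0r oppr_eq0 => /eqP.
Qed.

Lemma l2linearD L f g : l2linear L -> l2eq (L (f + g)) (L f + L g).
Proof. by move=> lL; have := lL 1 f g; rewrite !scale1r. Qed.

Lemma l2linearZ L k f : l2linear L -> l2eq (L (k *: f)) (k *: L f).
Proof.
move=> lL; have := lL k f 0; rewrite addr0 => H h.
by rewrite H l2dotDl (l2linear0 lL) l2dot0l addr0.
Qed.

Lemma l2linearB L f g : l2linear L -> l2eq (L (f - g)) (L f - L g).
Proof.
move=> lL; have := lL (-1) g f; rewrite !scaleN1r => H h.
by rewrite addrC H addrC.
Qed.

Lemma l2linear_sum L (I : Type) (r : seq I) (P : pred I) (F : I -> L2 mu) :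
  l2linear L ->
  l2eq (L (\sum_(i <- r | P i) F i)) (\sum_(i <- r | P i) L (F i)).
Proof.
move=> lL; elim: r => [|i r IH]; first by rewrite !big_nil; exact: l2linear0.
rewrite !big_cons; case: ifP => // _ h.
by rewrite (l2linearD _ _ lL) !l2dotDl IH.
Qed.

(** [N] is the operator norm, a supremum over unit vectors that need not be attained. The factor 3/4
    leaves room above the 1/2 that the tail of the gliding hump can cancel. *)
Lemma l2bound_almost_attained L (C c : R) : l2linear L -> l2bound L C ->
  0 <= c -> ~ l2bound L c ->
  exists N g, [/\ c <= N, l2bound L N, l2norm g = 1 &
    3 / 4 * N <= l2norm (L g)].
Proof.
move=> lL bL c0 nb.
have [f fc] : exists f, c * l2norm f < l2norm (L f).
  apply: contra_notP nb => H f; rewrite leNgt; apply/negP => fc.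
  by apply: H; exists f.
have f0 : 0 < l2norm f.
  rewrite lt_neqAle l2norm_ge0 andbT; apply/negP => /eqP f0.
  have := bL f; rewrite leNgt; apply/negP; rewrite negbK.
  by move: fc; rewrite -f0 !mulr0.
pose A := [set x | exists g, l2norm g = 1 /\ x = l2norm (L g)].
have normalize g : 0 < l2norm g ->
    A (l2norm (L g) / l2norm g).
  move=> g0; exists ((l2norm g)^-1 *: g); split.
    by rewrite l2normZ ger0_norm ?invr_ge0 ?l2norm_ge0// mulVf// gt_eqF.
  rewrite (l2eq_norm (l2linearZ _ _ lL)) l2normZ.
  by rewrite ger0_norm ?invr_ge0 ?l2norm_ge0// mulrC.
have sA : has_sup A.
  split; first by exists (l2norm (L f) / l2norm f); exact: normalize.
  by exists C => _ [g [g1 ->]]; rewrite (le_trans (bL g))// g1 mulr1.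
have cN : c < sup A.
  apply: (lt_le_trans _ (ub_le_sup sA.2 (normalize _ f0))).
  by rewrite ltr_pdivlMr.
have N0 : 0 < sup A by exact: le_lt_trans c0 cN.
have bN : l2bound L (sup A).
  move=> g; have [g0|g0] := eqVneq (l2norm g) 0.
    by have := bL g; rewrite g0 !mulr0.
  have gp : 0 < l2norm g by rewrite lt_neqAle eq_sym g0 l2norm_ge0.
  by rewrite -ler_pdivrMr// ub_le_sup//; [exact: sA.2|exact: normalize].
have e0 : 0 < sup A / 4 by rewrite divr_gt0.
have [_ [g [g1 ->]] gN] := sup_adherent e0 sA.
exists (sup A), g; split => //; first exact: ltW.
by apply: ltW; apply: le_lt_trans gN; lra.
Qed.

(* The gliding hump argument: at stage [n] the signs are chosen so that
   [L (N n)] is large at the partial sum, and the tail is too short to cancel. *)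
Lemma l2_uniform_bound (L : nat -> L2 mu -> L2 mu) :
  (forall n, l2linear (L n)) -> (forall n, exists C, l2bound (L n) C) ->
  (forall f, exists C, forall n, l2norm (L n f) <= C) ->
  exists C, forall n, l2bound (L n) C.
Proof.
move=> lL bL pb; apply: contrapT => nC.
have H k : exists p : nat * R * L2 mu, [/\ k%:R * 3 ^+ k <= p.1.2,
    l2bound (L p.1.1) p.1.2, l2norm p.2 = 1 &
    3 / 4 * p.1.2 <= l2norm (L p.1.1 p.2)].
  have c0 : 0 <= k%:R * 3 ^+ k :> R by rewrite mulr_ge0// exprn_ge0.
  have [n nb] : exists n, ~ l2bound (L n) (k%:R * 3 ^+ k).
    apply: contra_notP nC => Hn; exists (k%:R * 3 ^+ k) => n.
    by apply: contrapT => nb; apply: Hn; exists n.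
  have [C bC] := bL n.
  by have [N [g []]] := l2bound_almost_attained (lL n) bC c0 nb; exists (n, N, g).
have {H}[p pP] := choice H.
pose n k := (p k).1.1; pose N k := (p k).1.2; pose g k := (p k).2.
(* The values of [L] at [x + a] and [x - a] differ by [2 *: L a], so one of them has norm at least
   that of [L a]. *)
have step k x : exists y, l2norm (y - x) <= 3^-1 ^+ k /\
    3 / 4 * N k * 3^-1 ^+ k <= l2norm (L (n k) y).
  have [_ bN g1 gN] := pP k; rewrite -/(n k) -/(N k) -/(g k) in bN g1 gN.
  pose a := 3^-1 ^+ k *: g k.
  have e0 : 0 <= 3^-1 ^+ k :> R by rewrite exprn_ge0.
  have a1 : l2norm a = 3^-1 ^+ k by rewrite l2normZ g1 mulr1 ger0_norm.
  have La : 3 / 4 * N k * 3^-1 ^+ k <= l2norm (L (n k) a).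
    by rewrite (l2eq_norm (l2linearZ _ _ (lL _))) l2normZ ger0_norm// mulrC ler_wpM2l.
  have [H|H] := leP (3 / 4 * N k * 3^-1 ^+ k) (l2norm (L (n k) (x + a))).
    by exists (x + a); rewrite addrC addKr a1.
  exists (x - a); rewrite addrC addKr l2normN a1; split => //.
  have : l2norm (2 *: L (n k) a) <=
      l2norm (L (n k) (x + a)) + l2norm (L (n k) (x - a)).
    apply: le_trans (l2normB _ _); rewrite le_eqVlt; apply/orP; left; apply/eqP.
    apply: l2eq_norm => h; rewrite l2dotBl (l2linearD _ _ (lL _)).
    by rewrite (l2linearB _ _ (lL _)) l2dotBl l2dotDl l2dotZl; ring.
  by rewrite l2normZ ger0_norm//; lra.
have {step}[F FP] : exists F : nat -> L2 mu -> L2 mu, forall k x,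
    l2norm (F k x - x) <= 3^-1 ^+ k /\
    3 / 4 * N k * 3^-1 ^+ k <= l2norm (L (n k) (F k x)).
  by exists (fun k => projT1 (choice (step k))) => k; exact: projT2 (choice (step k)).
pose x := fix x k := if k is j.+1 then F j (x j) else 0 : L2 mu.
have xd k i : l2norm (x (k + i)%N - x k) <= 3 / 2 * (3^-1 ^+ k - 3^-1 ^+ (k + i)).
  elim: i => [|i IH]; first by rewrite addn0 !subrr mulr0 l2norm0.
  rewrite addnS/= (le_trans (l2dist_triangle _ (x (k + i)%N) _))//.
  have [+ _] := FP (k + i)%N (x (k + i)%N).
  by rewrite exprS; lra.
have xc k j : (k <= j)%N -> l2norm (x j - x k) <= 3 / 2 * 3^-1 ^+ k.
  move=> kj; rewrite -(subnKC kj) (le_trans (xd _ _))// ler_wpM2l//.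
  by rewrite gerBl exprn_ge0.
have /cvg0_seqP cv3 : 3^-1 ^+ k @[k --> \oo] --> (0 : R).
  by apply: cvg_expr; rewrite ger0_norm// invf_lt1//; lra.
have {}cv3 (e : R) : 0 < e -> exists k, 3^-1 ^+ k <= e.
  by move=> /cv3[|k /(_ k (leqnn k)) ?]; [move=> k; rewrite exprn_ge0|exists k].
have [|w /cvg0_seqP xw] := @l2_complete _ _ _ mu x.
  move=> e e0; have [|k kP] := cv3 (e / 3); first by rewrite divr_gt0.
  exists k => i j ki kj; apply: le_trans (l2dist_triangle _ (x k) _) _.
  rewrite (l2distC (x k)); have := xc _ _ ki; have := xc _ _ kj; lra.
have {xw} wx k : l2norm (w - x k) <= 3 / 2 * 3^-1 ^+ k.
  apply/ler_addgt0Pr => e e0.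
  have [|j jP] := xw _ e e0; first by move=> j; exact: l2norm_ge0.
  apply: le_trans (l2dist_triangle _ (x (maxn j k)) _) _.
  by rewrite addrC lerD ?xc ?leq_maxr// l2distC jP// leq_maxl.
have [C Cw] := pb w.
(* The increments after stage [k] sum to at most half of [3^-1 ^+ k]. So the value at [w] keeps
   [3 / 4 - 1 / 2 = 1 / 4] of [N k * 3^-1 ^+ k], which is at least [k%:R / 4]. *)
have [k kC] : exists k : nat, 4 * C < k%:R.
  exists (Num.bound `|4 * C|); apply: le_lt_trans (ler_norm _) _.
  exact: archi_boundP.
have [Nk bN _ _] := pP k; rewrite -/(n k) -/(N k) in Nk bN.
have [_ Lx] := FP k (x k).
have := Cw (n k); apply/negP; rewrite -ltNge; apply: (@lt_le_trans _ _ (k%:R / 4)).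
  by lra.
have Lwx : l2norm (L (n k) (w - x k.+1)) <= N k * (2^-1 * 3^-1 ^+ k).
  apply: le_trans (bN _) _; apply: ler_wpM2l.
    by apply: le_trans Nk; rewrite mulr_ge0// exprn_ge0.
  by apply: le_trans (wx _) _; rewrite exprS; lra.
have : l2norm (L (n k) (x k.+1)) <= l2norm (L (n k) w) +
    l2norm (L (n k) (w - x k.+1)).
  apply: le_trans (l2normB _ _); rewrite le_eqVlt; apply/orP; left; apply/eqP.
  apply: l2eq_norm => h; rewrite l2dotBl (l2linearB _ _ (lL _)) l2dotBl.
  by rewrite opprB addrC subrK.
have e0 : 0 < 3^-1 ^+ k :> R by rewrite exprn_gt0.
have : k%:R <= N k * 3^-1 ^+ k by rewrite exprVn ler_pdivlMr ?exprn_gt0.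
move: Lwx Lx => /=; lra.
Qed.

End L2_linear.

(** * Strongly continuous semigroups *)

Section C0_semigroup_theory.
Context {d} {T : measurableType d} {R : realType}.
Context {mu : {measure set T -> \bar R}}.
Variables (S : R -> L2 mu -> L2 mu) (HS : C0_semigroup S).
Implicit Types (f g : L2 mu) (s t h : R).

Lemma C0_linear t : 0 <= t -> l2linear (S t).
Proof. by case: HS => H _ _ _ _ t0 k f g; apply/ae_l2eq; exact: H. Qed.

Lemma C0_bound t : 0 <= t -> exists C, l2bound (S t) C.
Proof. by case: HS => _ H _ _ _ t0; exact: H. Qed.

Lemma C0_0 f : l2eq (S 0 f) f.
Proof. by case: HS => _ _ H _ _; apply/ae_l2eq; exact: H. Qed.

Lemma C0_add s t f : 0 <= s -> 0 <= t -> l2eq (S (s + t) f) (S s (S t f)).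
Proof. by case: HS => _ _ _ H _ s0 t0; apply/ae_l2eq; exact: H. Qed.

Lemma C0_comm s t f : 0 <= s -> 0 <= t -> l2eq (S s (S t f)) (S t (S s f)).
Proof.
move=> s0 t0 h; rewrite -(C0_add _ s0 t0) addrC.
exact: C0_add.
Qed.

Lemma C0_cont0 f e : 0 < e ->
  exists2 a, 0 < a & forall h, 0 <= h -> h < a -> l2norm (S h f - f) <= e.
Proof.
move=> e0; case: HS => _ _ _ _ /(_ f)/cvg0_rightP/(_ _ e0)[a a0 ah].
exists a => // h; rewrite le_eqVlt => /predU1P[<- _|h0 ha].
  by rewrite (l2eqP _ _).1 ?ltW//; exact: C0_0.
by have := ah h h0 ha; rewrite ger0_norm// l2norm_ge0.
Qed.

(** Otherwise there are times tending to 0 along which the operator norms are unbounded, while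
    strong continuity at 0 keeps every orbit bounded: a contradiction to the uniform boundedness
    principle. *)
Lemma C0_bound_near0 : exists M a, [/\ 1 <= M, 0 < a &
  forall t, 0 <= t -> t <= a -> l2bound (S t) M].
Proof.
apply: contrapT => nM.
have H (n : nat) : exists t, [/\ 0 <= t, t <= n.+1%:R^-1 & ~ l2bound (S t) n.+1%:R].
  apply: contra_notP nM => Hn; exists n.+1%:R, n.+1%:R^-1.
  rewrite ler1n invr_gt0 ltr0n; split => // t t0 tn.
  by apply: contrapT => nb; apply: Hn; exists t.
have {H}[t tP] := choice H.
have [n|n|f|C bC] := @l2_uniform_bound _ _ _ mu (fun n => S (t n)).
- by have [? _ _] := tP n; exact: C0_linear.
- by have [? _ _] := tP n; exact: C0_bound.
- have [a a0 af] := C0_cont0 f ltr01.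
  have [N aN] : exists N : nat, a^-1 < N%:R.
    exists (Num.bound a^-1); apply: archi_boundP.
    by rewrite invr_ge0 ltW.
  (* The sum covers the finitely many indices for which [t n < a] is not guaranteed. *)
  exists (\sum_(i < N) l2norm (S (t i) f) + (1 + l2norm f)) => n.
  have s0 : 0 <= \sum_(i < N) l2norm (S (t i) f).
    by apply: sumr_ge0 => i _; exact: l2norm_ge0.
  have [nN|Nn] := ltnP n N.
    rewrite (bigD1 (Ordinal nN))//= -!addrA lerDl addr_ge0 ?sumr_ge0//.
      by move=> i _; exact: l2norm_ge0.
    by rewrite addr_ge0// l2norm_ge0.
  rewrite -[X in l2norm X](subrK f) (le_trans (l2normD _ _))//.
  have [t0 tn _] := tP n; have := af (t n) t0.
  suff ta : t n < a by move=> /(_ ta); lra.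
  apply: le_lt_trans tn _; rewrite invf_plt ?posrE//.
  by apply: lt_le_trans aN _; rewrite ler_nat (leq_trans Nn).
have [N CN] : exists N : nat, C < N%:R.
  exists (Num.bound `|C|); apply: le_lt_trans (ler_norm _) _.
  exact: archi_boundP.
have [_ _] := tP N; apply => f; apply: le_trans (bC N f) _.
by rewrite ler_wpM2r ?l2norm_ge0// (le_trans (ltW CN))// ler_nat.
Qed.

Lemma C0_bound_on (Tm : R) : exists2 M, 1 <= M &
  forall t, 0 <= t -> t <= Tm -> l2bound (S t) M.
Proof.
have [M [a [M1 a0 Ma]]] := C0_bound_near0.
have H (n : nat) t : 0 <= t -> t <= n%:R * a -> l2bound (S t) (M ^+ n).
  elim: n t => [|n IH] t t0 tn f.
    have -> : t = 0 by apply/le_anti; rewrite t0 andbT -(mul0r a).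
    by rewrite expr0 mul1r (l2eq_norm (C0_0 f)).
  have [ta|ta] := leP t a.
    apply: le_trans (Ma _ t0 ta _) _; rewrite ler_wpM2r ?l2norm_ge0//.
    by rewrite exprS ler_peMr ?(le_trans ler01)// exprn_ege1.
  have ta0 : 0 <= t - a by lra.
  rewrite -[t](subrKC a) (l2eq_norm (C0_add f (ltW a0) ta0)).
  apply: le_trans (Ma _ (ltW a0) (lexx _) _) _.
  rewrite exprS -mulrA ler_wpM2l ?(le_trans ler01)//.
  by apply: IH => //; rewrite -natr1 mulrDl mul1r in tn; lra.
have [N aN] : exists N : nat, Tm / a < N%:R.
  exists (Num.bound `|Tm / a|); apply: le_lt_trans (ler_norm _) _.
  exact: archi_boundP.
exists (M ^+ N) => [|t t0 tT]; first exact: exprn_ege1.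
by apply: H => //; apply: le_trans tT _; rewrite -ler_pdivrMr// ltW.
Qed.

Lemma C0_unif_cont (Tm : R) f e : 0 < e -> exists2 a, 0 < a &
  forall s t, 0 <= s -> s <= t -> t <= Tm -> t - s < a ->
    l2norm (S t f - S s f) <= e.
Proof.
move=> e0; have [M M1 bM] := C0_bound_on Tm.
have M0 : 0 < M by exact: lt_le_trans ltr01 M1.
have eM : 0 < e / M by rewrite divr_gt0.
have [a a0 af] := C0_cont0 f eM.
exists a => // s t s0 st tT ts.
have ts0 : 0 <= t - s by rewrite subr_ge0.
have -> : l2norm (S t f - S s f) = l2norm (S s (S (t - s) f - f)).
  apply: l2eq_norm => h; rewrite l2dotBl -[in S t](subrKC s t) (C0_add f s0 ts0).
  by rewrite (l2linearB _ _ (C0_linear s0)) l2dotBl.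
apply: le_trans (bM _ s0 (le_trans st tT) _) _.
by rewrite mulrC -ler_pdivlMr// af.
Qed.

Lemma C0_generator_invariant t f w : 0 <= t ->
  generator S f w -> generator S (S t f) (S t w).
Proof.
move=> t0 /cvg0_rightP Sfw; apply/cvg0_rightP => e e0.
have [M M1 bM] := C0_bound_on t.
have M0 : 0 < M by exact: lt_le_trans ltr01 M1.
have eM : 0 < e / M by rewrite divr_gt0.
have [a a0 ah] := Sfw _ eM; exists a => // h h0 ha.
have lS := C0_linear t0.
rewrite ger0_norm ?l2norm_ge0//.
have -> : l2norm (h^-1 *: (S h (S t f) - S t f) - S t w) =
    l2norm (S t (h^-1 *: (S h f - f) - w)).
  apply: l2eq_norm => k; rewrite (l2linearB _ _ lS) !l2dotBl.
  rewrite (l2linearZ _ _ lS) !l2dotZl (l2linearB _ _ lS) !l2dotBl.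
  by rewrite (C0_comm f (ltW h0) t0).
apply: le_trans (bM _ t0 (lexx _) _) _.
by rewrite mulrC -ler_pdivlMr//; have := ah _ h0 ha; rewrite ger0_norm ?l2norm_ge0.
Qed.

End C0_semigroup_theory.

(** * Bochner integrals of controlled paths *)

Section paths.
Context {d} {T : measurableType d} {R : realType}.
Context {mu : {measure set T -> \bar R}}.
Variables (Tm : R) (Tm0 : 0 < Tm).
Implicit Types (f g : L2 mu) (y z : R -> L2 mu) (phi : R -> R) (e s t : R).

Local Notation leb := (@lebesgue_measure R).
Local Notation D := (`]0, Tm[%classic : set (measurableTypeR R)).

Definition ucont_real phi := forall e, 0 < e -> exists2 a, 0 < a &
  forall s t, 0 <= s -> s <= t -> t <= Tm -> t - s < a -> `|phi t - phi s| <= e.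

(** Only times in $[0, T_m]$ count, because a semigroup is controlled only for nonnegative times.
    Boundedness is included for the product estimate in [ucont_path_dot]. *)
Definition ucont_path y :=
  (exists Y, forall t, 0 <= t -> t <= Tm -> l2norm (y t) <= Y) /\
  (forall e, 0 < e -> exists2 a, 0 < a &
    forall s t, 0 <= s -> s <= t -> t <= Tm -> t - s < a ->
      l2norm (y t - y s) <= e).

(** Two kinds of functionals occur: the pairing with a fixed element and, to move [S t] through an
    integral, the pairing after [S t] has been applied. *)
Definition l2functional (l : L2 mu -> R) C :=
  (forall k f g, l (k *: f + g) = k * l f + l g) /\
  (forall f, `|l f| <= C * l2norm f).

Lemma l2functional_dot g : l2functional (l2dot^~ g) (l2norm g).
Proof.
split=> [k f f'|f]; first by rewrite l2dotDl l2dotZl.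
by rewrite mulrC l2norm_cauchy.
Qed.

Section functional.
Variables (l : L2 mu -> R) (C : R) (lC : l2functional l C).

Lemma l2functionalD f g : l (f + g) = l f + l g.
Proof. by rewrite -[f in LHS]scale1r lC.1 mul1r. Qed.

Lemma l2functional0 : l 0 = 0.
Proof. by have := l2functionalD 0 0; rewrite addr0; lra. Qed.

Lemma l2functionalZ k f : l (k *: f) = k * l f.
Proof. by rewrite -[k *: f]addr0 lC.1 l2functional0 addr0. Qed.

Lemma l2functionalB f g : l (f - g) = l f - l g.
Proof. by rewrite l2functionalD -scaleN1r l2functionalZ mulN1r. Qed.

Lemma l2functional_sum (I : Type) (r : seq I) (P : pred I) (F : I -> L2 mu) :
  l (\sum_(i <- r | P i) F i) = \sum_(i <- r | P i) l (F i).
Proof.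
exact: (big_morph l l2functionalD l2functional0).
Qed.

Lemma ucont_path_functional y : ucont_path y -> ucont_real (l \o y).
Proof.
move=> [_ yc] e e0; have C0 : 0 < `|C| + 1 by rewrite ltr_wpDl.
have [|a a0 ya] := yc (e / (`|C| + 1)); first by rewrite divr_gt0.
exists a => // s t s0 st tT ts; rewrite /= -l2functionalB (le_trans (lC.2 _))//.
have := ya _ _ s0 st tT ts; rewrite ler_pdivlMr// => h.
apply: le_trans h; rewrite mulrC ler_wpM2l ?l2norm_ge0//.
by rewrite (le_trans (ler_norm _))// lerDl.
Qed.

End functional.

Lemma ucont_path_cst f : ucont_path (fun=> f).
Proof.
split; first by exists (l2norm f).
by move=> e e0; exists 1 => // s t _ _ _ _; rewrite subrr l2norm0 ltW.
Qed.

Lemma ucont_path_dot y z : ucont_path y -> ucont_path z ->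
  ucont_real (fun t => l2dot (y t) (z t)).
Proof.
move=> [[Y yY] yc] [[Z zZ] zc] e e0.
have T0 := ltW Tm0.
have Y0 : 0 <= Y by apply: le_trans (yY 0 _ _); rewrite ?l2norm_ge0.
have Z0 : 0 <= Z by apply: le_trans (zZ 0 _ _); rewrite ?l2norm_ge0.
have YZ : 0 < Y + Z + 1 by rewrite ltr_wpDl// addr_ge0.
have eY : 0 < e / (Y + Z + 1) by rewrite divr_gt0.
have [a a0 ya] := yc _ eY; have [b b0 zb] := zc _ eY.
exists (Num.min a b); first by rewrite lt_min a0.
move=> s t s0 st tT; rewrite lt_min => /andP[tsa tsb].
have -> : l2dot (y t) (z t) - l2dot (y s) (z s) =
    l2dot (y t - y s) (z t) + l2dot (y s) (z t - z s).
  by rewrite l2dotBl l2dotBr; ring.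
apply: le_trans (ler_normD _ _) _.
have h1 := l2norm_cauchy (y t - y s) (z t).
have h2 := l2norm_cauchy (y s) (z t - z s).
have {}h1 : `|l2dot (y t - y s) (z t)| <= e / (Y + Z + 1) * Z.
  apply: le_trans h1 _; apply: ler_pM; rewrite ?l2norm_ge0 ?ya//.
  by rewrite zZ// (le_trans s0).
have {}h2 : `|l2dot (y s) (z t - z s)| <= Y * (e / (Y + Z + 1)).
  apply: le_trans h2 _; apply: ler_pM; rewrite ?l2norm_ge0 ?zb//.
  by rewrite yY// (le_trans st).
apply: le_trans (lerD h1 h2) _.
have -> : e / (Y + Z + 1) * Z + Y * (e / (Y + Z + 1)) =
  e - e / (Y + Z + 1) by field; rewrite gt_eqF.
by rewrite gerBl ltW.
Qed.

Lemma ucont_bounded phi : ucont_real phi ->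
  exists B, forall t, 0 <= t -> t <= Tm -> `|phi t| <= B.
Proof.
move=> /(_ 1 ltr01)[a a0 pa].
have H (n : nat) t : 0 <= t -> t <= Tm -> t <= n%:R * (a / 2) ->
    `|phi t| <= `|phi 0| + n%:R.
  elim: n t => [|n IH] t t0 tT.
    rewrite mul0r => tn; rewrite addr0; have -> // : t = 0.
    by apply/le_anti; rewrite t0 tn.
  move=> tn; have [ta|ta] := leP t (a / 2).
    have := pa 0 t (lexx _) t0 tT; rewrite subr0 => /(_ ltac:(lra)) h.
    rewrite -(subrK (phi 0) (phi t)) (le_trans (ler_normD _ _))// addrC lerD2l.
    by rewrite (le_trans h)// ler1n.
  have h1 : `|phi (t - a / 2)| <= `|phi 0| + n%:R.
    by apply: IH; move: tn; rewrite -natr1 mulrDl; lra.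
  have h2 : `|phi t - phi (t - a / 2)| <= 1 by apply: pa; lra.
  rewrite -(subrK (phi (t - a / 2)) (phi t)) (le_trans (ler_normD _ _))//.
  by rewrite -natr1; lra.
have [N aN] : exists N : nat, Tm / (a / 2) < N%:R.
  exists (Num.bound `|Tm / (a / 2)|); apply: le_lt_trans (ler_norm _) _.
  exact: archi_boundP.
exists (`|phi 0| + N%:R) => t t0 tT; apply: H => //.
by apply: le_trans tT _; rewrite -ler_pdivrMr ?divr_gt0// ltW.
Qed.

(** Composition with the clamping of time to $[0, T_m]$. The extension is continuous on the whole
    line, as the measurability lemma and the fundamental theorem of calculus ask. *)
Lemma ucont_extension phi : ucont_real phi -> exists psi : R -> R,
  continuous psi /\ forall t, 0 <= t -> t <= Tm -> psi t = phi t.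
Proof.
move=> pc.
pose cl t := Num.max 0 (Num.min t Tm).
have clE t : 0 <= t -> t <= Tm -> cl t = t.
  by move=> t0 tT; rewrite /cl min_l// max_r.
have clin t : 0 <= cl t <= Tm.
  by rewrite /cl le_max lexx/= ge_max (ltW Tm0)/= ge_min lexx orbT.
have clm s t : s <= t -> cl s <= cl t /\ cl t - cl s <= t - s.
  by rewrite /cl /Num.max /Num.min => st; do 4! case: ifPn => //;
    rewrite -?leNgt => *; split; lra.
exists (phi \o cl); split; last by move=> t t0 tT; rewrite /= clE.
move=> t; apply/cvgrPdist_le => e /pc[a a0 pa].
exists a => //= s ts; rewrite /ball/= in ts.
have [st|st] := leP s t.
  have [h1 h2] := clm _ _ st.
  have /andP[? ?] := clin s; have /andP[? ?] := clin t.
  apply: pa => //; apply: le_lt_trans h2 _.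
  by rewrite -[t - s]ger0_norm// subr_ge0.
have [h1 h2] := clm _ _ (ltW st).
have /andP[? ?] := clin s; have /andP[? ?] := clin t.
rewrite distrC; apply: pa => //; apply: le_lt_trans h2 _.
by rewrite -[s - t]ger0_norm ?subr_ge0 ?ltW// distrC.
Qed.

Lemma ucont_measurable phi : ucont_real phi -> measurable_fun D phi.
Proof.
move=> /ucont_extension[psi [/continuous_measurable_fun mpsi psiE]].
apply: (eq_measurable_fun psi) => [t|]; last exact: measurable_funTS.
by rewrite inE/= in_itv/= => /andP[t0 tT]; rewrite psiE// ltW.
Qed.

(** The squared norm expands into a finite double sum of measurable coefficients times continuous
    inner products, so no measurability of vector-valued maps enters. *)
Lemma measurable_l2norm_sum (I : finType) (c : I -> R -> R)
    (z : I -> R -> L2 mu) :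
  (forall i, measurable_fun D (c i)) -> (forall i, ucont_path (z i)) ->
  measurable_fun D (fun t => l2norm (\sum_i c i t *: z i t)).
Proof.
move=> mc pz.
apply: (eq_measurable_fun (fun t => Num.sqrt (\sum_i \sum_j
    (c i t * (c j t * l2dot (z i t) (z j t)))))) => [t _|].
  rewrite l2normE l2dot_suml; congr Num.sqrt; apply: eq_bigr => i _.
  by rewrite l2dot_sumr; apply: eq_bigr => j _; rewrite l2dotZl l2dotZr.
apply: measurableT_comp.
  exact: continuous_measurable_fun (@sqrt_continuous R).
apply: measurable_sum => i; apply: measurable_sum => j.
apply: measurable_funM; [exact: mc|apply: measurable_funM; first exact: mc].
by apply: ucont_measurable; exact: ucont_path_dot.
Qed.

End paths.

(** * Simple functions and their pairings *)

Section bochner_path.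
Context {d} {T : measurableType d} {R : realType}.
Context {mu : {measure set T -> \bar R}}.
Variables (Tm : R) (Tm0 : 0 < Tm).
Implicit Types (f g : L2 mu) (y z : R -> L2 mu) (phi : R -> R) (e s t : R).

Local Notation leb := (@lebesgue_measure R).
Local Notation D := (`]0, Tm[%classic : set (measurableTypeR R)).
Implicit Types (q : seq (set (measurableTypeR R) * L2 mu)).

Let mD : measurable D. Proof. exact: measurable_itv. Qed.

Lemma lebD_fin : (leb D < +oo)%E.
Proof. by rewrite lebesgue_measure_itv/= lte_fin Tm0 -EFinD ltry. Qed.

(** A simple function is a list of pairs of a set and a value. The sets may overlap, so
    concatenation of lists is addition of functions. *)
Definition simp q t : L2 mu := \sum_(p <- q) (\1_(p.1) t : R) *: p.2.
Definition isimp q : L2 mu := \sum_(p <- q) fine (leb p.1) *: p.2.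
Definition simp_ok q := forall p, p \in q -> measurable p.1 /\ p.1 `<=` D.

Lemma simp_okW q k : simp_ok q -> let p := nth (set0, 0) q k in
  measurable p.1 /\ p.1 `<=` D.
Proof.
move=> qok; have [kq|qk] := ltnP k (size q); first exact/qok/mem_nth.
by rewrite /= nth_default//; split; [exact: measurable0|exact: sub0set].
Qed.

Lemma simp_functional q (l : L2 mu -> R) C : l2functional l C -> simp_ok q ->
  leb.-integrable D (EFin \o (l \o simp q)) /\
  \int[leb]_(t in D) l (simp q t) = l (isimp q).
Proof.
move=> lC; elim: q => [|p q IH] ok.
  rewrite /isimp big_nil (l2functional0 lC); split.
    apply: (eq_integrable _ (cst 0)) => //; last exact: integrable0.
    by move=> t _; rewrite /= /simp big_nil (l2functional0 lC).
  rewrite -[RHS](mul0r (fine (leb D))) -Rintegral_cst//; apply: eq_Rintegral => t _.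
  by rewrite /simp big_nil (l2functional0 lC).
have [|iq Eq] := IH; first by move=> p' pq; apply: ok; rewrite inE pq orbT.
have [mp pD] := ok p (mem_head _ _).
have i1 : leb.-integrable D (EFin \o (fun t => \1_(p.1) t * l p.2)).
  apply: measurable_bounded_integrable => //; first exact: lebD_fin.
    by apply: measurable_funM => //; exact: measurable_indic.
  exists `|l p.2|; split=> // M MI t _ /=; rewrite normrM (le_trans _ (ltW MI))//.
  by rewrite ler_piMl// indicE; case: (_ \in _); rewrite ?normr1// normr0.
have E1 t : l (simp (p :: q) t) = \1_(p.1) t * l p.2 + l (simp q t).
  by rewrite /simp big_cons lC.1.
split.
  have -> : EFin \o (l \o simp (p :: q)) =
      ((EFin \o (fun t => \1_(p.1) t * l p.2)%R) \+ (EFin \o (l \o simp q)))%E.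
    by apply/funext => t /=; rewrite E1 EFinD.
  exact: integrableD.
under eq_Rintegral => t _ do rewrite E1.
rewrite RintegralD// Eq /isimp big_cons (lC.1); congr (_ + _).
rewrite RintegralZr//; last first.
  apply: measurable_bounded_integrable => //; first exact: lebD_fin.
  exists 1; split=> // M MI t _ /=; rewrite (le_trans _ (ltW MI))//.
  by rewrite indicE; case: (_ \in _); rewrite ?normr1// normr0.
congr (_ * _); rewrite /Rintegral integral_indic//; congr (fine (leb _)).
exact: setIidl.
Qed.

Variables (m : nat) (u : 'I_m -> R -> R) (y : 'I_m -> R -> L2 mu).
Hypothesis iu : forall i, leb.-integrable D (EFin \o u i).
Hypothesis py : forall i, ucont_path Tm (y i).

Let mu_ i : measurable_fun D (u i).
Proof. by have /measurable_int/measurable_EFinP := iu i. Qed.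

Let F t : L2 mu := \sum_i u i t *: y i t.

Lemma measurable_path_sub_simp q : simp_ok q ->
  measurable_fun D (fun t => l2norm (F t - simp q t)).
Proof.
move=> ok.
(* The difference is a single finite combination: the paths [y i] with coefficients [u i], and
   constant paths with coefficients minus indicators. *)
pose c (i : 'I_m + 'I_(size q)) := match i with
  | inl i => u i | inr k => fun t => - \1_((nth (set0, 0) q k).1) t end.
pose z (i : 'I_m + 'I_(size q)) := match i with
  | inl i => y i | inr k => fun=> (nth (set0, 0) q k).2 end.
have := @measurable_l2norm_sum _ _ _ mu _ Tm0 _ c z.
move=> /(_ _ _)/(eq_measurable_fun _); apply.
- by move=> t _; rewrite big_sumType/= -sumrN /F /simp (big_nth (set0, 0)) big_mkord;
    congr (l2norm (_ + _)); apply: eq_bigr => k _; rewrite scaleNr.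
- case=> i /=; first exact: mu_.
  apply: measurableT_comp => //; apply: measurable_indic.
  by have [] := simp_okW i ok.
- by case=> i /=; [exact: py|exact: ucont_path_cst].
Qed.

Lemma path_functional_integrable (l : L2 mu -> R) C : l2functional l C ->
  leb.-integrable D (EFin \o (l \o F)).
Proof.
move=> lC.
have -> : EFin \o (l \o F) = (fun t => \sum_i (u i t * l (y i t))%:E)%E.
  apply/funext => t /=; rewrite sumEFin (l2functional_sum lC); congr EFin.
  by apply: eq_bigr => i _; rewrite (l2functionalZ lC).
apply: integrable_sum => // i _.
have uc := ucont_path_functional lC (py i).
apply: (integrableMl _ (iu i)) => //; first exact: ucont_measurable.
have [B hB] := ucont_bounded uc.
exists B; split; first by rewrite num_real.
move=> M BM t /=; rewrite in_itv/= => /andP[t0 tT].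
by rewrite (le_trans _ (ltW BM))// hB// ltW.
Qed.

(** This is the one estimate behind both existence and uniqueness of the Bochner integral: the real
    integral of [l (F t)] is a common reference point for all simple approximations. *)
Lemma isimp_functional_close q (l : L2 mu -> R) C e : 0 <= C ->
  l2functional l C -> simp_ok q ->
  (\int[leb]_(t in D) (l2norm (F t - simp q t))%:E <= e%:E)%E ->
  `|l (isimp q) - \int[leb]_(t in D) l (F t)| <= C * e.
Proof.
move=> C0 lC ok Fe.
have [iq <-] := simp_functional lC ok.
have iF := path_functional_integrable lC.
have iB : leb.-integrable D (EFin \o (fun t => l (simp q t) - l (F t))).
  exact: (integrableB mD iq iF).
rewrite -RintegralB//.
apply: le_trans (le_normr_Rintegral _ _) _ => //.
have mF := measurable_path_sub_simp ok.
rewrite -lee_fin /Rintegral fineK; last first.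
  apply/integrable_fin_num => //; exact: (integrable_abse iB).
apply: (@le_trans _ _ (\int[leb]_(t in D) (C%:E * (l2norm (F t - simp q t))%:E))%E).
  apply: ge0_le_integral => //.
  - apply: measurableT_comp => //; apply: measurableT_comp => //.
    by apply: measurable_funB; apply/measurable_EFinP; [case/integrableP: iq|case/integrableP: iF].
  - by apply/measurable_EFinP; apply: measurable_funM.
  - move=> t _; rewrite -EFinM lee_fin -(l2functionalB lC) l2distC.
    exact: lC.2.
rewrite ge0_integralZl//; first by rewrite EFinM lee_wpmul2l.
- exact/measurable_EFinP.
- by move=> t _; rewrite lee_fin l2norm_ge0.
Qed.

End bochner_path.

Import HBSimple.

(** * Approximation of a path by simple functions in L1 *)

Section bochner_exists.
Context {d} {T : measurableType d} {R : realType}.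
Context {mu : {measure set T -> \bar R}}.
Variables (Tm : R) (Tm0 : 0 < Tm).
Implicit Types (f g : L2 mu) (phi : R -> R) (e s t : R).

Local Notation leb := (@lebesgue_measure R).
Local Notation D := (`]0, Tm[%classic : set (measurableTypeR R)).
Implicit Types (q : seq (set (measurableTypeR R) * L2 mu)).

Let mD : measurable D. Proof. exact: measurable_itv. Qed.

Lemma ucont_step (P : nat) t : (0 < P)%N -> D t ->
  let h := Tm / P%:R in let k := Num.truncn (t / h) in
  [/\ (k < P)%N, k%:R * h <= t, t - k%:R * h < h & forall j : nat,
    (\1_(D `&` `[j%:R * h, j.+1%:R * h[) t : R) = (j == k)%:R].
Proof.
move=> P0 Dt h k; have /andP[t0 tT] : 0 < t < Tm by move: Dt; rewrite /= in_itv.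
have h0 : 0 < h by rewrite divr_gt0// ltr0n.
have th : 0 <= t / h by rewrite divr_ge0// ltW.
have /andP[k1 k2] : (k%:R <= t / h < k.+1%:R) by exact: truncn_itv.
rewrite ler_pdivlMr// in k1; rewrite ltr_pdivrMr// in k2.
split => //.
- rewrite /k truncn_lt_nat// ltr_pdivrMr// /h mulrC divfK//.
  by rewrite pnatr_eq0 -lt0n.
- by rewrite ltrBlDl (lt_le_trans k2)// -natr1 mulrDl mul1r.
- move=> j; rewrite indicE; congr (nat_of_bool _)%:R.
  rewrite in_setI (mem_set Dt)/=; apply/idP/eqP => [|->].
    rewrite inE/= in_itv/= -ler_pdivlMr// -ltr_pdivrMr// => H.
    by rewrite /k (truncn_def H).
  by rewrite inE/= in_itv/= -ler_pdivlMr// -ltr_pdivrMr// truncn_itv.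
Qed.

Section step_approximation.
Variables (u : R -> R) (y : R -> L2 mu).
Hypothesis iu : leb.-integrable D (EFin \o u).
Hypothesis py : ucont_path Tm y.

Lemma sfun_l1_approx e : 0 < e -> exists v : {sfun (measurableTypeR R) >-> R},
  leb.-integrable D (fun t => (v t)%:E) /\
  (\int[leb]_(t in D) `|(u t)%:E - (v t)%:E| <= e%:E)%E.
Proof.
move=> e0; have [v [iv _ /fine_cvgP[fv vc]]] := approximation_sfun_integrable mD iu.
have : \forall n \near \oo, (fun n => (\int[leb]_(z in D) `|(u z)%:E - (v n z)%:E|)%E) n
    \is a fin_num /\ fine (\int[leb]_(z in D) `|(u z)%:E - (v n z)%:E|)%E <= e.
  apply: filterI => //.
  move/cvgrPdist_le : vc => /(_ _ e0); apply: filterS => n.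
  by rewrite sub0r normrN; apply: le_trans; exact: ler_norm.
move=> [n _ /(_ n (leqnn n))[fn ne]]; exists (v n); split; first exact: iv.
by rewrite -(fineK fn) lee_fin.
Qed.

(** Replace [u] by a simple function [v] close in L1 and [y] by its value at the left end [s] of the
    grid cell. The error splits as [(u t - v t) *: y t + v t *: (y t - y s)]. *)
Lemma simp_approx1 e : 0 < e -> exists q, simp_ok Tm q /\
  (\int[leb]_(t in D) (l2norm (u t *: y t - simp q t))%:E <= e%:E)%E.
Proof.
move=> e0; have [[Y yY] yc] := py.
have Y0 : 0 <= Y by exact: le_trans (l2norm_ge0 _) (yY 0 (lexx _) (ltW Tm0)).
have [|v [iv uv]] := @sfun_l1_approx (e / 2 / (Y + 1)).
  by rewrite !divr_gt0// ltr_wpDl.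
have mv : measurable_fun D v by have /measurable_int/measurable_EFinP := iv.
have mu_ : measurable_fun D u by have /measurable_int/measurable_EFinP := iu.
(* The grid is chosen after [v], since its fineness depends on the L1 norm [G] of [v]. The added 1
   in [Y + 1] and [G + 1] avoids division by zero. *)
pose G := fine (\int[leb]_(t in D) `|(v t)%:E|)%E.
have GE : (\int[leb]_(t in D) `|(v t)%:E| = G%:E)%E.
  by rewrite fineK//; apply: integrable_fin_num => //; exact: integrable_abse.
have G0 : 0 <= G by rewrite fine_ge0// integral_ge0.
have [|a a0 ya] := yc (e / 2 / (G + 1)).
  by rewrite !divr_gt0// ltr_wpDl.
have [P [P0 Pa]] : exists P : nat, (0 < P)%N /\ Tm / P%:R < a.
  exists (Num.bound (Tm / a)).+1; split => //.
  rewrite ltr_pdivrMr ?ltr0n// mulrC -ltr_pdivrMr//.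
  apply: lt_trans (archi_boundP _) _; first by rewrite divr_ge0 ?ltW.
  by rewrite ltr_nat.
pose h := Tm / P%:R.
pose r : seq R := finmap.enum_fset (fset_set (range v)).
(* The pieces are the intersections of the grid cells with the level sets of [v]. *)
pose q := [seq (D `&` `[k%:R * h, k.+1%:R * h[ `&` (v @^-1` [set c]),
   c *: y (k%:R * h)) | k <- iota 0 P, c <- r].
have qok : simp_ok Tm q.
  move=> p /allpairsP[[k c] /= [_ _ ->]] /=; split; last by move=> t [[]].
  by apply: measurableI => //; apply: measurableI => //; exact: measurable_itv.
exists q; split => //.
have qE t : D t -> simp q t = v t *: y ((Num.truncn (t / h))%:R * h).
  move=> Dt; have [kP _ _ kE] := ucont_step P0 Dt.
  rewrite /simp big_allpairs_dep -[X in iota 0 X]subn0 -/(index_iota 0 P) big_mkord.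
  rewrite (bigD1 (Ordinal kP))//= [X in _ + X]big1 ?addr0; last first.
    move=> j jk; apply: big1 => c _ /=.
    by rewrite indicI/= kE (_ : _ == _ = false) ?mul0r ?scale0r//; apply/negbTE.
  rewrite [in RHS](fimfunE v t) fsbig_finite//= scaler_suml.
  apply: eq_bigr => c _; rewrite indicI/= kE eqxx mul1r.
  by rewrite scalerA mulrC.
have mF : measurable_fun D (fun t => l2norm (u t *: y t - simp q t)).
  have := @measurable_path_sub_simp _ _ _ mu _ Tm0 1 (fun=> u) (fun=> y).
  move=> /(_ (fun=> iu) (fun=> py) q qok); apply: eq_measurable_fun => t _.
  by rewrite big_ord1.
apply: (@le_trans _ _ (\int[leb]_(t in D) (Y%:E * `|(u t)%:E - (v t)%:E| +
    (e / 2 / (G + 1))%:E * `|(v t)%:E|))%E).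
  apply: ge0_le_integral => //.
  - by move=> t _; rewrite lee_fin l2norm_ge0.
  - exact/measurable_EFinP.
  - apply: emeasurable_funD; apply: measurable_funeM; apply: measurableT_comp => //.
      by apply: emeasurable_funB; apply/measurable_EFinP.
    exact/measurable_EFinP.
  - move=> t Dt; rewrite (qE _ Dt) -EFinB !abse_EFin -!EFinM -EFinD lee_fin.
    have [kP kt th _] := ucont_step P0 Dt.
    set s := (_ * h); have s0 : 0 <= s by rewrite mulr_ge0// /h divr_ge0// ltW.
    move: Dt; rewrite /= in_itv/= => /andP[t0 tT].
    rewrite (_ : u t *: y t - v t *: y s =
      (u t - v t) *: y t + v t *: (y t - y s)); last first.
      by rewrite scalerBl scalerBr addrA subrK.
    apply: le_trans (l2normD _ _) _; rewrite !l2normZ.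
    rewrite lerD//; first by rewrite mulrC ler_wpM2r// yY// ltW.
    by rewrite mulrC ler_wpM2r// ya// ?ltW// (lt_trans th).
rewrite ge0_integralD//; first last.
- by apply: measurable_funeM; apply: measurableT_comp => //; apply/measurable_EFinP.
- by move=> t _; rewrite mule_ge0// lee_fin !divr_ge0// ?addr_ge0// ltW.
- apply: measurable_funeM; apply: measurableT_comp => //.
  by apply: emeasurable_funB; apply/measurable_EFinP.
- by move=> t _; rewrite mule_ge0.
rewrite ge0_integralZl//; first last.
- apply: measurableT_comp => //.
  by apply: emeasurable_funB; apply/measurable_EFinP.
rewrite ge0_integralZl//; first last.
- by rewrite lee_fin !divr_ge0// ?addr_ge0// ltW.
- by apply: measurableT_comp => //; apply/measurable_EFinP.
rewrite GE -EFinM.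
apply: (@le_trans _ _ (Y%:E * (e / 2 / (Y + 1))%:E + (e / 2 / (G + 1) * G)%:E)%E).
  by rewrite leeD2r// lee_wpmul2l.
rewrite -EFinM -EFinD lee_fin.
have A x : 0 <= x -> e / 2 / (x + 1) * x <= e / 2.
  move=> x0; rewrite -mulrA ler_piMr ?(ltW (divr_gt0 e0 _))//.
  by rewrite mulrC ler_pdivrMr ?ltr_wpDl// mul1r lerDl.
by rewrite mulrC; have := A _ Y0; have := A _ G0; lra.
Qed.

End step_approximation.

End bochner_exists.

(** * Existence and pairings of the Bochner integral *)

Section bochner_main.
Context {d} {T : measurableType d} {R : realType}.
Context {mu : {measure set T -> \bar R}}.
Variables (Tm : R) (Tm0 : 0 < Tm).
Implicit Types (f g w : L2 mu) (e s t : R).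

Local Notation leb := (@lebesgue_measure R).
Local Notation D := (`]0, Tm[%classic : set (measurableTypeR R)).
Implicit Types (q : seq (set (measurableTypeR R) * L2 mu)).

Let mD : measurable D. Proof. exact: measurable_itv. Qed.

Variables (m : nat) (u : 'I_m -> R -> R) (y : 'I_m -> R -> L2 mu).
Hypothesis iu : forall i, leb.-integrable D (EFin \o u i).
Hypothesis py : forall i, ucont_path Tm (y i).

Lemma simp_approx e : 0 < e -> exists q, simp_ok Tm q /\
  (\int[leb]_(t in D) (l2norm (\sum_i u i t *: y i t - simp q t))%:E
     <= e%:E)%E.
Proof.
(* Dividing by [m.+1] instead of [m] covers [m = 0]. *)
move=> e0; have e1 : 0 < e / m.+1%:R by rewrite divr_gt0.
have [q qP] := choice (fun i => simp_approx1 Tm0 (iu i) (py i) e1).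
pose Q := flatten [seq q i | i <- enum 'I_m].
have Qok : simp_ok Tm Q.
  move=> p /flattenP[_ /mapP[i _ ->]]; exact: (qP i).1.
exists Q; split => //.
have QE t : simp Q t = \sum_i simp (q i) t.
  by rewrite /simp big_flatten big_map big_enum.
have mi i : measurable_fun D (fun t => l2norm (u i t *: y i t - simp (q i) t)).
  have := @measurable_path_sub_simp _ _ _ mu _ Tm0 1 (fun=> u i) (fun=> y i).
  move=> /(_ (fun=> iu i) (fun=> py i) _ (qP i).1).
  by apply: eq_measurable_fun => t _; rewrite big_ord1.
apply: (@le_trans _ _ (\int[leb]_(t in D)
    \sum_i (l2norm (u i t *: y i t - simp (q i) t))%:E)%E).
  apply: ge0_le_integral => //.
  - by move=> t _; rewrite lee_fin l2norm_ge0.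
  - by apply/measurable_EFinP; exact: measurable_path_sub_simp.
  - by apply: emeasurable_sum => i; apply/measurable_EFinP.
  - by move=> t _; rewrite QE -sumrB sumEFin lee_fin l2norm_sum.
rewrite ge0_integral_sum//; first last.
- by move=> i t _; rewrite lee_fin l2norm_ge0.
- by move=> i; apply/measurable_EFinP.
apply: (@le_trans _ _ (\sum_(i < m) (e / m.+1%:R)%:E)%E).
  by apply: lee_sum => i _; exact: (qP i).2.
rewrite sumEFin lee_fin sumr_const card_ord -(mulr_natr (e / _)) -mulrA.
apply: ler_piMr; first exact: ltW.
by rewrite mulrC ler_pdivrMr// mul1r ler_nat.
Qed.

(** The integrand of the control-to-state map agrees with the combination of paths only up to null
    sets, and only for times in [D], where the semigroup is linear. *)
Variable F : R -> L2 mu.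
Hypothesis FE : forall t, D t -> l2eq (F t) (\sum_i u i t *: y i t).

Let normFE q t : D t ->
  l2norm (F t - simp q t) = l2norm (\sum_i u i t *: y i t - simp q t).
Proof.
by move=> Dt; apply: l2eq_norm; apply: l2eqB => //; exact: FE.
Qed.

(** Paired with [g], the integrals of all approximations are close to the same real integral. By
    duality they form a Cauchy sequence in norm, and completeness applies. *)
Lemma ex_bochner : exists w, is_bochner leb D F w.
Proof.
have H (n : nat) : exists q, simp_ok Tm q /\
    (\int[leb]_(t in D) (l2norm (\sum_i u i t *: y i t - simp q t))%:E
       <= (n.+1%:R^-1)%:E)%E.
  by apply: simp_approx; rewrite invr_gt0.
have {H}[q qP] := choice H.
have close j k : l2norm (isimp (q j) - isimp (q k)) <= j.+1%:R^-1 + k.+1%:R^-1.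
  apply: l2norm_dual => [|g]; first by rewrite addr_ge0.
  have lg := l2functional_dot g; rewrite l2dotBl.
  have hj := isimp_functional_close Tm0 iu py (l2norm_ge0 g) lg (qP j).1 (qP j).2.
  have hk := isimp_functional_close Tm0 iu py (l2norm_ge0 g) lg (qP k).1 (qP k).2.
  apply: le_trans (ler_norm _) _; move: hj hk; set I := (Rintegral _ _ _).
  move=> hj hk; rewrite -(subrKA I) (le_trans (ler_normD _ _))//.
  by rewrite mulrC mulrDr lerD// distrC.
have [|w wP] := @l2_complete _ _ _ mu (fun n => isimp (q n)).
  move=> e e0; exists (Num.bound (2 / e)) => j k Nj Nk.
  have b (n : nat) : (Num.bound (2 / e) <= n)%N -> n.+1%:R^-1 <= e / 2.
    move=> Nn; rewrite -[leRHS]invf_div lef_pV2 ?posrE ?divr_gt0//.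
    apply: ltW; apply: lt_trans (archi_boundP _) _.
      by rewrite divr_ge0// ltW.
    by rewrite ltr_nat ltnS.
  by apply: le_trans (close j k) _; rewrite [leRHS]splitr lerD// b.
exists w; exists (fun n => size (q n)), (fun n k => (nth (set0, 0) (q n) k).1),
  (fun n k => (nth (set0, 0) (q n) k).2).
have sE n t : \sum_(k < size (q n)) (\1_((nth (set0, 0) (q n) k).1) t : R) *:
    (nth (set0, 0) (q n) k).2 = simp (q n) t.
  by rewrite /simp [RHS](big_nth (set0, 0)) big_mkord.
split.
- move=> n k; have [mE ED] := simp_okW k (qP n).1; split => //.
  apply: le_lt_trans (lebD_fin Tm0).
  by apply: le_measure; rewrite ?inE.
- move=> n; apply: (eq_measurable_fun
    (fun t => l2norm (\sum_i u i t *: y i t - simp (q n) t))).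
    by move=> t; rewrite inE => Dt; rewrite sE normFE.
  by apply: measurable_path_sub_simp => //; exact: (qP n).1.
- apply: (@squeeze_cvge _ _ _ _ (cst 0%E) _ (fun n => (n.+1%:R^-1)%:E)).
  + apply: nearW => n; rewrite integral_ge0/=; last first.
      by move=> t _; rewrite lee_fin l2norm_ge0.
    apply: le_trans (qP n).2; rewrite le_eqVlt; apply/orP; left; apply/eqP.
    apply: eq_integral => t; rewrite inE => Dt.
    by rewrite sE normFE.
  + exact: cvg_cst.
  + apply: cvg_EFin; first exact: nearW.
    exact: cvg_harmonic.
- have -> // : (fun n => l2norm (\sum_(k < size (q n))
    fine (leb (nth (set0, 0) (q n) k).1) *: (nth (set0, 0) (q n) k).2 - w)) =
    (fun n => l2norm (isimp (q n) - w)).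
  by apply/funext => n; rewrite /isimp (big_nth (set0, 0)) big_mkord.
Qed.

(** Every admissible value has the same pairings, whichever simple functions produced it. Hence the
    choice made by [xget] is harmless. *)
Lemma is_bochner_functional w (l : L2 mu -> R) C : l2functional l C ->
  is_bochner leb D F w -> l w = \int[leb]_(t in D) \sum_i u i t * l (y i t).
Proof.
move=> lC [N [E [x [Eok mFs Fs0 xw]]]].
have lC' : l2functional l `|C|.
  split=> [|f]; first exact: lC.1.
  by rewrite (le_trans (lC.2 _))// ler_wpM2r ?l2norm_ge0// ler_norm.
pose q n := [seq (E n k, x n k) | k <- iota 0 (N n)].
have qok n : simp_ok Tm (q n).
  by move=> p /mapP[k _ ->]; have [? ? _] := Eok n k.
have sE n t : \sum_(k < N n) (\1_(E n k) t : R) *: x n k = simp (q n) t.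
  by rewrite /simp big_map -[X in iota 0 X]subn0 -/(index_iota 0 (N n)) big_mkord.
have iE n : \sum_(k < N n) fine (leb (E n k)) *: x n k = isimp (q n).
  by rewrite /isimp big_map -[X in iota 0 X]subn0 -/(index_iota 0 (N n)) big_mkord.
have -> : \int[leb]_(t in D) \sum_i u i t * l (y i t) =
    \int[leb]_(t in D) l (\sum_i u i t *: y i t).
  apply: eq_Rintegral => t _; rewrite (l2functional_sum lC).
  by apply: eq_bigr => i _; rewrite (l2functionalZ lC).
set I := Rintegral _ _ _.
apply/eqP; rewrite -subr_eq0 -normr_le0; apply/ler_addgt0Pr => e e0.
rewrite add0r.
have eC : 0 < e / 2 / (`|C| + 1) by rewrite !divr_gt0// ltr_wpDl.
move/cvgrPdist_le : xw => /(_ _ eC)[n1 _ n1P].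
move/fine_cvgP : Fs0 => [[n2 _ n2P] /cvgrPdist_le/(_ _ eC)[n3 _ n3P]].
pose n := maxn n1 (maxn n2 n3).
have h1 := n1P n (leq_maxl _ _).
have h2 : (n2 <= n)%N by rewrite /n maxnCA leq_maxl.
have h3 : (n3 <= n)%N by rewrite /n maxnA leq_maxr.
rewrite /= iE sub0r normrN ger0_norm ?l2norm_ge0// in h1.
have hF : (\int[leb]_(t in D) (l2norm (\sum_i u i t *: y i t - simp (q n) t))%:E
   <= (e / 2 / (`|C| + 1))%:E)%E.
  have := n3P n h3; have := n2P n h2 => /= fn.
  rewrite sub0r normrN => H; have := le_trans (ler_norm _) H.
  rewrite -lee_fin fineK//; apply: le_trans; rewrite le_eqVlt.
  apply/orP; left; apply/eqP; apply: eq_integral => t; rewrite inE => Dt.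
  by rewrite sE normFE.
have := isimp_functional_close Tm0 iu py (normr_ge0 C) lC' (qok n) hF.
rewrite -/I => h4.
have h5 : `|l w - l (isimp (q n))| <= `|C| * (e / 2 / (`|C| + 1)).
  rewrite -(l2functionalB lC) (le_trans (lC'.2 _))//.
  by rewrite ler_wpM2l// l2distC.
rewrite -(subrKA (l (isimp (q n)))) (le_trans (ler_normD _ _))//.
have : `|C| * (e / 2 / (`|C| + 1)) <= e / 2.
  rewrite mulrCA; apply: ler_piMr; first by rewrite ltW// divr_gt0.
  by rewrite ler_pdivrMr ?ltr_wpDl// mul1r lerDl.
by lra.
Qed.

Lemma bochnerP (l : L2 mu -> R) C : l2functional l C ->
  l (bochner leb D F) = \int[leb]_(t in D) \sum_i u i t * l (y i t).
Proof.
move=> lC; apply: is_bochner_functional lC _.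
by have [w wP] := ex_bochner; exact: (xgetPex 0 (ex_intro _ w wP)).
Qed.

End bochner_main.

(** * Density of the domain of the generator *)

Section antiderivative.
Variable R : realType.
Implicit Types (f G : R -> R) (a b t : R).
Local Notation leb := (@lebesgue_measure R).

Lemma continuous_integrable_itv f (i : bool * bool) a b : continuous f ->
  leb.-integrable [set` Interval (BSide i.1 a) (BSide i.2 b)] (EFin \o f).
Proof.
move=> cf; have : leb.-integrable `[a, b]%classic (EFin \o f).
  apply: continuous_compact_integrable; first exact: segment_compact.
  exact: continuous_subspaceT.
apply: integrableS => //.
by apply: subset_itv; rewrite bnd_simp.
Qed.

Lemma continuous_antiderivative f (A B : R) : continuous f ->
  exists F : R -> R, forall x, A < x -> x < B -> is_derive x 1 F (f x).
Proof.
move=> cf; exists (fun x => \int[leb]_(t in `[A, x]) f t) => x Ax xB.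
have [d1 d2] := continuous_FTC1_closed xB
  (continuous_integrable_itv (true, false) _ _ cf) Ax (cf x).
by apply: DeriveDef => //; rewrite -derive1E.
Qed.

Lemma is_derive_continuous (F : R -> R) (x df : R) : is_derive x 1 F df ->
  {for x, continuous F}.
Proof. by move=> [dF _]; apply/differentiable_continuous/derivable1_diffP. Qed.

Lemma Rintegral_antiderivative f F a b : a < b -> continuous f ->
  (forall x, a <= x -> x <= b -> is_derive x 1 F (f x)) ->
  \int[leb]_(x in `]a, b[) f x = F b - F a.
Proof.
move=> ab cf dF.
rewrite Rintegral_itv_bndo_bndc; last exact: (continuous_integrable_itv (false, true)).
rewrite Rintegral_itv_obnd_cbnd; last exact: (continuous_integrable_itv (false, false)).
rewrite /Rintegral (@continuous_FTC2 _ _ F)//.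
- exact: continuous_subspaceT.
- split.
  + by move=> x; rewrite in_itv/= => /andP[ax xb]; have [] := dF x (ltW ax) (ltW xb).
  + by apply: cvg_at_right_filter; apply: is_derive_continuous (dF a (lexx _) (ltW ab)).
  + by apply: cvg_at_left_filter; apply: is_derive_continuous (dF b (ltW ab) (lexx _)).
- move=> x; rewrite in_itv/= => /andP[ax xb].
  by have [d1 <-] := dF x (ltW ax) (ltW xb); rewrite derive1E.
Qed.

(** The integral over $(t, t+h)$ minus that over $(0, h)$ is the integral over $(h, h+t)$ minus that
    over $(0, t)$, and the mean value theorem applies to both. An antiderivative replaces the change
    of variables. *)
Lemma Rintegral_shift_difference G h t : 0 < h -> 0 < t -> continuous G ->
  exists s1 s2, [/\ 0 <= s1 <= t, 0 <= s2 <= t &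
    \int[leb]_(s in `]0, h[) G (t + s) - \int[leb]_(s in `]0, h[) G s =
    t * (G (h + s1) - G s2)].
Proof.
move=> h0 t0 cG.
(* The margins put the closed interval $[0, h+t]$ inside the open interval of differentiability. *)
have [F dF] := continuous_antiderivative (-1) (h + t + 1) cG.
have dF' x : 0 <= x -> x <= h + t -> is_derive x 1 F (G x).
  by move=> x0 xh; apply: dF; lra.
have cS : continuous (fun s => t + s).
  by move=> x; apply: cvgD; [exact: cvg_cst|exact: cvg_id].
have -> : \int[leb]_(s in `]0, h[) G s = F h - F 0.
  by apply: Rintegral_antiderivative => // x x0 xh; apply: dF' => //; lra.
have -> : \int[leb]_(s in `]0, h[) G (t + s) = F (t + h) - F (t + 0).
  apply: (Rintegral_antiderivative (F := fun s => F (t + s))) => //.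
    by move=> x; apply: continuous_comp; [exact: cS|exact: cG].
  move=> x x0 xh.
  have d1 : is_derive (t + x) 1 F (G (t + x)) by apply: dF'; lra.
  have d2 : is_derive x 1 (fun s => t + s) 1.
    by have := is_deriveD (is_derive_cst t x 1) (is_derive_id x 1); rewrite add0r.
  have := @is_derive1_comp R F (fun s => t + s) x (G (t + x)) 1 d1 d2.
  by rewrite mulr1.
have mv a b : 0 <= a -> a <= b -> b <= h + t ->
    exists2 c, c \in `[a, b] & F b - F a = G c * (b - a).
  move=> a0 ab bh; apply: MVT_segment => // [x|].
    by rewrite in_itv/= => /andP[ax xb]; apply: dF'; lra.
  apply: derivable_within_continuous => x; rewrite in_itv/= => /andP[ax xb].
  by have [] : is_derive x 1 F (G x) by apply: dF'; lra.
have [c1 c1in E1] : exists2 c, c \in `[h, h + t] & F (h + t) - F h =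
    G c * (h + t - h) by apply: mv; lra.
have [c2 c2in E2] : exists2 c, c \in `[0, t] & F t - F 0 = G c * (t - 0).
  by apply: mv; lra.
exists (c1 - h), c2; move: c1in c2in; rewrite !in_itv/= => c1in c2in; split.
- by move: c1in; lra.
- by [].
- rewrite subrKC [t + h]addrC addr0; move: E1 E2.
  by rewrite [h + t - h]addrAC subrr add0r subr0; lra.
Qed.

End antiderivative.

Section generator_dense.
Context {d} {T : measurableType d} {R : realType}.
Context {mu : {measure set T -> \bar R}}.
Variables (S : R -> L2 mu -> L2 mu) (HS : C0_semigroup S).
Implicit Types (f g w : L2 mu) (s t : R).
Local Notation leb := (@lebesgue_measure R).

Lemma C0_ucont_path (Tm : R) f : ucont_path Tm (fun t => S t f).
Proof.
split; last by move=> e e0; exact: C0_unif_cont.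
have [M _ bM] := C0_bound_on HS Tm.
by exists (M * l2norm f) => t t0 tT; exact: bM.
Qed.

Lemma integrable_one (h : R) : 0 < h -> leb.-integrable `]0, h[ (EFin \o (fun=> 1)).
Proof.
move=> h0; apply: measurable_bounded_integrable => //; first exact: lebD_fin.
by exists 1; split => // M M1 x _ /=; rewrite normr1 ltW.
Qed.

Lemma C0_mean h f : 0 < h -> exists w, forall (l : L2 mu -> R) C,
  l2functional l C -> l w = \int[leb]_(s in `]0, h[) l (S s f).
Proof.
move=> h0; exists (bochner leb `]0, h[ (fun s => S s f)) => l C lC.
rewrite (@bochnerP _ _ _ mu h h0 1 (fun=> (fun=> 1)) (fun=> (fun s => S s f))
  (fun=> integrable_one h0) (fun=> C0_ucont_path h f) _ _ l C lC).
  by apply: eq_Rintegral => s _; rewrite big_ord1 mul1r.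
by move=> t _ g; rewrite big_ord1 scale1r.
Qed.

(** This lets [S t] pass under the Bochner integral. *)
Lemma l2functional_C0 t g : 0 <= t ->
  exists C, l2functional (fun f => l2dot (S t f) g) C.
Proof.
move=> t0; have [C bC] := C0_bound HS t0; exists (C * l2norm g); split.
  by move=> k f f'; rewrite (C0_linear HS t0) l2dotDl l2dotZl.
move=> f; rewrite mulrAC (le_trans (l2norm_cauchy _ _))//.
by rewrite ler_wpM2r ?l2norm_ge0.
Qed.

(** The witness is the mean $h^{-1}\int_0^h S(s)f\,ds$, close to [f] for small [h]. Its image under
    the generator is $h^{-1}(S(h)f - f)$. *)
Lemma C0_generator_dense f (e : R) : 0 < e ->
  exists p w, generator S p w /\ l2norm (f - p) <= e.
Proof.
move=> e0; have [a a0 af] := C0_cont0 HS f e0.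
pose h := a / 2; have h0 : 0 < h by rewrite divr_gt0.
have h0' : 0 <= h := ltW h0.
have [w wP] := C0_mean f h0.
exists (h^-1 *: w), (h^-1 *: (S h f - f)); split; last first.
  rewrite l2distC; apply: l2norm_dual => [|g]; first exact: ltW.
  rewrite l2dotBl l2dotZl (wP (l2dot^~ g) _ (l2functional_dot g)).
  rewrite mulrC lerBlDr ler_pdivrMr//.
  have ic : leb.-integrable `]0, h[ (EFin \o (fun s => l2dot (S s f) g)).
    have := @path_functional_integrable _ _ _ mu h h0 1 (fun=> (fun=> 1))
      (fun=> (fun s => S s f)) (fun=> integrable_one h0)
      (fun=> C0_ucont_path h f) _ _ (l2functional_dot g).
    by congr integrable; apply/funext => s; rewrite /= big_ord1 scale1r.
  apply: le_trans (_ : \int[leb]_(s in `]0, h[) (e * l2norm g + l2dot f g) <= _).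
    apply: le_Rintegral => // [|s].
      apply: measurable_bounded_integrable => //; first exact: lebD_fin.
      exists `|e * l2norm g + l2dot f g|; split => // M M1 x _ /=.
      exact: ltW.
    rewrite /= in_itv/= => /andP[s0 sh].
    rewrite -lerBlDr -l2dotBl (le_trans (l2dot_le _ _))//.
    rewrite ler_wpM2r ?l2norm_ge0// af// ?ltW//.
    by rewrite (lt_trans sh)// /h; lra.
  rewrite Rintegral_cst// le_eqVlt; apply/orP; left; apply/eqP; congr (_ * _).
  have E : leb `]0, h[%classic = h%:E.
    by rewrite lebesgue_measure_itv/= lte_fin h0 -EFinD subr0.
  by have := congr1 (@fine R) E.
apply/cvg0_rightP => e' e'0.
(* Two increments of [G] over times at most [t] are divided by [h]. The interval of length [h + 1]
   leaves room for a shift by [t < 1]. *)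
have eh : 0 < e' * h / 2 by rewrite divr_gt0// mulr_gt0.
have [b b0 bf] := C0_unif_cont HS (h + 1) f eh.
exists (Num.min b 1); first by rewrite lt_min b0 ltr01.
move=> t t0; rewrite lt_min => /andP[tb t1].
rewrite ger0_norm ?l2norm_ge0//.
apply: l2norm_dual => [|g]; first exact: ltW.
have [C lC] := l2functional_C0 g (ltW t0).
have lS := C0_linear HS (ltW t0).
have h1 : 0 < h + 1 by rewrite addr_gt0.
have [G [cG GE]] := ucont_extension h1
  (ucont_path_functional (l2functional_dot g) (C0_ucont_path (h + 1) f)).
rewrite /= in GE.
have E1 : l2dot w g = \int[leb]_(s in `]0, h[) G s.
  rewrite (wP (l2dot^~ g) _ (l2functional_dot g)); apply: eq_Rintegral => s.
  by rewrite inE/= in_itv/= => /andP[s0 sh]; rewrite GE//; lra.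
have E2 : l2dot (S t w) g = \int[leb]_(s in `]0, h[) G (t + s).
  rewrite (wP _ _ lC); apply: eq_Rintegral => s.
  rewrite inE/= in_itv/= => /andP[s0 sh].
  by rewrite -(C0_add HS f (ltW t0) (ltW s0)) GE//; lra.
have [s1 [s2 [/andP[s10 s1t] /andP[s20 s2t]]]] := Rintegral_shift_difference h0 t0 cG.
rewrite -E1 -E2 => E3.
have -> : l2dot (t^-1 *: (S t (h^-1 *: w) - h^-1 *: w) - h^-1 *: (S h f - f)) g =
    h^-1 * ((G (h + s1) - G h) - (G s2 - G 0)).
  rewrite l2dotBl !l2dotZl !l2dotBl (l2linearZ _ _ lS) !l2dotZl -mulrBr E3.
  rewrite mulrCA mulKf ?gt_eqF//.
  rewrite (GE h) ?(GE 0) ?(C0_0 HS f)//; [by ring|lra..].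
have d1 : G (h + s1) - G h <= e' * h / 2 * l2norm g.
  rewrite !GE//; try lra; rewrite -l2dotBl (le_trans (l2dot_le _ _))//.
  by rewrite ler_wpM2r ?l2norm_ge0// bf//; lra.
have d2 : - (G s2 - G 0) <= e' * h / 2 * l2norm g.
  rewrite !GE//; try lra; rewrite -l2dotBl -l2dotNl (le_trans (l2dot_le _ _))//.
  by rewrite l2normN ler_wpM2r ?l2norm_ge0// bf//; lra.
by rewrite ler_pdivrMl//; lra.
Qed.

End generator_dense.

(** * Weak derivatives and the form B *)

Section compact_support.
Context {R : realType} {d : nat}.
Implicit Types (f : 'rV[R]_d -> R) (K : set 'rV[R]_d).

Lemma continuous_compact_bound f K : continuous f -> compact K ->
  exists M, forall x, K x -> `|f x| <= M.
Proof.
move=> cf cK; have /compact_bounded[M [_ MP]] : compact (f @` K).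
  by apply: continuous_compact => //; exact: continuous_subspaceT.
exists (M + 1) => x Kx; apply: (MP (M + 1)); first by rewrite ltrDl.
by exists x.
Qed.

Lemma continuous_measurable_rV f : continuous f -> measurable_fun setT f.
Proof.
move=> /continuousP cf; apply: (measurability (@RGenOInfty.G R)).
  exact: RGenOInfty.measurableE.
move=> _ [_ [a ->] <-]; rewrite setTI; apply: open_measurable_rV.
by apply: cf; exact: interval_open.
Qed.

(** The coordinates are bounded on [K], so a box contains it, and the measure of a box is known. *)
Lemma compact_finite_measure K : compact K -> exists2 B : set 'rV[R]_d,
  measurable B /\ K `<=` B & (lebesgue_rV R d B < +oo)%E.
Proof.
move=> cK.
have /choice[M MP] (j : 'I_d) : exists M, forall x, K x -> `|x ord0 j| <= M.
  apply: (continuous_compact_bound _ cK) => x.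
  exact: coord_continuous.
pose a : 'rV[R]_d := \row_j - `|M j|; pose b : 'rV[R]_d := \row_j `|M j|.
pose B := [set x : 'rV[R]_d | forall i, x ord0 i \in `[a ord0 i, b ord0 i]].
have mB : measurable B.
  apply: (measurable_bigcapI (F := fun i =>
    [set x : 'rV[R]_d | x ord0 i \in `[a ord0 i, b ord0 i]])) => i.
  rewrite -[X in measurable X]setTI.
  have := @measurable_mx_coord R 1 d ord0 i measurableT _
    (measurable_itv `[a ord0 i, b ord0 i]).
  by apply.
exists B.
- split=> // x Kx i /=; rewrite in_itv/= !mxE -ler_norml.
  by rewrite (le_trans (MP i x Kx))// ler_norm.
- rewrite lebesgue_rV_box ?ltry// => i; rewrite !mxE.
  by rewrite (@le_trans _ _ 0)// oppr_le0.
Qed.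

Lemma compact_support_Lfun (O : set 'rV[R]_d) (oO : open O) f K :
  continuous f -> compact K -> (forall x, ~ K x -> f x = 0) ->
  f \in Lfun (dom_measure oO) 2%:E.
Proof.
move=> cf cK f0; have mf := continuous_measurable_rV cf.
apply: sqr_int_Lfun => //.
have [M MP] := continuous_compact_bound cf cK.
have [B [mB KB] Boo] := compact_finite_measure cK.
apply: (@le_lt_trans _ _ (\int[dom_measure oO]_x ((M ^+ 2)%:E * (\1_B x)%:E))%E).
  apply: ge0_le_integral => //.
  - by move=> x _; rewrite lee_fin sqr_ge0.
  - by apply/measurable_EFinP; exact: measurable_funX.
  - by apply: measurable_funeM; apply/measurable_EFinP; exact: measurable_indic.
  - move=> x _; rewrite -EFinM lee_fin.
    have [Kx|nK] := pselect (K x); last first.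
      by rewrite f0// expr0n/= mulr_ge0// ?sqr_ge0.
    rewrite indicE (mem_set (KB _ Kx)) mulr1 -[leLHS]real_normK ?num_real//.
    by rewrite lerXn2r ?nnegrE// ?MP// (le_trans _ (MP x Kx)).
rewrite ge0_integralZl//; last 2 first.
- by apply/measurable_EFinP; exact: measurable_indic.
- by rewrite lee_fin sqr_ge0.
rewrite integral_indic// setIT lte_mul_pinfty// ?lee_fin ?sqr_ge0//.
apply: le_lt_trans Boo; rewrite /dom_measure/= /mrestr.
by apply: le_measure; rewrite ?inE//; apply: measurableI => //; exact: open_measurable_rV.
Qed.

Lemma partial_support f i K x : closed K -> (forall y, ~ K y -> f y = 0) ->
  ~ K x -> partial i f x = 0.
Proof.
move=> cK f0 nKx; rewrite /partial.
have -> : 'D_(delta_mx ord0 i) f x = 'D_(delta_mx ord0 i) (cst 0 : 'rV[R]_d -> R) x.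
  apply: near_eq_derive.
  have : nbhs x (~` K) by apply: open_nbhs_nbhs; split => //; exact: closed_openC.
  by apply: filterS => y /f0.
by rewrite derive_cst.
Qed.

Lemma test_function_Lfun (O : set 'rV[R]_d) (oO : open O) f :
  @test_function R d O f -> f \in Lfun (dom_measure oO) 2%:E /\
  forall i, partial i f \in Lfun (dom_measure oO) 2%:E.
Proof.
move=> [df [K [cK KO f0]]].
have cl : closed K by apply: compact_closed => //; exact: norm_hausdorff.
split=> [|i].
  apply: compact_support_Lfun cK f0 => x.
  exact: differentiable_continuous (df [::] x).
apply: (compact_support_Lfun _ _ cK) => [x|x]; last exact: partial_support.
exact: differentiable_continuous (df [:: i] x).
Qed.

End compact_support.

(** * Multiplication by essentially bounded coefficients *)

Section multiplication.
Context {d} {T : measurableType d} {R : realType}.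
Context {mu : {measure set T -> \bar R}}.
Implicit Types (f g : L2 mu) (a : Loo mu).

Lemma Loo_ae_bounded a : exists2 A, 0 <= A & {ae mu, forall x, `|a x| <= A}.
Proof.
have := Lfunction_finite _ a; rewrite /finite_norm unlock /Lnorm.
case: ifPn => [mu0 oo|mu0 _].
  have e0 : (0 <= ess_sup mu (abse \o (EFin \o a)))%E.
    by apply: ess_sup_gee => //; apply: aeW => x; rewrite lee_fin.
  exists (fine (ess_sup mu (abse \o (EFin \o a)))); first exact: fine_ge0.
  have := ess_sup_ge mu (abse \o (EFin \o a)).
  apply: filterS => x /=; rewrite -lee_fin fineK//.
  by rewrite ge0_fin_numE.
(* Here the whole space is a null set, so any bound holds almost everywhere. *)
exists 0 => //; exists setT; split => //.
by apply/le_anti; rewrite measure_ge0 andbT leNgt.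
Qed.

Lemma mul_Loo_subproof a f : (fun x => a x * f x) \in Lfun mu 2%:E.
Proof.
have [A A0 aA] := Loo_ae_bounded a.
have maf : measurable_fun setT (fun x => a x * f x) by exact: measurable_funM.
apply: sqr_int_Lfun => //.
apply: (@le_lt_trans _ _ (\int[mu]_x ((A ^+ 2)%:E * (f x ^+ 2)%:E))%E).
  apply: ae_ge0_le_integral => //.
  - by move=> x _; rewrite lee_fin sqr_ge0.
  - by apply/measurable_EFinP; exact: measurable_funX.
  - by move=> x _; rewrite -EFinM lee_fin mulr_ge0// sqr_ge0.
  - by apply: measurable_funeM; apply/measurable_EFinP; exact: measurable_funX.
  apply: filterS aA => x ax _; rewrite -EFinM lee_fin exprMn.
  rewrite ler_wpM2r ?sqr_ge0// -[leLHS]real_normK ?num_real//.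
  by rewrite lerXn2r ?nnegrE.
rewrite ge0_integralZl//.
- by rewrite -l2norm_sqr_int -EFinM ltry.
- by apply/measurable_EFinP; exact: measurable_funX.
- by move=> x _; rewrite lee_fin sqr_ge0.
- by rewrite lee_fin sqr_ge0.
Qed.

(** With coefficients as bounded operators, the form becomes a finite sum of inner products, see
    [bformE]. *)
Definition mul_Loo a f : L2 mu := Lfun_Sub (lee1n 2) (mul_Loo_subproof a f).

Lemma mul_Loo_linear a : l2linear (mul_Loo a).
Proof.
move=> k f g; apply/ae_l2eq; apply: aeW => x _ /=.
by rewrite mulrDr; congr (_ + _); exact: mulrCA.
Qed.

Lemma mul_Loo_bound a : exists2 A, 0 <= A & l2bound (mul_Loo a) A.
Proof.
have [A A0 aA] := Loo_ae_bounded a; exists A => // f.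
rewrite -(ler_pXn2r (n := 2)) ?nnegrE ?mulr_ge0 ?l2norm_ge0//.
rewrite exprMn -lee_fin [leRHS]EFinM !l2norm_sqr_int.
rewrite -ge0_integralZl//.
- apply: ae_ge0_le_integral => //.
  + by move=> x _; rewrite lee_fin sqr_ge0.
  + by apply/measurable_EFinP; exact: measurable_funX.
  + by move=> x _; rewrite -EFinM lee_fin mulr_ge0// sqr_ge0.
  + by apply: measurable_funeM; apply/measurable_EFinP; exact: measurable_funX.
  apply: filterS aA => x ax _; rewrite -EFinM lee_fin /= exprMn.
  rewrite ler_wpM2r ?sqr_ge0// -[leLHS]real_normK ?num_real//.
  by rewrite lerXn2r ?nnegrE.
- by apply/measurable_EFinP; exact: measurable_funX.
- by move=> x _; rewrite lee_fin sqr_ge0.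
- by rewrite lee_fin sqr_ge0.
Qed.

End multiplication.

Section Rintegral_sum.
Context {d} {T : measurableType d} {R : realType} {mu : {measure set T -> \bar R}}.

Lemma integrable_Rsum (I : Type) (r : seq I) (F : I -> T -> R) :
  (forall i, mu.-integrable setT (EFin \o F i)) ->
  mu.-integrable setT (EFin \o (fun x => \sum_(i <- r) F i x)).
Proof.
move=> iF.
have -> : EFin \o (fun x => \sum_(i <- r) F i x) =
    (fun x => \sum_(i <- r) (EFin \o F i) x)%E.
  by apply/funext => x; rewrite /= sumEFin.
by apply: integrable_sum => // i _; exact: iF.
Qed.

Lemma Rintegral_sum (I : Type) (r : seq I) (F : I -> T -> R) :
  (forall i, mu.-integrable setT (EFin \o F i)) ->
  \int[mu]_x (\sum_(i <- r) F i x) = \sum_(i <- r) \int[mu]_x F i x.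
Proof.
move=> iF; elim: r => [|i r IH].
  under eq_Rintegral do rewrite big_nil.
  by rewrite big_nil /Rintegral integral0.
under eq_Rintegral do rewrite big_cons.
by rewrite RintegralD// ?IH ?big_cons//; exact: integrable_Rsum.
Qed.

End Rintegral_sum.

Section H1_theory.
Context {R : realType} {d : nat} {O : set 'rV[R]_d} (oO : open O).
Local Notation mu := (dom_measure oO).
Local Notation L2O := (L2 mu).
Implicit Types (u v w g : L2O) (i : 'I_d).

(** Test functions and their partial derivatives lie in L2. Thus the defining identity is one
    between inner products, which makes its linearity and its invariance under [l2eq] immediate. *)
Lemma is_weak_partialP i u g : is_weak_partial i u g <->
  forall f (tf : @test_function R d O f),
    l2dot u (Lfun_Sub (lee1n 2) ((test_function_Lfun oO tf).2 i)) =
    - l2dot g (Lfun_Sub (lee1n 2) (test_function_Lfun oO tf).1).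
Proof. by split=> H f tf; exact: (H f tf). Qed.

Lemma is_weak_partial_linear i k u v g h :
  is_weak_partial i u g -> is_weak_partial i v h ->
  is_weak_partial i (k *: u + v) (k *: g + h).
Proof.
move=> /is_weak_partialP ug /is_weak_partialP vh; apply/is_weak_partialP => f tf.
by rewrite !l2dotDl !l2dotZl ug vh; ring.
Qed.

Lemma H1_linear k u v : H1 u -> H1 v -> H1 (k *: u + v).
Proof.
move=> H1u H1v i; have [g ug] := H1u i; have [h vh] := H1v i.
by exists (k *: g + h); exact: is_weak_partial_linear.
Qed.

(** A true equality: equivalent functions have the same set of candidates, from which [xget] picks
    the same one. *)
Lemma weak_partial_ext i u v : l2eq u v -> weak_partial i u = weak_partial i v.
Proof.
move=> uv; rewrite /weak_partial; congr xget; apply/funext => g; apply/propext.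
by split=> /is_weak_partialP H; apply/is_weak_partialP => f tf;
  [rewrite -uv|rewrite uv].
Qed.

Lemma l2norm_le_h1norm u : l2norm u <= h1norm u.
Proof.
rewrite -[leLHS]ger0_norm ?l2norm_ge0// -sqrtr_sqr ler_sqrt; last first.
  by rewrite addr_ge0 ?sqr_ge0// sumr_ge0// => i _; rewrite sqr_ge0.
by rewrite lerDl sumr_ge0// => i _; rewrite sqr_ge0.
Qed.

Lemma weak_partial_le_h1norm i u : l2norm (weak_partial i u) <= h1norm u.
Proof.
rewrite -[leLHS]ger0_norm ?l2norm_ge0// -sqrtr_sqr ler_sqrt; last first.
  by rewrite addr_ge0 ?sqr_ge0// sumr_ge0// => j _; rewrite sqr_ge0.
rewrite (bigD1 i)//= addrCA lerDl addr_ge0 ?sqr_ge0//.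
by rewrite sumr_ge0// => j _; rewrite sqr_ge0.
Qed.

Lemma h1norm_ge0 u : 0 <= h1norm u.
Proof. exact: sqrtr_ge0. Qed.

Section dense.
Hypothesis H10_dense : forall f (e : R), 0 < e ->
  exists p, @H10 R d O oO p /\ l2norm (f - p) <= e.

(* [H10] is dense and its elements are limits of test functions, so the test
   functions are dense. *)
Lemma weak_partial_unique i u g h :
  is_weak_partial i u g -> is_weak_partial i u h -> l2eq g h.
Proof.
move=> /is_weak_partialP ug /is_weak_partialP uh; apply/l2eqP/eqP.
rewrite eq_le l2norm_ge0 andbT; apply/ler_addgt0Pr => e e0; rewrite add0r.
have e2 : 0 < e / 2 by rewrite divr_gt0.
have [p [[_ [f [tf fp]]] gp]] := H10_dense (g - h) e2.
have [|N /(_ N (leqnn N)) pf] := (cvg0_seqP _).1 fp _ e2.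
  by move=> n; exact: h1norm_ge0.
have {pf}pf := le_trans (l2norm_le_h1norm _) pf.
have o : l2dot (g - h) (f N) = 0.
  rewrite l2dotBl.
  have -> : f N = Lfun_Sub (lee1n 2) (test_function_Lfun oO (tf N)).1.
    exact/LfuneqP.
  by have := ug _ (tf N); rewrite (uh _ (tf N)) => /oppr_inj ->; rewrite subrr.
have gf : l2norm (g - h - f N) <= e.
  by have := l2dist_triangle (g - h) p (f N); lra.
have : l2norm (g - h) ^+ 2 <= l2norm (g - h) * e.
  rewrite -l2dotff -[leLHS]subr0 -o -l2dotBr (le_trans (l2dot_le _ _))//.
  by rewrite ler_wpM2l// l2norm_ge0.
rewrite expr2; have := l2norm_ge0 (g - h); rewrite le_eqVlt => /predU1P[<- _|n0].
  exact: ltW.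
by rewrite ler_pM2l.
Qed.

Lemma weak_partialP i u : H1 u -> is_weak_partial i u (weak_partial i u).
Proof. by move=> /(_ i)[g ug]; exact: (xgetPex 0 (ex_intro _ g ug)). Qed.

Lemma weak_partial_linear i k u v : H1 u -> H1 v ->
  l2eq (weak_partial i (k *: u + v)) (k *: weak_partial i u + weak_partial i v).
Proof.
move=> Hu Hv; apply: weak_partial_unique (weak_partialP i (H1_linear k Hu Hv)) _.
by apply: is_weak_partial_linear; exact: weak_partialP.
Qed.

End dense.

Section bform.
Variables (a : 'I_d -> 'I_d -> Loo mu) (b : 'I_d -> Loo mu) (c : Loo mu).
Local Notation B := (bform a b c).

Lemma bformE u v : B u v =
  \sum_i \sum_j l2dot (mul_Loo (a i j) (weak_partial i u)) (weak_partial j v) +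
  \sum_i l2dot (mul_Loo (b i) (weak_partial i u)) v +
  l2dot (mul_Loo c u) v.
Proof.
pose Pa i j x := mul_Loo (a i j) (weak_partial i u) x * weak_partial j v x.
pose Pb i x := mul_Loo (b i) (weak_partial i u) x * v x.
pose Pc x := mul_Loo c u x * v x.
have ia i j : mu.-integrable setT (EFin \o Pa i j) by exact: l2dot_integrable.
have ib i : mu.-integrable setT (EFin \o Pb i) by exact: l2dot_integrable.
have ic : mu.-integrable setT (EFin \o Pc) by exact: l2dot_integrable.
have iA i : mu.-integrable setT (EFin \o (fun x => \sum_j Pa i j x)).
  exact: integrable_Rsum.
have -> : B u v = \int[mu]_x (\sum_i \sum_j Pa i j x + \sum_i Pb i x + Pc x).
  by [].
rewrite RintegralD//; last first.
  exact: (integrableD measurableT (integrable_Rsum _ iA) (integrable_Rsum _ ib)).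
rewrite RintegralD//; [|exact: integrable_Rsum..].
rewrite !Rintegral_sum//; congr (_ + _ + _).
by apply: eq_bigr => i _; rewrite Rintegral_sum.
Qed.

Lemma bform_ext u u' v v' : l2eq u u' -> l2eq v v' -> B u v = B u' v'.
Proof.
move=> uu vv; rewrite [LHS]bformE [RHS]bformE.
apply: (f_equal2 +%R); first apply: (f_equal2 +%R).
- by apply: eq_bigr => i _; apply: eq_bigr => j _;
    rewrite (weak_partial_ext i uu) (weak_partial_ext j vv).
- by apply: eq_bigr => i _;
    rewrite (weak_partial_ext i uu) l2dotC vv l2dotC.
- have [A _ bA] := mul_Loo_bound c.
  by rewrite (l2bound_ext (mul_Loo_linear c) bA uu) l2dotC vv l2dotC.
Qed.

Lemma bform_bound : exists2 C, 0 <= C &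
  forall u v, `|B u v| <= C * h1norm u * h1norm v.
Proof.
have [fa fa0 faP] : exists2 fa : 'I_d -> 'I_d -> R, forall i j, 0 <= fa i j &
    forall i j, l2bound (mul_Loo (a i j)) (fa i j).
  exists (fun i j => xget 0 [set A | 0 <= A /\ l2bound (mul_Loo (a i j)) A]);
    by move=> i j; have [A A0 bA] := mul_Loo_bound (a i j);
      have [] := xgetPex 0 (ex_intro (fun A => 0 <= A /\ l2bound (mul_Loo (a i j)) A) A
        (conj A0 bA)).
have [fb fb0 fbP] : exists2 fb : 'I_d -> R, forall i, 0 <= fb i &
    forall i, l2bound (mul_Loo (b i)) (fb i).
  exists (fun i => xget 0 [set A | 0 <= A /\ l2bound (mul_Loo (b i)) A]);
    by move=> i; have [A A0 bA] := mul_Loo_bound (b i);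
      have [] := xgetPex 0 (ex_intro (fun A => 0 <= A /\ l2bound (mul_Loo (b i)) A) A
        (conj A0 bA)).
have [fc fc0 fcP] := mul_Loo_bound c.
exists (\sum_i \sum_j fa i j + \sum_i fb i + fc).
  by rewrite !addr_ge0// sumr_ge0// => i _; rewrite sumr_ge0.
move=> u v; rewrite bformE !mulrDl !mulr_suml.
have term (M : L2O -> L2O) A f g : 0 <= A -> l2bound M A ->
    l2norm f <= h1norm u -> l2norm g <= h1norm v ->
    `|l2dot (M f) g| <= A * h1norm u * h1norm v.
  move=> A0 bM fu gv; apply: le_trans (l2norm_cauchy _ _) _.
  apply: ler_pM => //; rewrite ?l2norm_ge0//.
  by apply: le_trans (bM _) _; rewrite ler_wpM2l.
have sumle (f g : 'I_d -> R) : (forall i, `|f i| <= g i) ->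
    `|\sum_i f i| <= \sum_i g i.
  move=> fg; apply: le_trans (ler_norm_sum _ _ _) _.
  by apply: ler_sum => i _.
apply: le_trans (ler_normD _ _) _; apply: lerD.
  apply: le_trans (ler_normD _ _) _; apply: lerD.
    apply: (sumle) => i; rewrite !mulr_suml; apply: sumle => j.
    by apply: term => //; exact: weak_partial_le_h1norm.
  apply: sumle => i; apply: term => //; first exact: weak_partial_le_h1norm.
  exact: l2norm_le_h1norm.
by apply: term => //; exact: l2norm_le_h1norm.
Qed.

Hypothesis H10_dense : forall f (e : R), 0 < e ->
  exists p, @H10 R d O oO p /\ l2norm (f - p) <= e.

Let split3 (k x x' y y' z z' : R) : k * x + x' + (k * y + y') + (k * z + z') =
  k * (x + y + z) + (x' + y' + z').
Proof. by ring. Qed.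

Lemma bform_linearl k u u' v : H1 u -> H1 u' ->
  B (k *: u + u') v = k * B u v + B u' v.
Proof.
move=> Hu Hu'.
have lw i (q : Loo mu) g :
    l2dot (mul_Loo q (weak_partial i (k *: u + u'))) g =
    k * l2dot (mul_Loo q (weak_partial i u)) g +
    l2dot (mul_Loo q (weak_partial i u')) g.
  have [A _ bA] := mul_Loo_bound q.
  rewrite (l2bound_ext (mul_Loo_linear q) bA (weak_partial_linear H10_dense i k Hu Hu')).
  by rewrite (mul_Loo_linear q) l2dotDl l2dotZl.
rewrite [X in _ = _ + X]bformE [X in _ = k * X + _]bformE.
apply: etrans (bformE _ _) _.
apply: (etrans _ (split3 _ _ _ _ _ _ _)).
apply: (f_equal2 +%R); first apply: (f_equal2 +%R).
- rewrite [X in _ = X + _]mulr_sumr -[RHS]big_split; apply: eq_bigr => i _.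
  rewrite [X in _ = X + _]mulr_sumr -[RHS]big_split; apply: eq_bigr => j _.
  exact: lw.
- rewrite [X in _ = X + _]mulr_sumr -[RHS]big_split; apply: eq_bigr => i _.
  exact: lw.
- by rewrite (mul_Loo_linear c) l2dotDl l2dotZl.
Qed.

Lemma bform_linearr k u v v' : H1 v -> H1 v' ->
  B u (k *: v + v') = k * B u v + B u v'.
Proof.
move=> Hv Hv'.
have lw i g :
    l2dot g (weak_partial i (k *: v + v')) =
    k * l2dot g (weak_partial i v) + l2dot g (weak_partial i v').
  rewrite l2dotC (weak_partial_linear H10_dense i k Hv Hv').
  by rewrite l2dotC l2dotDr l2dotZr.
rewrite [X in _ = _ + X]bformE [X in _ = k * X + _]bformE.
apply: etrans (bformE _ _) _.
apply: (etrans _ (split3 _ _ _ _ _ _ _)).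
apply: (f_equal2 +%R); first apply: (f_equal2 +%R).
- rewrite [X in _ = X + _]mulr_sumr -[RHS]big_split; apply: eq_bigr => i _.
  rewrite [X in _ = X + _]mulr_sumr -[RHS]big_split; apply: eq_bigr => j _.
  exact: lw.
- rewrite [X in _ = X + _]mulr_sumr -[RHS]big_split; apply: eq_bigr => i _.
  by rewrite l2dotDr l2dotZr.
- by rewrite l2dotDr l2dotZr.
Qed.

End bform.
End H1_theory.

(** * Finite-dimensional subspaces and Galerkin semigroups *)

Section finite_dim.
Context {d} {T : measurableType d} {R : realType}.
Context {mu : {measure set T -> \bar R}}.
Implicit Types (f g w : L2 mu).

Definition orthonormal n (e : 'I_n -> L2 mu) :=
  forall i j, l2dot (e i) (e j) = (i == j)%:R.

Definition l2span n (v : 'I_n -> L2 mu) f :=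
  exists c : 'I_n -> R, l2eq f (\sum_i c i *: v i).

Lemma l2span_ext n (v : 'I_n -> L2 mu) f g : l2eq f g -> l2span v f -> l2span v g.
Proof. by move=> fg [c cf]; exists c => h; rewrite -fg cf. Qed.

Lemma l2span_linear n (v : 'I_n -> L2 mu) k f g :
  l2span v f -> l2span v g -> l2span v (k *: f + g).
Proof.
move=> [c cf] [c' cg]; exists (fun i => k * c i + c' i) => h.
rewrite l2dotDl l2dotZl cf cg !l2dot_suml mulr_sumr -big_split/=.
by apply: eq_bigr => i _; rewrite !l2dotZl; ring.
Qed.

Lemma l2span0 n (v : 'I_n -> L2 mu) : l2span v 0.
Proof.
by exists (fun=> 0) => h; rewrite big1// => i _; rewrite scale0r.
Qed.

Lemma l2spanZ n (v : 'I_n -> L2 mu) k f : l2span v f -> l2span v (k *: f).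
Proof. by move=> vf; rewrite -[k *: f]addr0; apply: l2span_linear => //; exact: l2span0. Qed.

Lemma l2span_sum n (v : 'I_n -> L2 mu) (I : Type) (r : seq I) (F : I -> L2 mu) :
  (forall i, l2span v (F i)) -> l2span v (\sum_(i <- r) F i).
Proof.
move=> vF; elim: r => [|i r IH]; first by rewrite big_nil; exact: l2span0.
by rewrite big_cons -[F i]scale1r; exact: l2span_linear.
Qed.

Lemma l2span_gen n (v : 'I_n -> L2 mu) i : l2span v (v i).
Proof.
exists (fun j => (j == i)%:R) => h; rewrite l2dot_suml (bigD1 i)//= big1 => [|j ji].
  by rewrite eqxx scale1r addr0.
by rewrite (negbTE ji) scale0r l2dot0l.
Qed.

Lemma l2span_trans n m (v : 'I_n -> L2 mu) (e : 'I_m -> L2 mu) f :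
  (forall i, l2span v (e i)) -> l2span e f -> l2span v f.
Proof.
move=> ve [c cf]; apply: l2span_ext (l2eq_sym cf) _.
by apply: l2span_sum => i; exact: l2spanZ.
Qed.

Lemma orthonormal_sub_proj n (e : 'I_n -> L2 mu) f j : orthonormal e ->
  l2dot (f - \sum_i l2dot f (e i) *: e i) (e j) = 0.
Proof.
move=> oe; rewrite l2dotBl l2dot_suml (bigD1 j)//= l2dotZl oe eqxx mulr1.
rewrite big1 ?addr0 ?subrr// => i ij.
by rewrite l2dotZl oe (negbTE ij) mulr0.
Qed.

(** The residual of each further vector is normalized, or dropped when its norm is zero, so [k] may
    be smaller than [n]. *)
Lemma gram_schmidt n (v : 'I_n -> L2 mu) : exists k (e : 'I_k -> L2 mu),
  [/\ orthonormal e, forall i, l2span e (v i) & forall j, l2span v (e j)].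
Proof.
elim: n v => [|n IH] v.
  by exists 0%N, (fun=> 0); split; case.
have [k [e [oe ve ev]]] := IH (fun i => v (lift ord0 i)).
have ev' j : l2span v (e j).
  by apply: l2span_trans (ev j) => i; exact: l2span_gen.
pose r := v ord0 - \sum_j l2dot (v ord0) (e j) *: e j.
have re j : l2dot r (e j) = 0 by exact: orthonormal_sub_proj.
have vr : l2span v r.
  rewrite /r addrC -scaleN1r; apply: l2span_linear; last exact: l2span_gen.
  by apply: l2span_sum => j; exact: l2spanZ.
have [r0|r0] := eqVneq (l2norm r) 0.
  exists k, e; split => // i.
  case: (unliftP ord0 i) => [j ->|->]; first exact: ve.
  exists (fun j => l2dot (v ord0) (e j)).
  by apply/l2eqP.
pose e' (j : 'I_k.+1) := if unlift ord0 j is Some i then e i else (l2norm r)^-1 *: r.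
have e'0 : e' ord0 = (l2norm r)^-1 *: r by rewrite /e' unlift_none.
have e'S j : e' (lift ord0 j) = e j by rewrite /e' liftK.
exists k.+1, e'; split.
- move=> i j; case: (unliftP ord0 i) => [i' ->|->]; case: (unliftP ord0 j) => [j' ->|->].
  + by rewrite !e'S oe (inj_eq lift_inj).
  + by rewrite e'S e'0 l2dotZr l2dotC re mulr0.
  + by rewrite e'S e'0 l2dotZl re mulr0.
  + rewrite e'0 l2dotZl l2dotZr l2dotff eqxx expr2 mulrA.
    by rewrite mulrACA mulVf// mulr1.
- have ee j : l2span e' (e j) by rewrite -e'S; exact: l2span_gen.
  move=> i; case: (unliftP ord0 i) => [j ->|->].
    by apply: l2span_trans (ve j).
  have -> : v ord0 = 1 *: (\sum_j l2dot (v ord0) (e j) *: e j) + r.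
    by rewrite scale1r /r subrKC.
  apply: l2span_linear; first by apply: l2span_sum => j; exact: l2spanZ.
  have -> : r = l2norm r *: e' ord0 by rewrite e'0 scalerA mulfV// scale1r.
  by apply: l2spanZ; exact: l2span_gen.
- move=> j; case: (unliftP ord0 j) => [j' ->|->]; first by rewrite e'S.
  by rewrite e'0; exact: l2spanZ.
Qed.

Section subspace.
Variables (X : set (L2 mu)) (hX : fin_dim_subspace X).

Lemma fin_dim_basis : exists k (e : 'I_k -> L2 mu),
  orthonormal e /\ forall f, X f <-> l2span e f.
Proof.
have [n [v ->]] := hX; have [k [e [oe ve ev]]] := gram_schmidt v.
exists k, e; split => // f; split=> [[c /ae_l2eq fc]|ef].
  by apply: l2span_trans ve _; exists c.
by have [c cf] := l2span_trans ev ef; exists c; exact/ae_l2eq.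
Qed.

Lemma fin_dim_linear k f g : X f -> X g -> X (k *: f + g).
Proof.
have [n [e [_ XE]]] := fin_dim_basis.
by move=> /XE Xf /XE Xg; apply/XE; exact: l2span_linear.
Qed.

Lemma fin_dim0 : X 0.
Proof. by have [n [e [_ XE]]] := fin_dim_basis; apply/XE; exact: l2span0. Qed.

Lemma fin_dimZ k f : X f -> X (k *: f).
Proof. by move=> Xf; rewrite -[k *: f]addr0; apply: fin_dim_linear => //; exact: fin_dim0. Qed.

Lemma fin_dimD f g : X f -> X g -> X (f + g).
Proof. by move=> Xf Xg; rewrite -[f]scale1r; exact: fin_dim_linear. Qed.

Lemma fin_dimB f g : X f -> X g -> X (f - g).
Proof. by move=> Xf Xg; rewrite addrC -scaleN1r; exact: fin_dim_linear. Qed.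

Lemma fin_dim_ext f g : l2eq f g -> X f -> X g.
Proof.
have [n [e [_ XE]]] := fin_dim_basis.
by move=> fg /XE Xf; apply/XE; exact: l2span_ext fg Xf.
Qed.

Lemma fin_dim_sum (I : Type) (r : seq I) (F : I -> L2 mu) :
  (forall i, X (F i)) -> X (\sum_(i <- r) F i).
Proof.
have [n [e [_ XE]]] := fin_dim_basis => XF; apply/XE.
by apply: l2span_sum => i; exact/XE.
Qed.

Lemma fin_dim_eq f g : X f -> X g -> (forall h, X h -> l2dot f h = l2dot g h) ->
  l2eq f g.
Proof.
move=> Xf Xg fg; apply/l2eqP/eqP; rewrite -sqrf_eq0 -l2dotff l2dotBl.
by rewrite fg ?subrr//; exact: fin_dimB.
Qed.

Lemma fin_dim_expand k (e : 'I_k -> L2 mu) f : orthonormal e ->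
  (forall g, X g <-> l2span e g) -> X f -> l2eq f (\sum_i l2dot f (e i) *: e i).
Proof.
move=> oe XE /XE Xf; have [c cf] := Xf.
have cE j : l2dot f (e j) = c j.
  rewrite cf l2dot_suml (bigD1 j)//= big1 => [|i ij].
    by rewrite l2dotZl oe eqxx mulr1 addr0.
  by rewrite l2dotZl oe (negbTE ij) mulr0.
by apply: l2eq_trans cf _; apply: l2eq_sum => i _; rewrite cE.
Qed.

(** The representative is the sum of the [l (e i) *: e i]. Both the orthogonal projection and the
    Galerkin operator exist by this lemma. *)
Lemma fin_dim_riesz (l : L2 mu -> R) :
  (forall k f g, X f -> X g -> l (k *: f + g) = k * l f + l g) ->
  (forall f g, X f -> l2eq f g -> l f = l g) ->
  exists w, X w /\ forall g, X g -> l2dot w g = l g.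
Proof.
move=> ll lx; have [n [e [oe XE]]] := fin_dim_basis.
have Xe i : X (e i) by apply/XE; exact: l2span_gen.
exists (\sum_i l (e i) *: e i); split.
  by apply: fin_dim_sum => i; exact: fin_dimZ.
move=> g Xg; rewrite (lx g _ Xg (fin_dim_expand oe XE Xg)).
have l0 : l 0 = 0.
  have := ll 1 0 0 fin_dim0 fin_dim0; rewrite scaler0 addr0 mul1r => /eqP.
  by rewrite -subr_eq0 opprD addrA subrr sub0r oppr_eq0 => /eqP.
have ls (r : seq 'I_n) (c : 'I_n -> R) :
    l (\sum_(i <- r) c i *: e i) = \sum_(i <- r) c i * l (e i).
  elim: r => [|i r IH]; first by rewrite !big_nil.
  rewrite !big_cons ll//; first by rewrite IH.
  by apply: fin_dim_sum => j; exact: fin_dimZ.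
rewrite ls l2dot_suml; apply: eq_bigr => i _.
by rewrite l2dotZl mulrC l2dotC.
Qed.

Lemma orth_projP f : X (orth_proj X f) /\
  forall g, X g -> l2dot (f - orth_proj X f) g = 0.
Proof.
have [||p [Xp pP]] := @fin_dim_riesz (l2dot f).
- by move=> k h g _ _; rewrite l2dotDr l2dotZr.
- by move=> h g _ hg; rewrite l2dotC hg l2dotC.
have pf : [set p | X p /\ forall g, X g -> l2dot (f - p) g = 0] p.
  by split => // g Xg; rewrite l2dotBl pP// subrr.
exact: (xgetPex 0 (ex_intro _ p pf)).
Qed.

Section projection.
(** [P] is any selection with the characterizing property, and likewise [A] and [E] below, so these
    lemmas see nothing of [xget]. *)
Variables (P : L2 mu -> L2 mu).
Hypothesis PP : forall f, X (P f) /\ forall g, X g -> l2dot (f - P f) g = 0.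

Lemma orth_proj_dot f g : X g -> l2dot (P f) g = l2dot f g.
Proof.
move=> Xg; have /eqP := (PP f).2 g Xg.
by rewrite l2dotBl subr_eq0 => /eqP.
Qed.

Lemma orth_proj_linear : l2linear (P).
Proof.
move=> k f g; apply: fin_dim_eq; first exact: (PP _).1.
  by apply: fin_dim_linear; exact: (PP _).1.
move=> h Xh; rewrite (orth_proj_dot _ Xh) !l2dotDl !l2dotZl.
by rewrite -(orth_proj_dot f Xh) -(orth_proj_dot g Xh).
Qed.

Lemma orth_proj_id f : X f -> l2eq (P f) f.
Proof.
move=> Xf; apply: fin_dim_eq => //; first exact: (PP _).1.
by move=> h Xh; exact: orth_proj_dot.
Qed.

Lemma orth_proj_bound : l2bound (P) 1.
Proof.
move=> f; rewrite mul1r; have := orth_proj_dot f (PP f).1.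
rewrite l2dotff => E; have := l2dot_le f (P f); rewrite -E expr2.
have := l2norm_ge0 (P f); rewrite le_eqVlt => /predU1P[<- _|n0].
  exact: l2norm_ge0.
by rewrite ler_pM2r.
Qed.

End projection.

(** The projection fixes each [s n] and is a contraction, so the limit [w] is equivalent to its own
    projection. *)
Lemma fin_dim_closed (s : nat -> L2 mu) w : (forall n, X (s n)) ->
  l2norm (s n - w) @[n --> \oo] --> 0 -> X w.
Proof.
have [P PP] : exists P, forall f, X (P f) /\ forall g, X g -> l2dot (f - P f) g = 0.
  by exists (orth_proj X) => f; exact: orth_projP.
move=> Xs /(cvg0_seqP (fun n => l2norm_ge0 (s n - w))) sw.
suff : l2eq (P w) w by move=> /fin_dim_ext; apply; exact: (PP _).1.
apply/l2eqP/eqP; rewrite eq_le l2norm_ge0 andbT.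
apply/ler_addgt0Pr => e e0; rewrite add0r.
have [|N /(_ N (leqnn N)) sN] := sw (e / 2); first by rewrite divr_gt0.
have : l2norm (P w - s N) <= e / 2.
  have -> : l2norm (P w - s N) = l2norm (P (w - s N)).
    apply: l2eq_norm => h; rewrite (l2linearB _ _ (orth_proj_linear PP)) !l2dotBl.
    by rewrite (orth_proj_id PP (Xs N)).
  by rewrite (le_trans (orth_proj_bound PP _))// mul1r l2distC.
by have := l2dist_triangle (P w) (s N) w; lra.
Qed.

End subspace.
End finite_dim.

(** * The Galerkin operator and its exponential *)

Section galerkin_exp.
Context {d} {T : measurableType d} {R : realType}.
Context {mu : {measure set T -> \bar R}}.
Implicit Types (f g u v w : L2 mu) (s t : R).
Variables (X : set (L2 mu)) (hX : fin_dim_subspace X).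
Variable B : L2 mu -> L2 mu -> R.
Hypothesis Bl : forall k u u' v, X u -> X u' -> X v ->
  B (k *: u + u') v = k * B u v + B u' v.
Hypothesis Br : forall k u v v', X u -> X v -> X v' ->
  B u (k *: v + v') = k * B u v + B u v'.
Hypothesis Bx : forall u u' v v', l2eq u u' -> l2eq v v' -> B u v = B u' v'.

Lemma galerkin_exists u : X u ->
  exists w, X w /\ forall v, X v -> l2dot w v = - B u v.
Proof.
move=> Xu; apply: (fin_dim_riesz hX (l := fun v => - B u v)).
- by move=> k f g Xf Xg; rewrite Br//; ring.
- by move=> f g Xf fg; rewrite (Bx (l2eq_refl u) fg).
Qed.

Variable A : L2 mu -> L2 mu.
Hypothesis galerkin_opP : forall u, X u ->
  X (A u) /\ forall v, X v -> l2dot (A u) v = - B u v.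

Lemma galerkin_in u : X u -> X (A u).
Proof. by case/galerkin_opP. Qed.

Lemma galerkin_linear k u v : X u -> X v -> l2eq (A (k *: u + v)) (k *: A u + A v).
Proof.
move=> Xu Xv; have Xuv := fin_dim_linear hX k Xu Xv.
apply: (fin_dim_eq hX); first exact: galerkin_in.
  by apply: (fin_dim_linear hX); exact: galerkin_in.
move=> h Xh; rewrite l2dotDl l2dotZl (galerkin_opP Xuv).2// (galerkin_opP Xu).2//.
by rewrite (galerkin_opP Xv).2// Bl//; ring.
Qed.

Lemma galerkin_ext u v : X u -> l2eq u v -> l2eq (A u) (A v).
Proof.
move=> Xu uv; have Xv := fin_dim_ext hX uv Xu.
apply: (fin_dim_eq hX); [exact: galerkin_in..|].
move=> h Xh; rewrite (galerkin_opP Xu).2// (galerkin_opP Xv).2//.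
by rewrite (Bx uv (l2eq_refl h)).
Qed.

(** The constant depends on [X] and serves only the exponential series on one space. Bounds uniform
    in [K] come from Garding's inequality, see [galerkin_exp_bound]. *)
Lemma galerkin_bound : exists2 C, 0 <= C &
  forall u, X u -> l2norm (A u) <= C * l2norm u.
Proof.
have [n [e [oe XE]]] := fin_dim_basis hX.
have Xe i : X (e i) by apply/XE; exact: l2span_gen.
have e1 i : l2norm (e i) = 1 by rewrite l2normE oe eqxx sqrtr1.
exists (\sum_i l2norm (A (e i))); first by rewrite sumr_ge0// => i _; exact: l2norm_ge0.
move=> u Xu.
have Au : l2eq (A u) (\sum_i l2dot u (e i) *: A (e i)).
  have XA := galerkin_in Xu.
  apply: (fin_dim_eq hX) => //.
    by apply: (fin_dim_sum hX) => i; apply: (fin_dimZ hX); exact: galerkin_in.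
  move=> h Xh; rewrite (galerkin_opP Xu).2//.
  rewrite (Bx (fin_dim_expand oe XE Xu) (l2eq_refl h)) l2dot_suml.
  have B0 : B 0 h = 0.
    have := Bl 1 (fin_dim0 hX) (fin_dim0 hX) Xh.
    rewrite scaler0 addr0 mul1r => /eqP.
    by rewrite -subr_eq0 opprD addrA subrr sub0r oppr_eq0 => /eqP.
  have Bs (r : seq 'I_n) (c : 'I_n -> R) :
      B (\sum_(i <- r) c i *: e i) h = \sum_(i <- r) c i * B (e i) h.
    elim: r => [|i r IH]; first by rewrite !big_nil.
    rewrite !big_cons Bl//; first by rewrite IH.
    by apply: (fin_dim_sum hX) => j; exact: fin_dimZ.
  rewrite Bs -sumrN; apply: eq_bigr => i _.
  by rewrite l2dotZl (galerkin_opP (Xe i)).2// mulrN.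
rewrite (l2eq_norm Au) mulr_suml (le_trans (l2norm_sum _ _ _))//.
apply: ler_sum => i _; rewrite l2normZ mulrC ler_wpM2l ?l2norm_ge0//.
by rewrite (le_trans (l2norm_cauchy _ _))// e1 mulr1.
Qed.

Lemma galerkin_iter_in l u : X u -> X (iter l A u).
Proof. by move=> Xu; elim: l => // l IH; exact: galerkin_in. Qed.

Lemma galerkin_iter_linear l k u v : X u -> X v ->
  l2eq (iter l A (k *: u + v)) (k *: iter l A u + iter l A v).
Proof.
move=> Xu Xv; elim: l => [|l IH]; first exact: l2eq_refl.
have Xl := galerkin_iter_in l Xu; have Yl := galerkin_iter_in l Xv.
apply: l2eq_trans (galerkin_linear k Xl Yl); apply: galerkin_ext => //.
by apply: galerkin_iter_in; exact: fin_dim_linear.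
Qed.

Let psum t f n := \sum_(l < n) (t ^+ l / l`!%:R) *: iter l A f.

Lemma galerkin_psum_in t f n : X f -> X (psum t f n).
Proof.
move=> Xf; apply: (fin_dim_sum hX) => l; apply: (fin_dimZ hX).
exact: galerkin_iter_in.
Qed.

(** The scalar exponential series of [|t| * C] dominates, so the partial sums are Cauchy and [xget]
    has a candidate. *)
Lemma exp_op_spec t f : X f ->
  l2norm (psum t f n - exp_op A t f) @[n --> \oo] --> 0.
Proof.
move=> Xf; suff [w wP] : exists w, l2norm (psum t f n - w) @[n --> \oo] --> 0.
  pose W := [set w | l2norm (psum t f n - w) @[n --> \oo] --> 0].
  by have : W (xget 0 W) by apply: xgetPex; exists w.
apply: l2_complete => e e0.
have [C C0 AC] := galerkin_bound.
have itC l : l2norm (iter l A f) <= C ^+ l * l2norm f.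
  elim: l => [|l IH]; first by rewrite mul1r.
  rewrite iterS (le_trans (AC _ (galerkin_iter_in l Xf)))//.
  by rewrite exprS -mulrA ler_wpM2l.
pose a := series (exp_coeff (`|t| * C)).
have psumB n m : (n <= m)%N ->
    l2norm (psum t f m - psum t f n) <= (a m - a n) * l2norm f.
  move=> nm; rewrite /psum /a /series/=.
  rewrite -!(big_mkord xpredT (fun l => (t ^+ l / l`!%:R) *: iter l A f)).
  have cut (V : zmodType) (F : nat -> V) : \sum_(0 <= i < m) F i -
      \sum_(0 <= i < n) F i = \sum_(n <= i < m) F i.
    by rewrite (big_cat_nat (leq0n n) nm)/= addrAC subrr add0r.
  rewrite !cut mulr_suml.
  rewrite (le_trans (l2norm_sum _ _ _))//; apply: ler_sum => l _.
  rewrite l2normZ /exp_coeff/= normrM normrX normfV normr_nat.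
  rewrite [leRHS]mulrAC [leLHS]mulrAC ler_wpM2r ?invr_ge0//.
  by rewrite exprMn -mulrA ler_wpM2l ?exprn_ge0.
have : cvgn a by exact: is_cvg_series_exp_coeff.
have f1 : 0 < l2norm f + 1 by rewrite ltr_wpDl ?l2norm_ge0.
have e2 : 0 < e / 2 / 2 / (l2norm f + 1) by rewrite !divr_gt0.
move=> /cvgrPdist_le/(_ _ e2)[N _ NP].
have b m : (N <= m)%N -> l2norm (psum t f m - psum t f N) <= e / 2.
  move=> Nm; apply: le_trans (psumB _ _ Nm) _.
  have h : a m - a N <= e / 2 / (l2norm f + 1).
    have h1 := NP m Nm; have h2 := NP N (leqnn N).
    rewrite /= in h1 h2; apply: le_trans (ler_norm _) _.
    rewrite -(subrKA (limn a)) (le_trans (ler_normD _ _))//.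
    rewrite [X in _ <= X / _]splitr mulrDl lerD// distrC//.
  apply: le_trans (ler_wpM2r (l2norm_ge0 f) h) _.
  rewrite mulrAC ler_pdivrMr// ler_wpM2l ?(ltW (divr_gt0 e0 _))//.
  by rewrite lerDl.
exists N => m n Nm Nn; apply: le_trans (l2dist_triangle _ (psum t f N) _) _.
by rewrite [leRHS]splitr lerD ?b// l2distC b.
Qed.

Variable E : R -> L2 mu -> L2 mu.
Hypothesis exp_op_cvg : forall t f, X f ->
  l2norm (psum t f n - E t f) @[n --> \oo] --> 0.

Lemma exp_op_in t f : X f -> X (E t f).
Proof.
move=> Xf; apply: (fin_dim_closed hX) (exp_op_cvg t Xf) => n.
exact: galerkin_psum_in.
Qed.

Lemma cvg_l2dot (z : nat -> L2 mu) w g : l2norm (z n - w) @[n --> \oo] --> 0 ->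
  l2dot (z n) g @[n --> \oo] --> l2dot w g.
Proof.
move=> /(cvg0_seqP (fun n => l2norm_ge0 (z n - w))) zw; apply/cvgrPdist_le => e e0.
have g1 : 0 < l2norm g + 1 by rewrite ltr_wpDl ?l2norm_ge0.
have [|N NP] := zw (e / (l2norm g + 1)); first by rewrite divr_gt0.
exists N => // n /NP zn; rewrite -l2dotBl (le_trans (l2norm_cauchy _ _))//.
rewrite l2distC (le_trans (ler_wpM2r (l2norm_ge0 g) zn))//.
by rewrite mulrAC ler_pdivrMr// ler_wpM2l ?ltW// ltrDl.
Qed.

Let coef f g l := (l`!%:R)^-1 * l2dot (iter l A f) g.

Lemma exp_op_pseries t f g : X f ->
  pseries (coef f g) t @ \oo --> l2dot (E t f) g.
Proof.
move=> Xf; have := cvg_l2dot (g := g) (exp_op_cvg t Xf).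
have -> // : (fun n => l2dot (psum t f n) g) = pseries (coef f g) t.
apply/funext => n; rewrite /psum l2dot_suml /pseries/= /series/= big_mkord.
by apply: eq_bigr => l _; rewrite l2dotZl /coef; ring.
Qed.

(** Paired with [g], the exponential is a scalar power series. Formal differentiation turns the
    coefficients for [f] into those for [A f], and termwise differentiation inside the radius of
    convergence concludes. *)
Lemma exp_op_derive t f g : X f ->
  is_derive t 1 (fun s => l2dot (E s f) g) (l2dot (E t (A f)) g).
Proof.
move=> Xf.
have limE s h : X h -> l2dot (E s h) g = limn (pseries (coef h g) s).
  by move=> Xh; apply/esym/cvg_lim => //; exact: exp_op_pseries.
have -> : (fun s => l2dot (E s f) g) = (fun s => limn (pseries (coef f g) s)).
  by apply/funext => s; exact: limE.
have diffsE h : pseries_diffs (coef h g) = coef (A h) g.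
  apply/funext => l; rewrite /pseries_diffs /coef factS natrM invfM -iterSr.
  by rewrite mulrA mulrA mulfV ?mul1r// pnatr_eq0.
have XA := galerkin_in Xf; have XAA := galerkin_in XA.
rewrite limE// -diffsE; apply: (@pseries_snd_diffs _ _ (`|t| + 1)).
- by apply/cvg_ex; eexists; exact: exp_op_pseries.
- by rewrite diffsE; apply/cvg_ex; eexists; exact: exp_op_pseries.
- by rewrite !diffsE; apply/cvg_ex; eexists; exact: exp_op_pseries.
- by rewrite [ltRHS]ger0_norm ?addr_ge0// ltrDl.
Qed.

Lemma exp_op_linear t k f g : X f -> X g ->
  l2eq (E t (k *: f + g)) (k *: E t f + E t g).
Proof.
move=> Xf Xg h; have Xfg := fin_dim_linear hX k Xf Xg.
have H := cvg_l2dot (g := h) (exp_op_cvg t Xfg).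
rewrite l2dotDl l2dotZl -(cvg_lim _ H)//; apply: cvg_lim => //.
have -> : (fun n => l2dot (psum t (k *: f + g) n) h) =
    (fun n => k * l2dot (psum t f n) h + l2dot (psum t g n) h).
  apply/funext => n; rewrite /psum !l2dot_suml mulr_sumr -big_split/=.
  apply: eq_bigr => l _.
  by rewrite !l2dotZl (galerkin_iter_linear l k Xf Xg) l2dotDl l2dotZl; ring.
by apply: cvgD; [apply: cvgMr|]; exact: cvg_l2dot (exp_op_cvg t _).
Qed.

Lemma exp_op_ext t f g : X f -> l2eq f g -> l2eq (E t f) (E t g).
Proof.
move=> Xf fg h; have Xg := fin_dim_ext hX fg Xf.
have H := cvg_l2dot (g := h) (exp_op_cvg t Xf).
rewrite -(cvg_lim _ H)//; apply: cvg_lim => //.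
have -> : (fun n => l2dot (psum t f n) h) = (fun n => l2dot (psum t g n) h).
  apply/funext => n; rewrite /psum !l2dot_suml; apply: eq_bigr => l _.
  rewrite !l2dotZl; congr (_ * _).
  suff : l2eq (iter l A f) (iter l A g) by exact.
  elim: (nat_of_ord l) => [//|j IH] /=.
  exact: (galerkin_ext (galerkin_iter_in j Xf) IH).
exact: cvg_l2dot (exp_op_cvg t _).
Qed.

Lemma exp_op0 f : X f -> l2eq (E 0 f) f.
Proof.
move=> Xf h; have H := cvg_l2dot (g := h) (exp_op_cvg 0 Xf).
rewrite -(cvg_lim _ H)//; apply: cvg_lim => //.
apply: cvg_near_cst; exists 1%N => // n /= n1.
rewrite /psum -(big_mkord xpredT (fun l => (0 ^+ l / l`!%:R) *: iter l A f)).
rewrite big_ltn//= expr0 divr1 scale1r big_nat big1 ?addr0// => l /andP[l0 _].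
by rewrite expr0n eqn0Ngt l0/= mul0r scale0r.
Qed.

(** [A] commutes with the partial sums by linearity of [B] and with the limit by
    [galerkin_bound]. *)
Lemma exp_op_galerkin t f : X f -> l2eq (E t (A f)) (A (E t f)).
Proof.
move=> Xf; have XA := galerkin_in Xf; have XE := exp_op_in t Xf.
apply: (fin_dim_eq hX); [exact: exp_op_in|exact: galerkin_in|].
move=> h Xh.
have H := cvg_l2dot (g := h) (exp_op_cvg t XA).
rewrite -(cvg_lim _ H)//; apply: cvg_lim => //.
have -> : (fun n => l2dot (psum t (A f) n) h) = (fun n => l2dot (A (psum t f n)) h).
  apply/funext => n; rewrite (galerkin_opP (galerkin_psum_in t n Xf)).2// /psum.
  have B0 : B 0 h = 0.
    have := Bl 1 (fin_dim0 hX) (fin_dim0 hX) Xh.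
    rewrite scaler0 addr0 mul1r => /eqP.
    by rewrite -subr_eq0 opprD addrA subrr sub0r oppr_eq0 => /eqP.
  have Bs (r : seq 'I_n) (c : 'I_n -> R) :
      B (\sum_(i <- r) c i *: iter i A f) h = \sum_(i <- r) c i * B (iter i A f) h.
    elim: r => [|i r IH]; first by rewrite !big_nil.
    have Xi := galerkin_iter_in i Xf.
    rewrite !big_cons Bl//; first by rewrite IH.
    by apply: (fin_dim_sum hX) => j; apply: (fin_dimZ hX); exact: galerkin_iter_in.
  rewrite Bs -sumrN l2dot_suml; apply: eq_bigr => l _.
  rewrite l2dotZl -iterSr iterS (galerkin_opP (galerkin_iter_in l Xf)).2//.
  by rewrite mulrN.
apply: cvg_l2dot; apply/cvg0_seqP => [n|e e0]; first exact: l2norm_ge0.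
have [C C0 AC] := galerkin_bound.
have eC : 0 < e / (C + 1) by rewrite divr_gt0// ltr_wpDl.
have [N NP] := (cvg0_seqP (fun n => l2norm_ge0 _)).1 (exp_op_cvg t Xf) _ eC.
exists N => n /NP nP.
have Xn := galerkin_psum_in t n Xf.
have -> : l2norm (A (psum t f n) - A (E t f)) = l2norm (A (psum t f n - E t f)).
  apply: l2eq_norm => k; have := galerkin_linear (-1) XE Xn k.
  by rewrite !scaleN1r addrC => ->; rewrite l2dotBl l2dotDl l2dotNl addrC.
have XnE := fin_dimB hX Xn XE.
apply: le_trans (AC _ XnE) _; apply: le_trans (ler_wpM2l C0 nP) _.
rewrite mulrCA ler_piMr ?ltW// ltr_pdivrMr ?ltr_wpDl// mul1r.
by rewrite ltrDl.
Qed.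

End galerkin_exp.

Lemma gronwall (R : realType) (q dq : R -> R) (l eta a b : R) :
  0 <= l -> 0 <= eta -> (forall t : R, is_derive t 1 q (dq t)) ->
  (forall t, a <= t -> t <= b -> dq t <= l * q t + eta) ->
  forall t, a <= t -> t <= b -> q t <= expR (l * (t - a)) * (q a + eta * (t - a)).
Proof.
move=> l0 eta0 dqP dqle t at_ tb.
(* [p] does not increase: its derivative is at most [eta * (expR (- (l * (s - a))) - 1)], which is
   nonpositive for [a <= s]. *)
pose p s := expR (- (l * (s - a))) * q s - eta * (s - a).
pose dp s := expR (- (l * (s - a))) * (dq s - l * q s) - eta.
have dpP (s : R) : is_derive s 1 p (dp s).
  have d0 : is_derive s 1 (fun s => s - a) 1.
    by have := is_deriveB (is_derive_id s (1 : R)) (is_derive_cst a s 1); rewrite subr0.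
  have d1 : is_derive s 1 (fun s => - (l * (s - a))) (- l).
    have := is_deriveN (is_deriveZ l d0).
    by rewrite [l *: 1]mulr1.
  have d2 := @is_derive1_comp R expR (fun s => - (l * (s - a))) s _ _
    (is_derive_expR _) d1.
  have d3 := is_deriveB (is_deriveM d2 (dqP s)) (is_deriveZ eta d0).
  refine (@is_derive_eq _ _ _ p s 1 _ _ d3 _); rewrite /dp.
  change (expR (- (l * (s - a))) * dq s + q s * (expR (- (l * (s - a))) * (- l)) - eta * 1 =
     expR (- (l * (s - a))) * (dq s - l * q s) - eta).
  by ring.
have [|c cin E] := MVT_segment at_ (fun s _ => dpP s).
  apply: derivable_within_continuous => s _; by have [] := dpP s.
have pt : p t <= p a.
  rewrite -subr_le0 E mulr_le0_ge0 ?subr_ge0//.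
  move: cin; rewrite in_itv/= => /andP[ac ct].
  have h := dqle c ac (le_trans ct tb).
  rewrite subr_le0; apply: le_trans (_ : 1 * eta <= _); last by rewrite mul1r.
  apply: le_trans (ler_wpM2l (expR_ge0 _) (_ : _ <= eta)) _; first by lra.
  rewrite ler_wpM2r// -expR0 ler_expR oppr_le0 mulr_ge0// subr_ge0//.
move: pt; rewrite /p subrr !mulr0 oppr0 expR0 mul1r addr0 => pt.
rewrite mulrC -ler_pdivrMr ?expR_gt0// -expRN mulrC.
by lra.
Qed.

(** * Convergence of the Galerkin semigroups *)

Section energy_derivative.
Context {d} {T : measurableType d} {R : realType}.
Context {mu : {measure set T -> \bar R}}.
Implicit Types (f g u v w : L2 mu) (s t : R).
Variables (X : set (L2 mu)) (hX : fin_dim_subspace X).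

(* In finite dimension weak differentiability suffices: expand in an orthonormal
   basis. *)
Lemma is_derive_sqr_path (z dz : R -> L2 mu) t :
  (forall s, X (z s)) -> X (dz t) ->
  (forall g, is_derive t 1 (fun s => l2dot (z s) g) (l2dot (dz t) g)) ->
  is_derive t 1 (fun s => l2norm (z s) ^+ 2) (2 * l2dot (dz t) (z t)).
Proof.
move=> Xz Xdz dzP; have [n [e [oe XE]]] := fin_dim_basis hX.
have -> : (fun s => l2norm (z s) ^+ 2) = (fun s => \sum_i l2dot (z s) (e i) ^+ 2).
  apply/funext => s; rewrite -l2dotff (fin_dim_expand oe XE (Xz s)) l2dot_suml.
  by apply: eq_bigr => i _; rewrite l2dotZl l2dotC expr2.
have -> : 2 * l2dot (dz t) (z t) =
    \sum_i 2 * l2dot (z t) (e i) * l2dot (dz t) (e i).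
  rewrite (fin_dim_expand oe XE Xdz) l2dot_suml mulr_sumr.
  by apply: eq_bigr => i _; rewrite l2dotZl (l2dotC (e i)); ring.
have -> : (fun s => \sum_i l2dot (z s) (e i) ^+ 2) =
   \sum_i (fun s => l2dot (z s) (e i) ^+ 2).
  by apply/funext => s; rewrite fct_sumE.
apply: is_derive_sum => i.
have d2 := is_deriveM (dzP (e i)) (dzP (e i)).
refine (@is_derive_eq _ _ _ (fun s => l2dot (z s) (e i) ^+ 2) t 1 _ _ d2 _).
change (l2dot (z t) (e i) * l2dot (dz t) (e i) + l2dot (z t) (e i) * l2dot (dz t) (e i) =
  2 * l2dot (z t) (e i) * l2dot (dz t) (e i)).
by ring.
Qed.

End energy_derivative.

(** * Energy estimates in an abstract setting *)

Section galerkin_energy.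
Context {d} {T : measurableType d} {R : realType}.
Context {mu : {measure set T -> \bar R}}.
Implicit Types (f g u v w phi psi : L2 mu) (s t : R).

(** [V], [H] and [h1] stand for [H1], [H10] and [h1norm]. Linearity of [B] in the second argument
    has done its work once the Galerkin operators [A] exist. *)
Variables (V H : set (L2 mu)) (h1 : L2 mu -> R) (B : L2 mu -> L2 mu -> R).
Variables (CB kappa kappa0 : R).
Hypothesis HV : H `<=` V.
Hypothesis Bl : forall k u u' v, V u -> V u' -> B (k *: u + u') v = k * B u v + B u' v.
Hypothesis Bx : forall u u' v v', l2eq u u' -> l2eq v v' -> B u v = B u' v'.
Hypothesis l2h1 : forall u, l2norm u <= h1 u.
Hypothesis CB0 : 0 <= CB.
Hypothesis BC : forall u v, `|B u v| <= CB * h1 u * h1 v.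
Hypothesis kappa_ge0 : 0 <= kappa.
Hypothesis kappa0_gt0 : 0 < kappa0.
Hypothesis garding : forall phi, H phi ->
  kappa0 * h1 phi ^+ 2 <= B phi phi + kappa * l2norm phi ^+ 2.

Let h1_ge0 u : 0 <= h1 u. Proof. exact: le_trans (l2norm_ge0 u) (l2h1 u). Qed.

Section one_space.
Variables (X : set (L2 mu)) (hX : fin_dim_subspace X) (XH : X `<=` H).
Variable A : L2 mu -> L2 mu.
Hypothesis AP : forall u, X u -> X (A u) /\ forall v, X v -> l2dot (A u) v = - B u v.
Variable E : R -> L2 mu -> L2 mu.
Hypothesis EP : forall t f, X f ->
  l2norm (\sum_(l < n) (t ^+ l / l`!%:R) *: iter l A f - E t f) @[n --> \oo] --> 0.

Let XV : X `<=` V. Proof. by move=> u /XH /HV. Qed.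

Let Bl' k u u' v : X u -> X u' -> X v -> B (k *: u + u') v = k * B u v + B u' v.
Proof. by move=> /XV Vu /XV Vu' _; exact: Bl. Qed.

Let EX t f : X f -> X (E t f).
Proof. by move=> Xf; exact: (exp_op_in hX AP EP). Qed.

Let AX f : X f -> X (A f). Proof. by move=> Xf; have [] := AP Xf. Qed.

(* [E t f] compared with the affine path through [psi0] at [t0] and [psi1] at
   [t0 + h]. *)
Let aff t0 h psi0 psi1 t := psi0 + ((t - t0) / h) *: (psi1 - psi0).

Lemma galerkin_derive_sqr f t0 h psi0 psi1 t : X f -> X psi0 -> X psi1 ->
  is_derive t 1 (fun s => l2norm (E s f - aff t0 h psi0 psi1 s) ^+ 2)
    (2 * l2dot (E t (A f) - h^-1 *: (psi1 - psi0)) (E t f - aff t0 h psi0 psi1 t)).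
Proof.
move=> Xf X0 X1; have X10 := fin_dimB hX X1 X0.
apply: (@is_derive_sqr_path _ _ _ _ _ hX (fun s => E s f - aff t0 h psi0 psi1 s)
  (fun t => E t (A f) - h^-1 *: (psi1 - psi0))).
- move=> s; apply: (fin_dimB hX); first exact: EX.
  by apply: (fin_dimD hX) => //; exact: (fin_dimZ hX).
- by apply: (fin_dimB hX); [apply: EX; exact: AX|exact: (fin_dimZ hX)].
- move=> g.
  have -> : (fun s => l2dot (E s f - aff t0 h psi0 psi1 s) g) =
      (fun s => l2dot (E s f) g - (l2dot psi0 g + ((s - t0) / h) * l2dot (psi1 - psi0) g)).
    by apply/funext => s; rewrite /aff l2dotBl [l2dot (_ + _ *: _) _]l2dotDl l2dotZl.
  have -> : l2dot (E t (A f) - h^-1 *: (psi1 - psi0)) g =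
      l2dot (E t (A f)) g - h^-1 * l2dot (psi1 - psi0) g.
    by rewrite l2dotBl l2dotZl.
  have d1 := exp_op_derive AP EP t g Xf.
  have d0 : is_derive t 1 (fun s => s - t0) 1.
    by have := is_deriveB (is_derive_id t (1 : R)) (is_derive_cst t0 t 1); rewrite subr0.
  have d2 := is_deriveD (is_derive_cst (l2dot psi0 g) t 1)
    (is_deriveZ (h^-1 * l2dot (psi1 - psi0) g) d0).
  have d3 := is_deriveB d1 d2.
  have d4 : is_derive t 1 (fun s => l2dot (E s f) g -
      (l2dot psi0 g + (h^-1 * l2dot (psi1 - psi0) g) * (s - t0)))
      (l2dot (E t (A f)) g - h^-1 * l2dot (psi1 - psi0) g).
    refine (@is_derive_eq _ _ _ _ t 1 _ _ d3 _).
    change (l2dot (E t (A f)) g - (0 + h^-1 * l2dot (psi1 - psi0) g * 1) =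
      l2dot (E t (A f)) g - h^-1 * l2dot (psi1 - psi0) g).
    by ring.
  suff -> : (fun s => l2dot (E s f) g - (l2dot psi0 g + (s - t0) / h * l2dot (psi1 - psi0) g)) =
    (fun s => l2dot (E s f) g -
      (l2dot psi0 g + (h^-1 * l2dot (psi1 - psi0) g) * (s - t0))) by exact: d4.
  by apply/funext => s; congr (_ - (_ + _)); ring.
Qed.

Let BB u u' v : V u -> V u' -> B (u - u') v = B u v - B u' v.
Proof.
by move=> Vu Vu'; have := Bl (-1) v Vu' Vu; rewrite scaleN1r addrC => ->; ring.
Qed.

(** The left side is the derivative of the squared error. Each [psi] is exchanged for [phi] at the
    cost of [B (phi - psi) e], and [B phi e] is the pairing with [- w]. What remains are [- B e e],
    these costs and the residual bounded by [r]. *)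
Lemma galerkin_energy_le f t0 h psi0 psi1 phi0 phi1 w0 w1 delta r t :
  X f -> X psi0 -> X psi1 -> 0 < h -> t0 <= t -> t <= t0 + h ->
  H phi0 -> H phi1 ->
  (forall v, H v -> l2dot (- w0) v = B phi0 v) ->
  (forall v, H v -> l2dot (- w1) v = B phi1 v) ->
  h1 (phi0 - psi0) <= delta -> h1 (phi1 - psi1) <= delta ->
  (forall s, 0 <= s -> s <= 1 ->
    l2norm ((1 - s) *: w0 + s *: w1 - h^-1 *: (psi1 - psi0)) <= r) ->
  2 * l2dot (E t (A f) - h^-1 *: (psi1 - psi0)) (E t f - aff t0 h psi0 psi1 t) <=
  (2 * kappa + 1) * l2norm (E t f - aff t0 h psi0 psi1 t) ^+ 2 +
  (CB ^+ 2 * delta ^+ 2 / (2 * kappa0) + r ^+ 2).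
Proof.
move=> Xf X0 X1 h0 t0t tt0 H0 H1 form0 form1 d0 d1 rP.
pose s := (t - t0) / h; have s0 : 0 <= s by rewrite divr_ge0 ?subr_ge0// ltW.
have s1 : s <= 1 by rewrite ler_pdivrMr// mul1r; lra.
have affE : l2eq (aff t0 h psi0 psi1 t) ((1 - s) *: psi0 + s *: psi1).
  by move=> g; rewrite /aff -/s !(l2dotDl, l2dotNl, l2dotZl); ring.
set e := E t f - aff t0 h psi0 psi1 t.
have Xaff : X ((1 - s) *: psi0 + s *: psi1).
  by apply: (fin_dim_linear hX) => //; exact: (fin_dimZ hX).
have Xe : X e.
  apply: (fin_dimB hX); first exact: EX.
  exact: (fin_dim_ext hX (l2eq_sym affE) Xaff).
have He := XH Xe; have Ve := XV Xe.
have EAf : l2dot (E t (A f)) e = - B e e - (1 - s) * B psi0 e - s * B psi1 e.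
  rewrite (exp_op_galerkin hX Bl' Bx AP EP t Xf) (AP (EX t Xf)).2//.
  have -> : B (E t f) e = B (1 *: e + ((1 - s) *: psi0 + s *: psi1)) e.
    apply: Bx (l2eq_refl _) => g.
    by rewrite /e scale1r [RHS]l2dotDl -affE l2dotBl; ring.
  rewrite (Bl 1 e Ve (XV Xaff)) (Bl (1 - s) e (XV X0) (XV (fin_dimZ hX s X1))).
  have -> : B (s *: psi1) e = s * B psi1 e.
    have := Bl s e (XV X1) (XV (fin_dim0 hX)); rewrite addr0.
    have -> : B 0 e = 0.
      by have := BB e (XV X0) (XV X0); rewrite subrr => ->; rewrite subrr.
    by rewrite addr0.
  by ring.
have B0 : B psi0 e = l2dot (- w0) e - B (phi0 - psi0) e.
  by rewrite (BB e (HV H0) (XV X0)) (form0 _ He); ring.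
have B1 : B psi1 e = l2dot (- w1) e - B (phi1 - psi1) e.
  by rewrite (BB e (HV H1) (XV X1)) (form1 _ He); ring.
have -> : l2dot (E t (A f) - h^-1 *: (psi1 - psi0)) e =
   - B e e + (1 - s) * B (phi0 - psi0) e + s * B (phi1 - psi1) e +
   l2dot ((1 - s) *: w0 + s *: w1 - h^-1 *: (psi1 - psi0)) e.
  rewrite !(l2dotDl, l2dotNl, l2dotZl) EAf B0 B1 !l2dotNl.
  by ring.
have g1 := garding He.
have delta0 : 0 <= delta by exact: le_trans (h1_ge0 _) d0.
have b0 : B (phi0 - psi0) e <= CB * delta * h1 e.
  apply: le_trans (ler_norm _) _; apply: le_trans (BC _ _) _.
  by rewrite ler_wpM2r// ler_wpM2l.
have b1 : B (phi1 - psi1) e <= CB * delta * h1 e.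
  apply: le_trans (ler_norm _) _; apply: le_trans (BC _ _) _.
  by rewrite ler_wpM2r// ler_wpM2l.
have b01 : (1 - s) * B (phi0 - psi0) e + s * B (phi1 - psi1) e <= CB * delta * h1 e.
  have -> : CB * delta * h1 e = (1 - s) * (CB * delta * h1 e) + s * (CB * delta * h1 e) by ring.
  by rewrite lerD// ler_wpM2l// subr_ge0.
have rb : l2dot ((1 - s) *: w0 + s *: w1 - h^-1 *: (psi1 - psi0)) e <= r * l2norm e.
  by apply: le_trans (l2dot_le _ _) _; rewrite ler_wpM2r ?l2norm_ge0// rP.
(* Young's inequality, weighted so that the [h1] term is exactly what Garding's inequality supplies.
   The second one, [y2], is responsible for the 1 in [2 * kappa + 1]. *)
have y1 : 2 * (CB * delta * h1 e) <= 2 * (kappa0 * h1 e ^+ 2) +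
    CB ^+ 2 * delta ^+ 2 / (2 * kappa0).
  rewrite -subr_ge0.
  have -> : 2 * (kappa0 * h1 e ^+ 2) + CB ^+ 2 * delta ^+ 2 / (2 * kappa0) -
    2 * (CB * delta * h1 e) = (2 * kappa0 * h1 e - CB * delta) ^+ 2 / (2 * kappa0).
    by field; rewrite gt_eqF.
  by rewrite divr_ge0 ?sqr_ge0// mulr_ge0// ltW.
have y2 : 2 * (r * l2norm e) <= l2norm e ^+ 2 + r ^+ 2.
  by rewrite -subr_ge0; apply: le_trans (sqr_ge0 (l2norm e - r)) _; lra.
by lra.
Qed.

(** Stability with a constant independent of the space: compare with the zero path and use that
    Garding's inequality bounds [- B] on the diagonal by [kappa] times the squared L2 norm. *)
Lemma galerkin_exp_bound f t : X f -> 0 <= t ->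
  l2norm (E t f) ^+ 2 <= expR ((2 * kappa) * t) * l2norm f ^+ 2.
Proof.
move=> Xf t0.
have X0 := fin_dim0 hX.
have aE s : aff 0 1 0 0 s = 0 by rewrite /aff subrr scaler0 addr0.
have dP s := galerkin_derive_sqr 0 1 s Xf X0 X0.
have k20 : 0 <= 2 * kappa by rewrite mulr_ge0.
have := gronwall k20 (lexx 0) dP _ (a := 0) (b := t) t0 (lexx t).
rewrite mul0r !addr0 !aE !subr0; rewrite (l2eq_norm (exp_op0 EP Xf)).
apply=> s s0 st; rewrite !aE ?subrr scaler0 ?subr0.
rewrite (exp_op_galerkin hX Bl' Bx AP EP s Xf) (AP (EX s Xf)).2; last exact: EX.
have XEs := EX s Xf; have := garding (XH XEs).
have : 0 <= kappa0 * h1 (E s f) ^+ 2 by rewrite mulr_ge0 ?sqr_ge0// ltW.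
by lra.
Qed.

(** The path is Lipschitz with constant [L], by the mean value theorem for its pairings. [L] depends
    on the space, which suffices for integrating the path for each [K] separately. *)
Lemma galerkin_exp_ucont (Tm : R) f : 0 < Tm -> X f -> ucont_path Tm (fun t => E t f).
Proof.
move=> Tm0 Xf.
have b g (Xg : X g) t : 0 <= t -> t <= Tm -> l2norm (E t g) <= expR (kappa * Tm) * l2norm g.
  move=> t0 tT; rewrite -(ler_pXn2r (n := 2)) ?nnegrE ?mulr_ge0 ?l2norm_ge0 ?expR_ge0//.
  apply: le_trans (galerkin_exp_bound Xg t0) _.
  rewrite exprMn ler_wpM2r ?sqr_ge0// -expRM_natl ler_expR.
  by rewrite -mulrA ler_wpM2l// ler_wpM2l.
split; first by exists (expR (kappa * Tm) * l2norm f) => t; exact: b.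
pose L := expR (kappa * Tm) * l2norm (A f).
have L0 : 0 <= L by rewrite mulr_ge0 ?expR_ge0 ?l2norm_ge0.
move=> e e0; exists (e / (L + 1)); first by rewrite divr_gt0// ltr_wpDl.
move=> s t s0 st tT ts.
apply: l2norm_dual => [|g]; first exact: ltW.
have dP x := exp_op_derive AP EP x g Xf.
have [|c cin Ec] := MVT_segment st (fun x _ => dP x).
  by apply: derivable_within_continuous => x _; have [] := dP x.
rewrite l2dotBl Ec; move: cin; rewrite in_itv/= => /andP[sc ct].
apply: le_trans (ler_wpM2r _ (l2dot_le _ _)) _; first by rewrite subr_ge0.
have h1' := b _ (AX Xf) c (le_trans s0 sc) (le_trans ct tT).
rewrite mulrAC ler_wpM2r ?l2norm_ge0//.
apply: le_trans (ler_wpM2r _ h1') _; first by rewrite subr_ge0.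
apply: le_trans (ler_wpM2l L0 (ltW ts)) _.
by rewrite mulrCA ler_piMr ?ltW// ltr_pdivrMr ?ltr_wpDl// mul1r ltrDl.
Qed.

Lemma galerkin_grid_le g h (psi phi w : nat -> L2 mu) delta r (N : nat) :
  X g -> 0 < h -> (forall j, X (psi j)) -> (forall j, H (phi j)) ->
  (forall j v, H v -> l2dot (- w j) v = B (phi j) v) ->
  (forall j, (j <= N)%N -> h1 (phi j - psi j) <= delta) ->
  (forall j s, (j < N)%N -> 0 <= s -> s <= 1 ->
    l2norm ((1 - s) *: w j + s *: w j.+1 - h^-1 *: (psi j.+1 - psi j)) <= r) ->
  forall j t, (j < N)%N -> j%:R * h <= t -> t <= j.+1%:R * h ->
  l2norm (E t g - aff (j%:R * h) h (psi j) (psi j.+1) t) ^+ 2 <=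
  expR ((2 * kappa + 1) * t) * (l2norm (g - psi 0) ^+ 2 +
    (CB ^+ 2 * delta ^+ 2 / (2 * kappa0) + r ^+ 2) * t).
Proof.
move=> Xg h0 Xpsi Hphi formw dP rP.
set l := 2 * kappa + 1; set eta := _ + r ^+ 2.
have l0 : 0 <= l by rewrite addr_ge0// mulr_ge0.
have eta0 : 0 <= eta.
  apply: addr_ge0; last exact: sqr_ge0.
  apply: divr_ge0; first by rewrite mulr_ge0 ?sqr_ge0.
  by rewrite mulr_ge0// ltW.
have aff0 j : aff (j%:R * h) h (psi j) (psi j.+1) (j%:R * h) = psi j.
  by rewrite /aff subrr mul0r scale0r addr0.
have aff1 j : l2eq (aff (j%:R * h) h (psi j) (psi j.+1) (j.+1%:R * h)) (psi j.+1).
  have -> : aff (j%:R * h) h (psi j) (psi j.+1) (j.+1%:R * h) =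
      psi j + 1 *: (psi j.+1 - psi j).
    congr (_ + _ *: _); rewrite -mulrBl mulfK ?gt_eqF// -natr1.
    by rewrite addrAC subrr add0r.
  by rewrite scale1r subrKC.
have step j t : (j < N)%N -> j%:R * h <= t -> t <= j.+1%:R * h ->
    l2norm (E t g - aff (j%:R * h) h (psi j) (psi j.+1) t) ^+ 2 <=
    expR (l * (t - j%:R * h)) * (l2norm (E (j%:R * h) g - psi j) ^+ 2 +
      eta * (t - j%:R * h)).
  move=> jN jt tj.
  have dqP s := galerkin_derive_sqr (j%:R * h) h s Xg (Xpsi j) (Xpsi j.+1).
  have := gronwall l0 eta0 dqP _ (a := j%:R * h) (b := j.+1%:R * h) jt tj.
  rewrite aff0; apply => s js sj.
  apply: (galerkin_energy_le Xg (Xpsi j) (Xpsi j.+1) h0 js _ (Hphi j) (Hphi j.+1)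
    (formw j) (formw j.+1) (dP _ (ltnW jN)) (dP _ jN) (rP j ^~ jN)).
  by move: sj; rewrite -natr1 mulrDl mul1r.
have e_mono x y (a b : R) : 0 <= x -> x <= y -> 0 <= a -> a <= b ->
    expR (l * x) * a <= expR (l * y) * b.
  move=> x0 xy a0 ab; apply: ler_pM; rewrite ?expR_ge0// ler_expR ler_wpM2l//.
have Q j : (j <= N)%N -> l2norm (E (j%:R * h) g - psi j) ^+ 2 <=
    expR (l * (j%:R * h)) * (l2norm (g - psi 0) ^+ 2 + eta * (j%:R * h)).
  elim: j => [|j IH] jN.
    rewrite mul0r !mulr0 expR0 mul1r addr0.
    by rewrite (l2eq_norm (l2eqB (exp_op0 EP Xg) (l2eq_refl _))).
  have jj : j%:R * h <= j.+1%:R * h.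
    by apply: ler_wpM2r; [exact: ltW|rewrite ler_nat].
  have := step j _ jN jj (lexx _).
  rewrite (l2eq_norm (l2eqB (l2eq_refl _) (aff1 j))) => H2; apply: le_trans H2 _.
  have {}IH := IH (ltnW jN).
  have jh0 : 0 <= j%:R * h by rewrite mulr_ge0// ltW.
  set c := j.+1%:R * h - j%:R * h in jj *.
  have c0 : 0 <= c by rewrite subr_ge0.
  have cE : j.+1%:R * h = j%:R * h + c by rewrite /c subrKC.
  rewrite cE (_ : l * (j%:R * h + c) = l * c + l * (j%:R * h)); last by ring.
  rewrite expRD -mulrA ler_wpM2l ?expR_ge0//.
  (* The new source term is enlarged by the accumulated growth factor, so that it joins the earlier
     ones and the exponents add up. *)
  have ec : eta * c <= expR (l * (j%:R * h)) * (eta * c).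
    by apply: ler_peMl; [exact: mulr_ge0|rewrite -[leLHS]expR0 ler_expR mulr_ge0].
  by apply: le_trans (lerD IH ec) _; rewrite le_eqVlt; apply/orP; left; apply/eqP; ring.
move=> j t jN jt tj; apply: le_trans (step j t jN jt tj) _.
have {}Q := Q j (ltnW jN).
set c := t - j%:R * h; have c0 : 0 <= c by rewrite subr_ge0.
have jh0 : 0 <= j%:R * h by rewrite mulr_ge0// ltW.
have -> : t = j%:R * h + c by rewrite /c subrKC.
rewrite (_ : l * (j%:R * h + c) = l * c + l * (j%:R * h)); last by ring.
rewrite expRD -mulrA ler_wpM2l ?expR_ge0//.
have ec : eta * c <= expR (l * (j%:R * h)) * (eta * c).
  by apply: ler_peMl; [exact: mulr_ge0|rewrite -[leLHS]expR0 ler_expR mulr_ge0].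
by apply: le_trans (lerD Q ec) _; rewrite le_eqVlt; apply/orP; left; apply/eqP; ring.
Qed.

End one_space.

(** * Strong convergence, uniform on bounded time intervals *)

Section convergence.
Variables (S : R -> L2 mu -> L2 mu) (HS : C0_semigroup S).
Hypothesis gen : forall phi w, generator S phi w ->
  H phi /\ forall v, H v -> l2dot (- w) v = B phi v.
Variables (X : nat -> set (L2 mu)).
Hypothesis hX : forall K, fin_dim_subspace (X K).
Hypothesis XH : forall K, X K `<=` H.
Hypothesis approx : forall phi, H phi -> exists psi : nat -> L2 mu,
  (forall K, X K (psi K)) /\ h1 (phi - psi K) @[K --> \oo] --> 0.
Variables (A P : nat -> L2 mu -> L2 mu) (E : nat -> R -> L2 mu -> L2 mu).
Hypothesis AP : forall K u, X K u ->
  X K (A K u) /\ forall v, X K v -> l2dot (A K u) v = - B u v.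
Hypothesis EP : forall K t f, X K f ->
  l2norm (\sum_(l < n) (t ^+ l / l`!%:R) *: iter l (A K) f - E K t f)
    @[n --> \oo] --> 0.
Hypothesis PP : forall K f, X K (P K f) /\
  forall g, X K g -> l2dot (f - P K f) g = 0.
Variables (Tm : R) (Tm0 : 0 < Tm).

Lemma grid_approx (phi : nat -> L2 mu) (N : nat) : (forall j, H (phi j)) ->
  exists psi : nat -> nat -> L2 mu, (forall j K, X K (psi j K)) /\
    forall delta, 0 < delta -> exists K0, forall K, (K0 <= K)%N ->
      forall j, (j <= N)%N -> h1 (phi j - psi j K) <= delta.
Proof.
move=> Hphi; have [psi psiP] := choice (fun j => approx (Hphi j)).
exists psi; split=> [j K|delta d0]; first exact: (psiP j).1.
have /choice[K KP] j : exists K0, forall K, (K0 <= K)%N -> h1 (phi j - psi j K) <= delta.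
  exact: ((cvg0_seqP (fun n => h1_ge0 _)).1 (psiP j).2 delta d0).
exists (\max_(j < N.+1) K j)%N => k Kk j jN; apply: KP.
by apply: leq_trans Kk; rewrite (leq_bigmax (Ordinal (jN : (j < N.+1)%N))).
Qed.

Lemma grid_cell (N : nat) t : (0 < N)%N -> 0 <= t -> t <= Tm ->
  exists j, [/\ (j < N)%N, j%:R * (Tm / N%:R) <= t & t <= j.+1%:R * (Tm / N%:R)].
Proof.
move=> N0 t0 tT; have h0 : 0 < Tm / N%:R by rewrite divr_gt0// ltr0n.
have NT : N%:R * (Tm / N%:R) = Tm.
  by rewrite mulrC divfK// pnatr_eq0 -lt0n.
have := tT; rewrite le_eqVlt => /predU1P[->|tT'].
  (* At [t = Tm] the truncation below would return [N], so the last closed cell is taken by hand. *)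
  exists N.-1; rewrite prednK//; split => //; last by rewrite NT.
  by rewrite -[leRHS]NT; apply: ler_wpM2r; [exact: ltW|rewrite ler_nat leq_pred].
have th : 0 <= t / (Tm / N%:R) by rewrite divr_ge0// ltW.
exists (Num.truncn (t / (Tm / N%:R))).
have /andP[k1 k2] := truncn_itv th; split.
- by rewrite truncn_lt_nat// ltr_pdivrMr// NT.
- by rewrite -ler_pdivlMr.
- by rewrite -ler_pdivrMr// ltW.
Qed.

Lemma galerkin_cvg_dom f w (eps : R) : generator S f w -> 0 < eps ->
  exists K0, forall K, (K0 <= K)%N -> forall t, 0 <= t -> t <= Tm ->
    l2norm (E K t (P K f) - S t f) <= eps.
Proof.
move=> genf eps0.
pose l := 2 * kappa + 1; have l0 : 0 <= l by rewrite addr_ge0// mulr_ge0.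
pose c := CB ^+ 2 / (2 * kappa0) + 1.
have c0 : 0 <= c.
  by rewrite addr_ge0// divr_ge0 ?sqr_ge0// mulr_ge0// ltW.
(* [D * th ^+ 2] bounds the squared distance to the path once the initial error, [delta] and the
   residual are at most [th]. With [th = eps / 4 / D] it equals [(eps / 4) * th], and [1 <= D] makes
   this at most the square of [eps / 4]. *)
pose D := expR (l * Tm) * (1 + c * Tm).
have D1 : 1 <= D.
  rewrite -[leLHS]mulr1; apply: ler_pM => //.
    by rewrite -[leLHS]expR0 ler_expR mulr_ge0// ltW.
  by rewrite lerDl mulr_ge0// ltW.
have D0 : 0 < D by exact: lt_le_trans ltr01 D1.
pose th := eps / 4 / D.
have th0 : 0 < th by rewrite !divr_gt0.
have th4 : th <= eps / 4.
  by rewrite /th ler_pdivrMr// ler_peMr// ltW// divr_gt0.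
have [M M1 bM] := C0_bound_on HS Tm.
have M0 : 0 < M by exact: lt_le_trans ltr01 M1.
(* The factor [M] is lost when a difference over a cell is pulled back to time 0 by
   [S (j%:R * h)]. *)
have tM : 0 < th / 4 / M by rewrite !divr_gt0.
have [a1 a10 a1P] := (cvg0_rightP _).1 genf _ tM.
have [a2 a20 a2P] := C0_cont0 HS w tM.
have [|a3 a30 a3P] := C0_unif_cont HS Tm f (e := eps / 4); first by rewrite divr_gt0.
have [N [N0 Na]] : exists N : nat, (0 < N)%N /\
    Tm / N%:R < Num.min a1 (Num.min a2 a3).
  set a := Num.min _ _; have a0 : 0 < a by rewrite !lt_min a10 a20.
  exists (Num.bound (Tm / a)).+1; split => //.
  rewrite ltr_pdivrMr ?ltr0n// mulrC -ltr_pdivrMr//.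
  apply: lt_trans (archi_boundP _) _; first by rewrite divr_ge0 ?ltW.
  by rewrite ltr_nat.
move: Na; set h := Tm / N%:R; rewrite !lt_min => /and3P[ha1 ha2 ha3].
have h0 : 0 < h by rewrite divr_gt0// ltr0n.
have NT : N%:R * h = Tm by rewrite mulrC divfK// pnatr_eq0 -lt0n.
have jT (j : nat) : (j <= N)%N -> j%:R * h <= Tm.
  by move=> jN; rewrite -NT; apply: ler_wpM2r; [exact: ltW|rewrite ler_nat].
have j0 (j : nat) : 0 <= j%:R * h by rewrite mulr_ge0// ltW.
pose phi (j : nat) := S (j%:R * h) f; pose ww (j : nat) := S (j%:R * h) w.
have gj j : generator S (phi j) (ww j) by exact: C0_generator_invariant.
have Hphi j : H (phi j) by exact: (gen (gj j)).1.
have formw j v : H v -> l2dot (- ww j) v = B (phi j) v by exact: (gen (gj j)).2.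
(* The second bound is there because the residual divides the approximation errors by [h]. *)
pose delta := Num.min th (th * h / 4).
have d0 : 0 < delta by rewrite lt_min th0 divr_gt0// mulr_gt0.
have dth : delta <= th by rewrite ge_min lexx.
have dth4 : delta <= th * h / 4 by rewrite ge_min lexx orbT.
have [psi [Xpsi psiP]] := grid_approx N Hphi.
have [K0 K0P] := psiP _ d0; exists K0 => K /K0P dP t t0 tT.
have shift (j : nat) g : l2eq (S (j.+1%:R * h) g) (S (j%:R * h) (S h g)).
  have -> : j.+1%:R * h = j%:R * h + h by rewrite -natr1 mulrDl mul1r.
  by apply: C0_add => //; exact: ltW.
(* Four contributions of at most [th / 4]: the variation of [ww] over the cell, the difference
   quotient against the generator, and the approximation errors at the two ends. *)
have rP j s : (j < N)%N -> 0 <= s -> s <= 1 ->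
    l2norm ((1 - s) *: ww j + s *: ww j.+1 - h^-1 *: (psi j.+1 K - psi j K)) <= th.
  move=> jN s0 s1; have lS := C0_linear HS (j0 j).
  have jNT := jT j (ltnW jN).
  have b1 : l2norm (ww j.+1 - ww j) <= th / 4.
    have -> : l2norm (ww j.+1 - ww j) = l2norm (S (j%:R * h) (S h w - w)).
      apply: l2eq_norm => k.
      by rewrite (l2linearB _ _ lS) !l2dotBl (shift j w).
    apply: le_trans (bM _ (j0 j) jNT _) _.
    by rewrite mulrC -ler_pdivlMr// a2P// ltW.
  have b2 : l2norm (h^-1 *: (phi j.+1 - phi j) - ww j) <= th / 4.
    have -> : l2norm (h^-1 *: (phi j.+1 - phi j) - ww j) =
        l2norm (S (j%:R * h) (h^-1 *: (S h f - f) - w)).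
      apply: l2eq_norm => k.
      rewrite (l2linearB _ _ lS) !l2dotBl (l2linearZ _ _ lS) !l2dotZl.
      by rewrite (l2linearB _ _ lS) !l2dotBl (shift j f).
    apply: le_trans (bM _ (j0 j) jNT _) _.
    rewrite mulrC -ler_pdivlMr//.
    by have := a1P h h0 ha1; rewrite ger0_norm ?l2norm_ge0.
  have b3 i : (i <= N)%N -> l2norm (h^-1 *: (phi i - psi i K)) <= th / 4.
    move=> iN; rewrite l2normZ gtr0_norm ?invr_gt0//.
    rewrite ler_pdivrMl//; apply: le_trans (l2h1 _) _; apply: le_trans (dP i iN) _.
    by apply: le_trans dth4 _; rewrite le_eqVlt; apply/orP; left; apply/eqP; ring.
  have -> : l2norm ((1 - s) *: ww j + s *: ww j.+1 - h^-1 *: (psi j.+1 K - psi j K)) =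
      l2norm ((s *: (ww j.+1 - ww j) - (h^-1 *: (phi j.+1 - phi j) - ww j)) +
        (h^-1 *: (phi j.+1 - psi j.+1 K) - h^-1 *: (phi j - psi j K))).
    apply: l2eq_norm => k.
    by rewrite !(l2dotDl, l2dotNl, l2dotZl); ring.
  apply: le_trans (l2normD _ _) _.
  have := l2normB (s *: (ww j.+1 - ww j)) (h^-1 *: (phi j.+1 - phi j) - ww j).
  have := l2normB (h^-1 *: (phi j.+1 - psi j.+1 K)) (h^-1 *: (phi j - psi j K)).
  have := b3 _ jN; have := b3 _ (ltnW jN).
  have : l2norm (s *: (ww j.+1 - ww j)) <= l2norm (ww j.+1 - ww j).
    by rewrite l2normZ ger0_norm// ler_piMl ?l2norm_ge0.
  by lra.
have XP := (PP K f).1.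
have [j [jN jt tj]] := grid_cell N0 t0 tT.
have := galerkin_grid_le (hX K) (@XH K) (@AP K) (@EP K) XP h0 (Xpsi ^~ K) Hphi formw
  dP rP jN jt tj.
rewrite /=; set s := (t - j%:R * h) / h; set v := _ + _ *: _ => Ev.
have s0 : 0 <= s by rewrite divr_ge0 ?subr_ge0// ltW.
have s1 : s <= 1.
  by rewrite ler_pdivrMr// mul1r; move: tj; rewrite -natr1 mulrDl mul1r -/h; lra.
have P0 : l2norm (P K f - psi 0 K) <= th.
  have PK := orth_proj_linear (hX K) (PP K).
  have -> : l2norm (P K f - psi 0 K) = l2norm (P K (f - psi 0 K)).
    apply: l2eq_norm => k; rewrite (l2linearB _ _ PK) !l2dotBl.
    by rewrite (orth_proj_id (hX K) (PP K) (Xpsi 0 K)).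
  apply: le_trans (orth_proj_bound (PP K) _) _; rewrite mul1r.
  have -> : l2norm (f - psi 0 K) = l2norm (phi 0 - psi 0 K).
    apply: l2eq_norm; apply: l2eqB (l2eq_refl _); rewrite /phi mul0r.
    by apply: l2eq_sym; exact: C0_0.
  by apply: le_trans (l2h1 _) _; apply: le_trans (dP 0 (leq0n _)) dth.
have Ev4 : l2norm (E K t (P K f) - v) <= eps / 4.
  rewrite -(ler_pXn2r (n := 2)) ?nnegrE ?l2norm_ge0 ?divr_ge0 ?(ltW eps0)//.
  apply: le_trans Ev _; apply: le_trans (_ : D * th ^+ 2 <= _).
    have -> : D * th ^+ 2 = expR (l * Tm) * (th ^+ 2 +
       (CB ^+ 2 * th ^+ 2 / (2 * kappa0) + th ^+ 2) * Tm).
      by rewrite /D /c; ring.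
    have k20 : 0 <= 2 * kappa0 by rewrite mulr_ge0// ltW.
    have d2 : delta ^+ 2 <= th ^+ 2 by rewrite lerXn2r// nnegrE ltW.
    apply: ler_pM; first exact: expR_ge0.
    - rewrite addr_ge0 ?sqr_ge0// mulr_ge0// addr_ge0 ?sqr_ge0// divr_ge0//.
      by rewrite mulr_ge0 ?sqr_ge0.
    - by rewrite ler_expR ler_wpM2l.
    apply: lerD; first by rewrite lerXn2r// nnegrE ?l2norm_ge0// ltW.
    apply: ler_pM => //.
      by rewrite addr_ge0 ?sqr_ge0// divr_ge0// mulr_ge0 ?sqr_ge0.
    rewrite lerD2r ler_wpM2r ?invr_ge0// ler_wpM2l ?sqr_ge0//.
  have -> : D * th ^+ 2 = (eps / 4) * th by rewrite /th; field; rewrite gt_eqF.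
  by rewrite expr2 ler_wpM2l// divr_ge0// ltW.
(* [v] is a convex combination of the two neighbouring [psi], each within [eps / 4] of its [phi],
   which in turn is within [eps / 4] of [S t f]. *)
have vS : l2norm (v - S t f) <= eps / 2.
  have -> : l2norm (v - S t f) = l2norm (
     ((1 - s) *: (phi j - S t f) + s *: (phi j.+1 - S t f)) -
     ((1 - s) *: (phi j - psi j K) + s *: (phi j.+1 - psi j.+1 K))).
    apply: l2eq_norm => k; rewrite /v.
    by rewrite !(l2dotDl, l2dotNl, l2dotZl); ring.
  have q1 : l2norm (phi j - S t f) <= eps / 4.
    rewrite l2distC a3P//; apply: le_lt_trans ha3.
    by move: tj; rewrite -natr1 mulrDl mul1r -/h; lra.
  have q2 : l2norm (phi j.+1 - S t f) <= eps / 4.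
    rewrite /phi a3P//; first exact: jT.
    apply: le_lt_trans ha3.
    by move: jt; rewrite -natr1 mulrDl mul1r -/h; lra.
  have q3 i : (i <= N)%N -> l2norm (phi i - psi i K) <= eps / 4.
    by move=> iN; apply: le_trans (l2h1 _) _; apply: le_trans (dP i iN) _; lra.
  have conv (x y : L2 mu) : l2norm x <= eps / 4 -> l2norm y <= eps / 4 ->
      l2norm ((1 - s) *: x + s *: y) <= eps / 4.
    move=> xe ye; apply: le_trans (l2normD _ _) _; rewrite !l2normZ.
    rewrite (ger0_norm s0) ger0_norm ?subr_ge0//.
    apply: (@le_trans _ _ ((1 - s) * (eps / 4) + s * (eps / 4))).
      by rewrite lerD// ler_wpM2l// subr_ge0.
    by rewrite le_eqVlt; apply/orP; left; apply/eqP; ring.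
  apply: le_trans (l2normB _ _) _.
  have := conv _ _ q1 q2; have := conv _ _ (q3 _ (ltnW jN)) (q3 _ jN); lra.
by apply: le_trans (l2dist_triangle _ v _) _; lra.
Qed.

Lemma galerkin_cvg f (eps : R) : 0 < eps ->
  exists K0, forall K, (K0 <= K)%N -> forall t, 0 <= t -> t <= Tm ->
    l2norm (E K t (P K f) - S t f) <= eps.
Proof.
move=> eps0; have [M M1 bM] := C0_bound_on HS Tm.
pose C := expR (kappa * Tm).
have C0 : 0 <= C by exact: expR_ge0.
have CM : 0 < C + M by rewrite ltr_wpDl// (lt_le_trans ltr01).
have [|p [w [genp fp]]] := C0_generator_dense HS f (e := eps / 2 / (C + M)).
  by rewrite !divr_gt0.
have [|K0 K0P] := galerkin_cvg_dom (eps := eps / 2) genp; first by rewrite divr_gt0.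
exists K0 => K /K0P EK t t0 tT; have {}EK := EK t t0 tT.
have XP g : X K (P K g) := (PP K g).1.
have XV' u : X K u -> V u by move=> /XH /HV.
have Bl' k u u' v : X K u -> X K u' -> X K v -> B (k *: u + u') v = k * B u v + B u' v.
  by move=> /XV' Vu /XV' Vu' _; exact: Bl.
have PK := orth_proj_linear (hX K) (PP K).
have EPfp : l2norm (E K t (P K (f - p))) <= C * l2norm (f - p).
  apply: (@le_trans _ _ (C * l2norm (P K (f - p)))); last first.
    by rewrite ler_wpM2l//; have := orth_proj_bound (PP K) (f - p); rewrite mul1r.
  rewrite -(ler_pXn2r (n := 2)) ?nnegrE ?mulr_ge0 ?l2norm_ge0//.
  apply: le_trans (galerkin_exp_bound (hX K) (@XH K) (@AP K) (@EP K) (XP _) t0) _.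
  rewrite exprMn ler_wpM2r ?sqr_ge0// /C -expRM_natl ler_expR.
  by rewrite -mulrA ler_wpM2l// ler_wpM2l.
have SE : l2norm (S t (f - p)) <= M * l2norm (f - p) by exact: bM.
have -> : l2norm (E K t (P K f) - S t f) = l2norm (
    (E K t (P K (f - p)) - S t (f - p)) + (E K t (P K p) - S t p)).
  apply: l2eq_norm => k; rewrite !(l2dotDl, l2dotNl).
  rewrite (l2linearB _ _ (C0_linear HS t0)) l2dotBl.
  have Pfp : l2eq (P K (f - p)) (-1 *: P K p + P K f).
    by move=> g; rewrite (l2linearB _ _ PK) scaleN1r addrC.
  rewrite (exp_op_ext (hX K) Bx (@AP K) (@EP K) t (XP _) Pfp).
  rewrite (exp_op_linear (hX K) Bl' Bx (@AP K) (@EP K) t (-1) (XP _) (XP _)).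
  by rewrite l2dotDl l2dotZl; ring.
apply: le_trans (l2normD _ _) _; apply: le_trans (lerD (l2normB _ _) (lexx _)) _.
have : (C + M) * l2norm (f - p) <= eps / 2.
  by rewrite mulrC -ler_pdivlMr.
by rewrite mulrDl; lra.
Qed.

End convergence.

End galerkin_energy.

(** * Convergence of the minimizers *)

Section control_time.
Context {R : realType} (tF : R) (tF0 : 0 < tF).
Local Notation leb := (@lebesgue_measure R).
Local Notation D := (`]0, tF[%classic : set (measurableTypeR R)).
Implicit Types (u : L2 (time_measure tF)).

Let mD : measurable D. Proof. exact: measurable_itv. Qed.

Lemma time_sqr_le u : (\int[leb]_(t in D) (u t ^+ 2)%:E <= (l2norm u ^+ 2)%:E)%E.
Proof.
rewrite l2norm_sqr_int.
rewrite [leLHS](eq_measure_integral (time_measure tF)); last first.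
  by move=> A mA AD; rewrite /time_measure/= /mrestr setIidl.
apply: ge0_subset_integral => //.
  by apply/measurable_EFinP; exact: measurable_funX.
by move=> x _; rewrite lee_fin sqr_ge0.
Qed.

(** Integrate Young's inequality for the absolute value of [u t] with weight [n + 1], which stays
    positive when the norm [n] of [u] is zero. *)
Lemma time_abs_le u :
  (\int[leb]_(t in D) `|(u t)%:E| <= ((tF + 1) * (l2norm u + 1))%:E)%E.
Proof.
set n := l2norm u; have n0 : 0 <= n := l2norm_ge0 u.
have mu_ : measurable_fun D u by exact: measurable_funTS.
have k0 : 0 <= (n + 1) / 2 by rewrite divr_ge0// addr_ge0.
have i0 : 0 <= (2 * (n + 1))^-1 by rewrite invr_ge0 mulr_ge0// addr_ge0.
apply: (@le_trans _ _ (\int[leb]_(t in D)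
    (((n + 1) / 2)%:E + (2 * (n + 1))^-1%:E * (u t ^+ 2)%:E))%E).
  apply: ge0_le_integral => //.
  - by apply: measurableT_comp => //; exact/measurable_EFinP.
  - apply: emeasurable_funD => //; apply: measurable_funeM.
    by apply/measurable_EFinP; exact: measurable_funX.
  - move=> t _; rewrite abse_EFin -EFinM -EFinD lee_fin.
    have n1 : 0 < n + 1 by rewrite ltr_wpDl.
    rewrite -[u t ^+ 2]real_normK ?num_real// -subr_ge0.
    have -> : (n + 1) / 2 + (2 * (n + 1))^-1 * `|u t| ^+ 2 - `|u t| =
      (n + 1 - `|u t|) ^+ 2 / (2 * (n + 1)) by field; rewrite gt_eqF.
    by rewrite divr_ge0 ?sqr_ge0// mulr_ge0// ltW.
rewrite ge0_integralD//; first last.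
- apply: measurable_funeM; apply/measurable_EFinP; exact: measurable_funX.
- by move=> t _; rewrite -EFinM lee_fin mulr_ge0// sqr_ge0.
rewrite ge0_integralZl//; first last.
- by move=> t _; rewrite lee_fin sqr_ge0.
- by apply/measurable_EFinP; exact: measurable_funX.
rewrite integral_cst//.
have lD : leb D = tF%:E.
  by rewrite lebesgue_measure_itv/= lte_fin tF0 -EFinD subr0.
rewrite [X in (_ * X + _ <= _)%E](_ : _ = tF%:E); last exact: lD.
apply: (@le_trans _ _ (((n + 1) / 2)%:E * tF%:E + (2 * (n + 1))^-1%:E * (n ^+ 2)%:E)%E).
  by rewrite leeD2l// lee_wpmul2l ?lee_fin// time_sqr_le.
rewrite -!EFinM -EFinD lee_fin.
have n1 : 0 < n + 1 by rewrite ltr_wpDl.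
have : (2 * (n + 1))^-1 * n ^+ 2 <= n + 1.
  rewrite mulrC ler_pdivrMr ?mulr_gt0//.
  have := sqr_ge0 (n + 1); have := sqr_ge0 n.
  by rewrite (_ : (n + 1) * (2 * (n + 1)) = n ^+ 2 + 4 * n + 2 + n ^+ 2); [lra|ring].
have : 0 <= (n + 1) * tF by rewrite mulr_ge0// ltW.
by lra.
Qed.

Lemma time_integrable u : leb.-integrable D (EFin \o u).
Proof.
apply/integrableP; split.
  by apply/measurable_EFinP; exact: measurable_funTS.
exact: le_lt_trans (time_abs_le u) (ltry _).
Qed.

End control_time.

Section control_norm.
Context {R : realType} {tF : R} {m : nat}.
Implicit Types (u v : ctrl m tF).

Lemma ctrl_normE u : ctrl_norm u ^+ 2 = \sum_i l2norm (u i) ^+ 2.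
Proof. by rewrite sqr_sqrtr// sumr_ge0// => i _; rewrite sqr_ge0. Qed.

Lemma ctrl_norm_ge0 u : 0 <= ctrl_norm u.
Proof. exact: sqrtr_ge0. Qed.

Lemma l2norm_le_ctrl_norm u i : l2norm (u i) <= ctrl_norm u.
Proof.
rewrite -(ler_pXn2r (n := 2)) ?nnegrE ?l2norm_ge0 ?ctrl_norm_ge0//.
by rewrite ctrl_normE (bigD1 i)//= lerDl sumr_ge0// => j _; rewrite sqr_ge0.
Qed.

End control_norm.

(** * Control-to-state maps and the cost *)

Section control_problem.
Context {d} {T : measurableType d} {R : realType}.
Context {mu : {measure set T -> \bar R}}.
Variables (tF : R) (tF0 : 0 < tF) (m : nat).
Local Notation leb := (@lebesgue_measure R).
Local Notation D := (`]0, tF[%classic : set (measurableTypeR R)).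
Implicit Types (u v : ctrl m tF).

Let mD : measurable D. Proof. exact: measurable_itv. Qed.

(** The weak form of a control-to-state map with kernel [y]. The comparison of minimizers uses
    nothing else about the Bochner integral. *)
Definition path_operator (y : 'I_m -> R -> L2 mu) (Theta : ctrl m tF -> L2 mu) :=
  (forall i, ucont_path tF (y i)) /\
  forall u g, l2dot (Theta u) g = \int[leb]_(t in D) \sum_i u i t * l2dot (y i t) g.

Lemma bochner_path_operator (y : 'I_m -> R -> L2 mu) (F : ctrl m tF -> R -> L2 mu) :
  (forall i, ucont_path tF (y i)) ->
  (forall u t, D t -> l2eq (F u t) (\sum_i u i t *: y i t)) ->
  path_operator y (fun u => bochner leb D (F u)).
Proof.
move=> py FE; split=> // u g.
have iu i : leb.-integrable D (EFin \o u i) by exact: time_integrable.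
exact: (bochnerP tF0 iu py (FE u) (l2functional_dot g)).
Qed.

Section operator.
Variables (y : 'I_m -> R -> L2 mu) (Theta : ctrl m tF -> L2 mu).
Hypothesis yTheta : path_operator y Theta.
Let py := yTheta.1.
Let control_dot := yTheta.2.

Let iu u i : leb.-integrable D (EFin \o u i). Proof. exact: time_integrable. Qed.

Let ig u g i : leb.-integrable D (EFin \o (fun t => u i t * l2dot (y i t) g)).
Proof.
have uc := ucont_path_functional (l2functional_dot g) (py i).
apply: (integrableMl _ (iu u i)) => //; first exact: ucont_measurable.
have [B hB] := ucont_bounded uc.
exists B; split; first by rewrite num_real.
move=> M BM t /=; rewrite in_itv/= => /andP[t0 tT].
by rewrite (le_trans _ (ltW BM))// hB// ltW.
Qed.

Lemma path_operator_integrable u g : leb.-integrable D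
  (EFin \o (fun t => \sum_i u i t * l2dot (y i t) g)).
Proof.
have -> : EFin \o (fun t => \sum_i u i t * l2dot (y i t) g) =
    (fun t => \sum_i (u i t * l2dot (y i t) g)%:E)%E.
  by apply/funext => t; rewrite /= sumEFin.
by apply: integrable_sum => // i _; exact: ig.
Qed.

Lemma control_linear k u v :
  l2eq (Theta (fun i => k *: u i + v i)) (k *: Theta u + Theta v).
Proof.
move=> g; rewrite l2dotDl l2dotZl !control_dot.
have Iu := path_operator_integrable u g; have Iv := path_operator_integrable v g.
have Iku : leb.-integrable D (EFin \o (fun t => k * (\sum_i u i t * l2dot (y i t) g))).
  exact: (integrableZl mD k Iu).
rewrite -RintegralZl// -RintegralD//.
apply: eq_Rintegral => t _; rewrite mulr_sumr -big_split/=.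
by apply: eq_bigr => i _; rewrite mulrDl mulrA.
Qed.

End operator.

Lemma control_close (y y' : 'I_m -> R -> L2 mu) (Theta Theta' : ctrl m tF -> L2 mu)
    (eps : R) u : 0 <= eps -> path_operator y Theta -> path_operator y' Theta' ->
  (forall i t, 0 <= t -> t <= tF -> l2norm (y i t - y' i t) <= eps) ->
  l2norm (Theta u - Theta' u) <= m%:R * ((tF + 1) * (ctrl_norm u + 1)) * eps.
Proof.
move=> eps0 yT yT' yy'.
have C0 : 0 <= m%:R * ((tF + 1) * (ctrl_norm u + 1)).
  by rewrite !mulr_ge0// addr_ge0 ?ctrl_norm_ge0// ltW.
apply: l2norm_dual => [|g]; first by rewrite mulr_ge0.
have iu i : leb.-integrable D (EFin \o u i) by exact: time_integrable.
have igs := path_operator_integrable yT u g.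
have igs' := path_operator_integrable yT' u g.
rewrite l2dotBl yT.2 yT'.2 -RintegralB//.
have eg0 : 0 <= eps * l2norm g by rewrite mulr_ge0 ?l2norm_ge0.
have mu_ i : measurable_fun D (u i) by have /measurable_int/measurable_EFinP := iu i.
have iB : leb.-integrable D (EFin \o (fun t => \sum_i u i t * l2dot (y i t) g -
    \sum_i u i t * l2dot (y' i t) g)).
  exact: (integrableB mD igs igs').
have /measurable_int miB := iB.
apply: le_trans (ler_norm _) _.
apply: le_trans (le_normr_Rintegral mD iB) _.
rewrite -lee_fin /Rintegral fineK; last first.
  apply: integrable_fin_num => //; exact: (integrable_abse iB).
apply: (@le_trans _ _ (\int[leb]_(t in D)
    \sum_i ((eps * l2norm g)%:E * `|(u i t)%:E|))%E).
  apply: ge0_le_integral => //.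
  - apply: measurableT_comp => //; apply: measurableT_comp => //.
    exact/measurable_EFinP.
  - apply: emeasurable_sum => i; apply: measurable_funeM.
    by apply: measurableT_comp => //; exact/measurable_EFinP.
  - move=> t /=; rewrite in_itv/= => /andP[t0 tT].
    rewrite -sumrB sumEFin lee_fin (le_trans (ler_norm_sum _ _ _))//.
    apply: ler_sum => i _; rewrite -mulrBr normrM mulrC -l2dotBl.
    rewrite ler_wpM2r// (le_trans (l2norm_cauchy _ _))//.
    by rewrite ler_wpM2r ?l2norm_ge0// yy'// ltW.
rewrite ge0_integral_sum//; first last.
- by move=> i t _; rewrite mule_ge0// lee_fin.
- move=> i; apply: measurable_funeM.
  by apply: measurableT_comp => //; exact/measurable_EFinP.
apply: (@le_trans _ _
    (\sum_(i < m) ((eps * l2norm g) * ((tF + 1) * (ctrl_norm u + 1)))%:E)%E).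
  apply: lee_sum => i _; rewrite ge0_integralZl//; last first.
    by apply: measurableT_comp => //; exact/measurable_EFinP.
  rewrite [leRHS]EFinM lee_wpmul2l// ?lee_fin//.
  apply: le_trans (time_abs_le tF0 (u i)) _; rewrite lee_fin.
  rewrite ler_wpM2l ?addr_ge0 ?(ltW tF0)// lerD2r.
  exact: l2norm_le_ctrl_norm.
rewrite sumEFin lee_fin sumr_const card_ord -mulr_natl.
by rewrite le_eqVlt; apply/orP; left; apply/eqP; ring.
Qed.

Section minimizers.
Variables (y : 'I_m -> R -> L2 mu) (Theta : ctrl m tF -> L2 mu).
Variables (yK : nat -> 'I_m -> R -> L2 mu) (ThetaK : nat -> ctrl m tF -> L2 mu).
Hypothesis yTheta : path_operator y Theta.
Hypothesis yThetaK : forall K, path_operator (yK K) (ThetaK K).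
Hypothesis yK_cvg : forall eps, 0 < eps -> exists K0, forall K, (K0 <= K)%N ->
  forall i t, 0 <= t -> t <= tF -> l2norm (yK K i t - y i t) <= eps.
Variables (theta : L2 mu) (rho : R) (rho0 : 0 < rho).
Let J (G : ctrl m tF -> L2 mu) u := l2norm (G u - theta) ^+ 2 + rho * ctrl_norm u ^+ 2.

(** Strong convexity at the midpoint: by the parallelogram identity the cost there is at most the
    mean of the two costs minus [rho / 4] times the squared distance, and it is at least the
    minimum. *)
Lemma minimizer_gap u v : is_minimizer (J Theta) u ->
  rho * ctrl_norm (fun i => v i - u i) ^+ 2 <= 2 * (J Theta v - J Theta u).
Proof.
move=> uP.
pose w : ctrl m tF := fun i => 2^-1 *: (v i - u i) + u i.
have := uP w; rewrite /J.
have wE : l2eq (Theta w) (2^-1 *: (Theta v - Theta u) + Theta u).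
  move=> g; have := control_linear yTheta 2^-1 (fun i => v i - u i) u g.
  rewrite /w => ->; rewrite !l2dotDl !l2dotZl; congr (_ * _ + _).
  have := control_linear yTheta (-1) u v g.
  have -> : (fun i => -1 *: u i + v i) = (fun i => v i - u i).
    by apply/funext => i; rewrite scaleN1r addrC.
  by move=> ->; rewrite !(l2dotDl, l2dotZl, l2dotNl); ring.
have par (x z : L2 mu) : l2norm (2^-1 *: (x - z) + z) ^+ 2 =
    2^-1 * l2norm x ^+ 2 + 2^-1 * l2norm z ^+ 2 - 4^-1 * l2norm (x - z) ^+ 2.
  rewrite -!l2dotff !(l2dotDl, l2dotZl, l2dotNl, l2dotDr, l2dotZr, l2dotNr).
  by rewrite (l2dotC z x); field.
have parT : l2norm (Theta w - theta) ^+ 2 <=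
    2^-1 * l2norm (Theta v - theta) ^+ 2 + 2^-1 * l2norm (Theta u - theta) ^+ 2.
  have -> : l2norm (Theta w - theta) =
      l2norm (2^-1 *: ((Theta v - theta) - (Theta u - theta)) + (Theta u - theta)).
    apply: l2eq_norm => g; rewrite !(l2dotDl, l2dotNl) wE.
    by rewrite !(l2dotDl, l2dotNl, l2dotZl); ring.
  rewrite par gerBl; apply: mulr_ge0 => //; exact: sqr_ge0.
have parc : ctrl_norm w ^+ 2 = 2^-1 * ctrl_norm v ^+ 2 + 2^-1 * ctrl_norm u ^+ 2 -
    4^-1 * ctrl_norm (fun i => v i - u i) ^+ 2.
  rewrite !ctrl_normE !mulr_sumr -big_split -sumrB /=; apply: eq_bigr => i _.
  have par' (x z : L2 (time_measure tF)) : l2norm (2^-1 *: (x - z) + z) ^+ 2 =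
      2^-1 * l2norm x ^+ 2 + 2^-1 * l2norm z ^+ 2 - 4^-1 * l2norm (x - z) ^+ 2.
    rewrite -!l2dotff !(l2dotDl, l2dotZl, l2dotNl, l2dotDr, l2dotZr, l2dotNr).
    by rewrite (l2dotC z x); field.
  exact: par'.
by rewrite parc; lra.
Qed.

Lemma minimizers_cvg (uo : ctrl m tF) (uK : nat -> ctrl m tF) :
  is_minimizer (J Theta) uo -> (forall K, is_minimizer (J (ThetaK K)) (uK K)) ->
  ctrl_norm (fun i => uK K i - uo i) @[K --> \oo] --> 0.
Proof.
move=> uoP uKP; apply/cvg0_seqP => [K|e e0]; first exact: ctrl_norm_ge0.
have Theta0 G z : path_operator z G -> l2eq (G (fun=> 0)) 0.
  move=> zG g; rewrite zG.2 l2dot0l -[RHS](mul0r (fine (leb D))) -Rintegral_cst//.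
  by apply: eq_Rintegral => t _; rewrite big1// => i _; rewrite mul0r.
(* Comparison with the zero control. It bounds both [uK K] and its final state uniformly in [K]. *)
have JK0 K : J (ThetaK K) (uK K) <= l2norm theta ^+ 2.
  apply: le_trans (uKP K (fun=> 0)) _; rewrite /J ctrl_normE big1 => [|i _]; last first.
    by rewrite l2norm0 expr0n.
  rewrite mulr0 addr0 (l2eq_norm (l2eqB (Theta0 _ _ (yThetaK K)) (l2eq_refl theta))).
  by rewrite sub0r l2normN.
set n := l2norm theta in JK0; have n0 : 0 <= n := l2norm_ge0 theta.
have uKb K : ctrl_norm (uK K) <= n / Num.sqrt rho.
  rewrite ler_pdivlMr ?sqrtr_gt0//.
  rewrite -(ler_pXn2r (n := 2)) ?nnegrE ?mulr_ge0 ?ctrl_norm_ge0 ?sqrtr_ge0//.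
  rewrite exprMn [Num.sqrt rho ^+ 2]sqr_sqrtr ?(ltW rho0)// mulrC.
  by apply: le_trans (JK0 K); rewrite /J lerDr sqr_ge0.
have TKb K : l2norm (ThetaK K (uK K) - theta) <= n.
  rewrite -(ler_pXn2r (n := 2)) ?nnegrE ?l2norm_ge0//.
  apply: le_trans (JK0 K); rewrite /J lerDl mulr_ge0 ?sqr_ge0//; exact: ltW.
pose U := n / Num.sqrt rho + ctrl_norm uo + 1.
have U1 : 1 <= U.
  by rewrite lerDr addr_ge0 ?ctrl_norm_ge0// divr_ge0 ?sqrtr_ge0.
pose q := m%:R * ((tF + 1) * U); have q0 : 0 <= q.
  apply: mulr_ge0 => //; apply: mulr_ge0; first by rewrite addr_ge0 ?(ltW tF0).
  exact: le_trans U1.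
pose W := n + l2norm (Theta uo - theta) + 1.
have W0 : 0 < W by rewrite ltr_wpDl// addr_ge0// l2norm_ge0.
have cmp (x z : L2 mu) (a : R) : 0 <= a -> a <= 1 -> l2norm (x - z) <= a ->
    l2norm (x - theta) ^+ 2 <= l2norm (z - theta) ^+ 2 +
      a * (2 * l2norm (z - theta) + 1).
  move=> a0 a1 xz; have tri := l2dist_triangle x z theta.
  have z0 := l2norm_ge0 (z - theta).
  apply: (@le_trans _ _ ((a + l2norm (z - theta)) ^+ 2)).
    rewrite lerXn2r ?nnegrE ?l2norm_ge0 ?addr_ge0//.
    by apply: le_trans tri _; rewrite lerD2r.
  have : a * a <= a by rewrite ler_piMl.
  by rewrite sqrrD expr2 (mulrDr a) mulr1; lra.
(* Passing from [Theta] to [ThetaK K] at [uK K] and back at [uo] costs at most [2 * a * W] in total.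
   By [minimizer_gap] the squared distance times [rho] is then at most [4 * a * W]. *)
pose a := Num.min 1 (rho * e ^+ 2 / (8 * W)).
have a0 : 0 < a by rewrite lt_min ltr01 divr_gt0 ?mulr_gt0// exprn_gt0.
have a1 : a <= 1 by rewrite ge_min lexx.
have aW : a * (8 * W) <= rho * e ^+ 2.
  by rewrite -ler_pdivlMr ?mulr_gt0// ge_min lexx orbT.
have [|K0 K0P] := yK_cvg (eps := a / (q + 1)); first by rewrite divr_gt0// ltr_wpDl.
exists K0 => K /K0P KP.
have eps0 : 0 <= a / (q + 1) by rewrite divr_ge0 ?(ltW a0)// addr_ge0.
have close u : ctrl_norm u <= n / Num.sqrt rho + ctrl_norm uo ->
    l2norm (ThetaK K u - Theta u) <= a.
  move=> ub; apply: le_trans (control_close u eps0 (yThetaK K) yTheta KP) _.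
  apply: (@le_trans _ _ (q * (a / (q + 1)))).
    rewrite ler_wpM2r// ler_wpM2l// ler_wpM2l ?addr_ge0 ?(ltW tF0)//.
    by rewrite lerD2r.
  rewrite mulrCA ler_piMr ?(ltW a0)// ler_pdivrMr ?ltr_wpDl// mul1r.
  by rewrite lerDl.
have cK : l2norm (Theta (uK K) - ThetaK K (uK K)) <= a.
  by rewrite l2distC close// (le_trans (uKb K))// lerDl ctrl_norm_ge0.
have co : l2norm (ThetaK K uo - Theta uo) <= a.
  by rewrite close// lerDr divr_ge0 ?sqrtr_ge0.
have hK := cmp _ _ _ (ltW a0) a1 cK; have ho := cmp _ _ _ (ltW a0) a1 co.
have gap := minimizer_gap (uK K) uoP.
have min := uKP K uo; rewrite /J in gap min.
have hK' : a * (2 * l2norm (ThetaK K (uK K) - theta) + 1) <= a * (2 * n + 1).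
  by apply: ler_wpM2l; [exact: ltW|rewrite lerD2r ler_wpM2l].
rewrite -(ler_pXn2r (n := 2)) ?nnegrE ?ctrl_norm_ge0 ?(ltW e0)//.
rewrite -(ler_pM2l rho0); apply: le_trans aW; apply: le_trans gap _.
move: hK ho min hK'; rewrite /W.
set A1 := l2norm (Theta (uK K) - theta) ^+ 2.
set A2 := l2norm (ThetaK K (uK K) - theta) ^+ 2.
set A3 := l2norm (ThetaK K uo - theta) ^+ 2.
set A4 := l2norm (Theta uo - theta).
rewrite !(mulrDr a) !mulr1; have := l2norm_ge0 (Theta uo - theta); rewrite -/A4.
have an : 0 <= a * n by rewrite mulr_ge0// ltW.
have aA : 0 <= a * A4 by rewrite mulr_ge0 ?l2norm_ge0// ltW.
by lra.
Qed.

End minimizers.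
End control_problem.

Section control_paths.
Context {d} {T : measurableType d} {R : realType}.
Context {mu : {measure set T -> \bar R}}.

Lemma ucont_path_rev (Tm : R) (y : R -> L2 mu) :
  ucont_path Tm y -> ucont_path Tm (fun t => y (Tm - t)).
Proof.
move=> [[Y yY] yu]; split.
  by exists Y => t t0 tT; apply: yY; lra.
move=> e e0; have [a a0 ya] := yu e e0; exists a => // s t s0 st tT sta.
by rewrite l2distC; apply: ya; lra.
Qed.

Lemma l2linear_comb (L : L2 mu -> L2 mu) n (k : 'I_n -> R) (f : 'I_n -> L2 mu) :
  l2linear L -> l2eq (L (\sum_i k i *: f i)) (\sum_i k i *: L (f i)).
Proof.
move=> Ll h; rewrite (l2linear_sum _ _ _ Ll) !l2dot_suml.
by apply: eq_bigr => i _; rewrite l2linearZ.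
Qed.

Lemma exp_proj_linear (X : set (L2 mu)) (hX : fin_dim_subspace X)
    (A P : L2 mu -> L2 mu) (E : R -> L2 mu -> L2 mu) (B : L2 mu -> L2 mu -> R) :
  (forall k u u' v, X u -> X u' -> X v -> B (k *: u + u') v = k * B u v + B u' v) ->
  (forall u u' v v', l2eq u u' -> l2eq v v' -> B u v = B u' v') ->
  (forall u, X u -> X (A u) /\ forall v, X v -> l2dot (A u) v = - B u v) ->
  (forall t f, X f -> l2norm (\sum_(l < n) (t ^+ l / l`!%:R) *: iter l A f - E t f)
     @[n --> \oo] --> 0) ->
  (forall f, X (P f) /\ forall g, X g -> l2dot (f - P f) g = 0) ->
  forall t, l2linear (E t \o P).
Proof.
move=> Bl Bx AP EP PP t k f g h /=.
have Pl := orth_proj_linear hX PP k f g.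
rewrite (exp_op_ext hX Bx AP EP t (PP _).1 Pl).
exact: (exp_op_linear hX Bl Bx AP EP t k (PP f).1 (PP g).1).
Qed.

End control_paths.

(** * From semigroups to minimizers *)

Section galerkin_control.
Context {d} {T : measurableType d} {R : realType}.
Context {mu : {measure set T -> \bar R}}.
Local Notation leb := (@lebesgue_measure R).
Variables (V H : set (L2 mu)) (h1 : L2 mu -> R) (B : L2 mu -> L2 mu -> R).
Variables (CB kappa kappa0 : R).
Hypothesis HV : H `<=` V.
Hypothesis Bl : forall k u u' v, V u -> V u' -> B (k *: u + u') v = k * B u v + B u' v.
Hypothesis Bx : forall u u' v v', l2eq u u' -> l2eq v v' -> B u v = B u' v'.
Hypothesis l2h1 : forall u, l2norm u <= h1 u.
Hypothesis CB0 : 0 <= CB.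
Hypothesis BC : forall u v, `|B u v| <= CB * h1 u * h1 v.
Hypothesis kappa_ge0 : 0 <= kappa.
Hypothesis kappa0_gt0 : 0 < kappa0.
Hypothesis garding : forall phi, H phi ->
  kappa0 * h1 phi ^+ 2 <= B phi phi + kappa * l2norm phi ^+ 2.
Variables (S : R -> L2 mu -> L2 mu) (HS : C0_semigroup S).
Hypothesis gen : forall phi w, generator S phi w ->
  H phi /\ forall v, H v -> l2dot (- w) v = B phi v.
Variables (X : nat -> set (L2 mu)).
Hypothesis hX : forall K, fin_dim_subspace (X K).
Hypothesis XH : forall K, X K `<=` H.
Hypothesis approx : forall phi, H phi -> exists psi : nat -> L2 mu,
  (forall K, X K (psi K)) /\ h1 (phi - psi K) @[K --> \oo] --> 0.
Variables (A P : nat -> L2 mu -> L2 mu) (E : nat -> R -> L2 mu -> L2 mu).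
Hypothesis AP : forall K u, X K u ->
  X K (A K u) /\ forall v, X K v -> l2dot (A K u) v = - B u v.
Hypothesis EP : forall K t f, X K f ->
  l2norm (\sum_(l < n) (t ^+ l / l`!%:R) *: iter l (A K) f - E K t f)
    @[n --> \oo] --> 0.
Hypothesis PP : forall K f, X K (P K f) /\
  forall g, X K g -> l2dot (f - P K f) g = 0.
Variables (tF : R) (tF0 : 0 < tF) (m : nat) (beta : 'I_m -> L2 mu).

Let Theta (L : R -> L2 mu -> L2 mu) (u : ctrl m tF) : L2 mu :=
  bochner leb `]0, tF[%classic (fun tau => L (tF - tau) (\sum_i u i tau *: beta i)).

Lemma galerkin_minimizers_cvg (theta : L2 mu) (rho : R) (uo : ctrl m tF)
    (uK : nat -> ctrl m tF) : 0 < rho ->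
  is_minimizer (fun u => l2norm (Theta S u - theta) ^+ 2 + rho * ctrl_norm u ^+ 2) uo ->
  (forall K, is_minimizer (fun u =>
     l2norm (Theta (fun t f => E K t (P K f)) u - theta) ^+ 2 +
     rho * ctrl_norm u ^+ 2) (uK K)) ->
  ctrl_norm (fun i => uK K i - uo i) @[K --> \oo] --> 0.
Proof.
move=> rho0 uoP uKP.
have path (L : R -> L2 mu -> L2 mu) : (forall f, ucont_path tF (L^~ f)) ->
    (forall t, 0 <= t -> l2linear (L t)) ->
    path_operator (fun i t => L (tF - t) (beta i)) (Theta L).
  move=> Lc Ll; apply: (bochner_path_operator tF0) => [i|u t].
    exact: (ucont_path_rev (Lc (beta i))).
  rewrite /= in_itv/= => /andP[_ tT]; apply: l2linear_comb; apply: Ll.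
  by rewrite subr_ge0 ltW.
have pS : path_operator (fun i t => S (tF - t) (beta i)) (Theta S).
  apply: path => [f|t t0]; first exact: (C0_ucont_path HS).
  exact: (C0_linear HS).
have XV K : X K `<=` V by move=> u /XH /HV.
have pK K : path_operator (fun i t => E K (tF - t) (P K (beta i)))
    (Theta (fun t f => E K t (P K f))).
  apply: path => [f|t _].
    exact: (galerkin_exp_ucont HV Bl Bx kappa_ge0 kappa0_gt0 garding (hX K) (@XH K)
      (@AP K) (@EP K) tF0 (PP K f).1).
  by apply: (exp_proj_linear (hX K) _ Bx (@AP K) (@EP K) (PP K)) => k u u' v Xu Xu' _;
    apply: Bl; exact: (XV K).
apply: (minimizers_cvg tF0 pS pK _ rho0 uoP uKP) => e e0.
have conv i := galerkin_cvg HV Bl Bx l2h1 CB0 BC kappa_ge0 kappa0_gt0 garding HS gen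
  hX XH approx AP EP PP tF0 (beta i) e0.
have [N NP] := choice conv.
exists (\max_i N i)%N => K NK i t t0 tT.
apply: NP; first by apply: leq_trans NK; exact: leq_bigmax.
  by rewrite subr_ge0.
by rewrite gerBl.
Qed.

End galerkin_control.

Theorem proposition4p4 (R : realType) (d m : nat) (O : set 'rV[R]_d)
    (oO : open O) (tF : R)
    (a : 'I_d -> 'I_d -> Loo (dom_measure oO))
    (b : 'I_d -> Loo (dom_measure oO)) (c : Loo (dom_measure oO))
    (kappa kappa0 : R)
    (SA : R -> L2 (dom_measure oO) -> L2 (dom_measure oO))
    (beta : 'I_m -> L2 (dom_measure oO)) (fS : L2 (cyl_measure oO tF))
    (g theta_r : L2 (dom_measure oO)) (rho : R)
    (X : nat -> set (L2 (dom_measure oO)))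
    (uo : ctrl m tF) (uK : nat -> ctrl m tF) :
  let B := bform a b c in
  let Theta := ctrl_to_state SA beta in
  let ThetaK K := ctrl_to_state
    (fun t f => exp_op (galerkin_op B (X K)) t (orth_proj (X K) f)) beta in
  let theta_ro := theta_r - free_state SA tF fS g in
  bounded_set O -> connected O -> 0 < tF -> (0 < m)%N ->
  (forall i j, a i j = a j i %[ae (dom_measure oO)]) ->
  0 <= kappa -> 0 < kappa0 ->
  (forall phi, H10 phi ->
    kappa0 * h1norm phi ^+ 2 <= B phi phi + kappa * l2norm phi ^+ 2) ->
  C0_semigroup SA ->
  (forall phi w, generator SA phi w <-> form_operator B phi w) ->
  0 < rho ->
  (forall K, fin_dim_subspace (X K) /\ X K `<=` @H10 R d O oO) ->
  (forall psi, H10 psi -> exists psiK, (forall K, X K (psiK K)) /\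
    h1norm (psi - psiK K) @[K --> \oo] --> 0) ->
  is_minimizer (cost Theta theta_ro rho) uo ->
  (forall K, is_minimizer (cost (ThetaK K) theta_ro rho) (uK K)) ->
  ctrl_norm (fun i => uK K i - uo i) @[K --> \oo] --> 0.
Proof.
move=> B Theta ThetaK theta_ro _ _ tF0 _ _ kappa_ge0 kappa0_gt0 garding HSA gen rho0
  XP approx uoP uKP.
have H10_dense f e : 0 < e -> exists p, @H10 R d O oO p /\ l2norm (f - p) <= e.
  move=> e0; have [p [w [pw fp]]] := C0_generator_dense HSA f e0.
  by exists p; split => //; have [] := (gen p w).1 pw.
have HV : @H10 R d O oO `<=` @H1 R d O oO by move=> u [].
have Bl := bform_linearl a b c H10_dense.
have Br := bform_linearr a b c H10_dense.
have Bx := bform_ext a b c.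
have [CB CB0 BC] := bform_bound a b c.
have hX K : fin_dim_subspace (X K) := (XP K).1.
have XH K : X K `<=` @H10 R d O oO := (XP K).2.
have XV K : X K `<=` @H1 R d O oO by move=> u /XH /HV.
have AP K u : X K u -> X K (galerkin_op B (X K) u) /\
    forall v, X K v -> l2dot (galerkin_op B (X K) u) v = - B u v.
  move=> Xu; have Br' k u' v v' : X K u' -> X K v -> X K v' ->
      B u' (k *: v + v') = k * B u' v + B u' v'.
    by move=> _ Xv Xv'; apply: Br; exact: (XV K).
  exact: (xgetPex 0 (galerkin_exists (hX K) Br' Bx Xu)).
have Bl' K k u u' v : X K u -> X K u' -> X K v -> B (k *: u + u') v = k * B u v + B u' v.
  by move=> Xu Xu' _; apply: Bl; exact: (XV K).
have EP K t f (Xf : X K f) := exp_op_spec (hX K) (Bl' K) Bx (AP K) t Xf.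
exact: (galerkin_minimizers_cvg HV Bl Bx (@l2norm_le_h1norm _ _ _ oO) CB0 BC kappa_ge0
  kappa0_gt0 garding HSA (fun phi w => (gen phi w).1) hX XH approx AP EP
  (fun K => orth_projP (hX K)) tF0 rho0 uoP uKP).
Qed.
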